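(* Let $d\ge1$ be an integer, let $s\in\{1,\ldots,d\}$, and let $n\ge2$ be an integer power of $2$. Let $A_T\subseteq[0,1]^d$ be any one of the $n$ point sets (each of size $n$) output by the algorithm $\mathsf{WSubgTrans}$ (defined in the context) run with the weights $\gamma_1=\cdots=\gamma_s=1$ and $\gamma_{s+1}=\cdots=\gamma_d=0$. Then for every function $f:[0,1]^d\to\mathbb{R}$ that has a Fourier decomposition $f(\boldsymbol{x})=\sum_{\boldsymbol{k}\in\mathbb{Z}^d}\widehat f(\boldsymbol{k})\exp(2\pi i\langle\boldsymbol{k},\boldsymbol{x}\rangle)$, the integration error satisfies $$\mathbb{E}\big[(\mathsf{err}(A_T,f))^2\big]\le O_s(1)\cdot\inf_{f=g+h,\ h\in\widetilde{\mathcal{F}}_s}\left(\frac{\log n}{n}\,\sigma(g)^2+\frac{(\log(dn))^{s+1}}{n^2}\,\sigma_{\mathsf{SO}}(h)^2\right),$$ where the infimum is over all decompositions of $f$ as the sum of two functions $g,h:[0,1]^d\to\mathbb{R}$ with $g\in L^2([0,1]^d)$ arbitrary and $h\in\widetilde{\mathcal{F}}_s$, where $\widetilde{\mathcal{F}}_s$ is the class of functions that depend only on the variables $x_1,\ldots,x_s$, and $$\sigma_{\mathsf{SO}}(h)^2:=\sum_{\boldsymbol{k}\in\mathbb{Z}^d\setminus\{\boldsymbol0\}}\big|\widehat h(\boldsymbol{k})\big|^2\Big(\sum_{\emptyset\ne u\subseteq\{1,\ldots,d\}}\ \prod_{j\in u}|k_j|\Big).$$ Here the expectation is over all randomness of the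 algorithm, and $O_s(1)$ denotes a constant depending only on $s$.
   Context: Integration error and variance. For a finite set $A\subseteq[0,1]^d$, $\mathsf{err}(A,f):=\frac1{|A|}\sum_{\boldsymbol{x}\in A}f(\boldsymbol{x})-\int_{[0,1]^d}f(\boldsymbol{x})\,d\boldsymbol{x}$. For $g\in L^2([0,1]^d)$, $\sigma(g)^2:=\int g^2-(\int g)^2$ (integrals over $[0,1]^d$). $\widehat h(\boldsymbol{k})$ denotes the $\boldsymbol{k}$-th Fourier coefficient of $h$. Dyadic boxes. For $j\in\{0,1,2,\ldots\}$, $\mathcal{D}_j:=\{(\ell/2^j,(\ell+1)/2^j]:\ell=0,\ldots,2^j-1\}$; $\mathcal{D}_{\le L}:=\bigcup_{j\le L}\mathcal{D}_j$; $\mathcal{D}_{\le L}^{\otimes d}:=\{I_1\times\cdots\times I_d: I_j\in\mathcal{D}_{\le L}\text{ for all }j\}$. The weight of a box $B=B_1\times\cdots\times B_d\in\mathcal{D}_{\le L}^{\otimes d}$ is $\gamma(B):=\prod_{j:\,B_j\neq(0,1]}\gamma_j$ (empty product $=1$). Thus, for the weights above, $\gamma(B)=1$ if $B_j=(0,1]$ for all $j>s$, and $\gamma(B)=0$ otherwise. Self-Balancing Walk. Input: vectors $\boldsymbol{v}_1,\ldots,\boldsymbol{v}_N\in\mathbb{R}^m$ of Euclidean norm at most $1$ and a failure parameter $\delta$. Set $\boldsymbol{w}_0=\boldsymbol 0$, $\lambda=30\log(mN/\delta)$. For $j=1,\ldots,N$: if $|\langle\boldsymbol{w}_{j-1},\boldsymbol{v}_j\rangle|>\lambda$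 or $\|\boldsymbol{w}_{j-1}\|_\infty>\lambda$, fail; otherwise set $p_j=\frac12-\frac{\langle\boldsymbol{w}_{j-1},\boldsymbol{v}_j\rangle}{2\lambda}$, let $c_j=1$ with probability $p_j$ and $c_j=-1$ with probability $1-p_j$ (fresh randomness), and set $\boldsymbol{w}_j=\boldsymbol{w}_{j-1}+c_j\boldsymbol{v}_j$. Output $(c_1,\ldots,c_N)\in\{\pm1\}^N$. Convention: $\delta\in(0,1/2]$ with $\log(1/\delta)=O(\log(mN))$, and a failed run is repeated with fresh randomness until it succeeds. $\mathsf{BalSubgDisc}$. Input: vectors $\boldsymbol{v}_1,\ldots,\boldsymbol{v}_N$ with $N$ even. Apply Self-Balancing Walk to $\boldsymbol{v}_1-\boldsymbol{v}_2,\boldsymbol{v}_3-\boldsymbol{v}_4,\ldots,\boldsymbol{v}_{N-1}-\boldsymbol{v}_N$, all divided by the common factor $2\max_j\|\boldsymbol{v}_j\|_2$ so that their norms are at most $1$, to get signs $x_1,\ldots,x_{N/2}$; output the balanced coloring $c_{2i-1}=x_i$, $c_{2i}=-x_i$. Algorithm $\mathsf{WSubgTrans}$. Let $L=O(\log(dn))$ be the level parameter, i.e. $L=\lceil C\log(dn)\rceil$ with $C$ a sufficiently large absolute constant. Sample a shift $\boldsymbol{\tau}$ uniformly from $[0,1)^d$ and shift the dyadic system $\mathcal{D}_{\le L}^{\otimes d}$ by $\boldsymbol{\tau}$, coordinatewise modulo $1$; below, ''$\boldsymbol{z}\in B$'' refers to the shifted box $B+\boldsymbol{\tau}$ mod $1$.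 Let $T=\log_2 n$, and let $A_0^{(0)}$ consist of $n^2$ independent uniform samples from $[0,1]^d$. For $t=0,\ldots,T-1$ and $i=0,\ldots,2^t-1$: put $A_t=A_t^{(i)}$; list its points as $\boldsymbol{z}_1,\ldots,\boldsymbol{z}_{|A_t|}$; to each $\boldsymbol{z}_j$ associate the vector $\boldsymbol{v}_j=\big(\boldsymbol{e}_j,(\gamma(B)\mathbf{1}_{\{\boldsymbol{z}_j\in B\}})_{B\in\mathcal{D}_{\le L}^{\otimes d}}\big)$, where $\boldsymbol{e}_j\in\{0,1\}^{|A_t|}$ is the $j$-th standard basis vector, and where coordinates indexed by boxes with $\gamma(B)=0$ (identically zero) are dropped, so that they do not count toward the dimension $m$; let $\boldsymbol{c}_t\in\{\pm1\}^{|A_t|}$ be the output of $\mathsf{BalSubgDisc}$ on $(\boldsymbol{v}_j)_j$; set $A_{t+1}^{(2i)}=\{\boldsymbol{z}_j\in A_t:c_{t,j}=-1\}$ and $A_{t+1}^{(2i+1)}=\{\boldsymbol{z}_j\in A_t:c_{t,j}=+1\}$. Output the $2^T=n$ sets $A_T^{(i)}$, $0\le i<n$, each of size $n$; $A_T$ denotes any one of them (fixed index $i$). *)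

(* Defs.v *)
From HB Require Import structures.
From mathcomp Require Import all_boot all_order all_algebra.
From mathcomp Require Import complex.
From mathcomp Require Import all_classical all_reals all_analysis.
Set Implicit Arguments.
Unset Strict Implicit.
Unset Printing Implicit Defensive.
Import Order.TTheory GRing.Theory Num.Theory.
Import numFieldNormedType.Exports.
Local Open Scope classical_set_scope.
Local Open Scope ring_scope.

Section TupleProbability.
Context (dT : measure_display) (T : measurableType dT) (R : realType).

Definition tuple_cons n (p : T * n.-tuple T) : n.+1.-tuple T :=
  [tuple of p.1 :: p.2].

Lemma measurable_tuple_cons n : measurable_fun setT (@tuple_cons n).
Proof. exact: measurable_cons. Qed.

HB.instance Definition _ n :=
  isMeasurableFun.Build _ _ _ _ (@tuple_cons n) (@measurable_tuple_cons n).

Variable P : probability T R.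

(* The law of n independent samples of P. *)
Fixpoint tuple_prob n : probability (n.-tuple T) R :=
  match n with
  | 0 => @dirac _ (0.-tuple T) [tuple] R
  | n'.+1 => distribution (P \x tuple_prob n')%E (@tuple_cons n')
  end.

End TupleProbability.

(* A function on [0,1]^d is represented by a total function on d.-tuple R; only
   its values on [cube R d] are ever used. *)
Section Cube.
Context (R : realType).

Definition vec (d : nat) := d.-tuple (measurableTypeR R).

Definition cube d : set (vec d) :=
  [set x | forall i, 0 <= tnth x i :> R /\ tnth x i <= 1 :> R].

Definition half_open_cube d : set (vec d) :=
  [set x | forall i, 0 <= tnth x i :> R /\ tnth x i < 1 :> R].

(* Lebesgue measure on [0,1]^d. *)
Definition unif d : probability (vec d) R :=
  tuple_prob (uniform_prob (@ltr01 R)) d.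

Definition integ d (f : vec d -> R) : R := \int[unif d]_(x in @cube d) f x.

Definition L2 d (f : vec d -> R) : Prop :=
  measurable_fun (@cube d) f /\
  (\int[unif d]_(x in @cube d) (f x ^+ 2)%:E < +oo)%E.

Definition sigma2 d (g : vec d -> R) : R :=
  integ (fun x => g x ^+ 2) - integ g ^+ 2.

Definition depends_on_first d (s : nat) (h : vec d -> R) : Prop :=
  forall x y : vec d, @cube d x -> @cube d y ->
    (forall i : 'I_d, (i < s)%N -> tnth x i = tnth y i) -> h x = h y.

End Cube.

Section Fourier.
Context (R : realType) (d : nat).
Local Open Scope complex_scope.

Definition freq := {ffun 'I_d -> int}.

Definition freq_dot (k : freq) (x : vec R d) : R :=
  \sum_(i < d) (k i)%:~R * (tnth x i : R).

(* exp(2 pi i <k, x>) *)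
Definition character (k : freq) (x : vec R d) : R[i] :=
  cos (2 * pi * freq_dot k x) +i* sin (2 * pi * freq_dot k x).

Definition cinteg (u : vec R d -> R[i]) : R[i] :=
  integ (fun x => complex.Re (u x)) +i* integ (fun x => complex.Im (u x)).

Definition fourier_coef (f : vec R d -> R) (k : freq) : R[i] :=
  cinteg (fun x => (f x)%:C * character (- k) x).

Definition freq_box (K : nat) (e : {ffun 'I_d -> 'I_(K.*2.+1)}) : freq :=
  [ffun i => (e i)%:Z - K%:Z].

Definition fourier_sum (f : vec R d -> R) (K : nat) (x : vec R d) : R[i] :=
  \sum_(e : {ffun 'I_d -> 'I_(K.*2.+1)})
     fourier_coef f (freq_box e) * character (freq_box e) x.

(* Convergence of the Fourier series is meant in L^2([0,1]^d). *)
Definition has_fourier_decomposition (f : vec R d -> R) : Prop :=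
  L2 f /\
  (\int[unif R d]_(x in @cube R d)
     ((ComplexField.Normc.normc ((f x)%:C - fourier_sum f K x)) ^+ 2)%:E)%E
    @[K --> \oo] --> 0%E.

Definition SO_weight (k : freq) : R :=
  \sum_(u : {set 'I_d} | u != finset.set0) \prod_(j in u) `|(k j)%:~R : R|.

Definition sigmaSO2 (h : vec R d -> R) : \bar R :=
  \esum_(k in [set k : freq | k <> 0])
    ((ComplexField.Normc.normc (fourier_coef h k)) ^+ 2 * SO_weight k)%:E.

End Fourier.

(* A finitely supported law is the list of its weighted outcomes; the same
   outcome may be listed several times. *)
Section Law.
Context (R : realType).

Definition law (A : Type) := seq (R * A).

Definition dret A (a : A) : law A := [:: (1, a)].

Definition dbind A B (mu : law A) (k : A -> law B) : law B :=
  flatten [seq [seq (p.1 * q.1, q.2) | q <- k p.2] | p <- mu].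

Definition dmap A B (f : A -> B) (mu : law A) : law B :=
  [seq (p.1, f p.2) | p <- mu].

Definition dcoin (p : R) : law bool := [:: (p, true); (1 - p, false)].

Definition expect A (mu : law A) (F : A -> R) : R :=
  \sum_(p <- mu) p.1 * F p.2.

Definition fail_prob A (mu : law (option A)) : R :=
  \sum_(p <- mu | ~~ isSome p.2) p.1.

(* Independent runs of mu are made until one does not fail ([None]): the
   outcome a has probability \sum_r (fail_prob mu)^r * mu (Some a). *)
Definition retry A (mu : law (option A)) : law A :=
  pmap (fun p => omap (fun a =>
          (limn (series (geometric p.1 (fail_prob mu))), a)) p.2) mu.

End Law.

(* Signs are booleans, with true standing for +1. *)
Section Walk.
Context (R : realType) (m : nat).

Definition sgn (c : bool) : R := if c then 1 else -1.

Definition dot (u v : 'rV[R]_m) : R := \sum_(k < m) u 0 k * v 0 k.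

Definition norm2 (v : 'rV[R]_m) : R := Num.sqrt (dot v v).

Definition norm_infty (v : 'rV[R]_m) : R := \big[Num.max/0]_(k < m) `|v 0 k|.

Fixpoint walk_from (lambda : R) (w : 'rV[R]_m) (vs : seq 'rV[R]_m) :
    law R (option (seq bool)) :=
  if vs is v :: vs' then
    if (lambda < `|dot w v|) || (lambda < norm_infty w) then dret R None
    else dbind (dcoin (1 / 2 - dot w v / (2 * lambda))) (fun c =>
           dmap (omap (cons c)) (walk_from lambda (w + sgn c *: v) vs'))
  else dret R (Some [::]).

Definition self_balancing_walk (delta : R) (vs : seq 'rV[R]_m) :=
  walk_from (30 * ln ((m * size vs)%:R / delta)) 0 vs.

Fixpoint pair_diffs (vs : seq 'rV[R]_m) : seq 'rV[R]_m :=
  if vs is u :: v :: vs' then (u - v) :: pair_diffs vs' else [::].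

Definition balanced (xs : seq bool) : seq bool :=
  flatten [seq [:: x; ~~ x] | x <- xs].

(* The failure parameter [delta m N] may depend on the dimension m and on the
   number N of vectors given to the walk. *)
Definition bal_subg_disc (delta : nat -> nat -> R) (vs : seq 'rV[R]_m) :
    law R (seq bool) :=
  let M := \big[Num.max/0]_(v <- vs) norm2 v in
  let us := [seq (2 * M)^-1 *: u | u <- pair_diffs vs] in
  dmap balanced (retry (self_balancing_walk (delta m (size us)) us)).

End Walk.

Section DyadicBoxes.
Context (R : realType) (d L : nat).

(* The pair of j and l stands for the interval (l/2^j, (l+1)/2^j]; distinct
   pairs give distinct intervals, and the interval is (0,1] iff j = 0. *)
Definition dyadic := {j : 'I_L.+1 & 'I_(2 ^ j)}.

Definition in_dyadic (I : dyadic) (b : R) : Prop :=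
  (tagged I)%:R / 2 ^+ tag I < b /\ b <= (tagged I).+1%:R / 2 ^+ tag I.

Definition box := {ffun 'I_d -> dyadic}.

Definition shifted_box (tau : vec R d) (B : box) : set (vec R d) :=
  [set z | forall i, exists b : R, exists k : int,
     in_dyadic (B i) b /\ (tnth z i : R) = b + (tnth tau i : R) + k%:~R].

Definition box_weight (gamma : 'I_d -> R) (B : box) : R :=
  \prod_(j | tag (B j) != ord0) gamma j.

Definition active_box (gamma : 'I_d -> R) := {B : box | box_weight gamma B != 0}.

End DyadicBoxes.

Section WSubgTrans.
Context (R : realType) (d L N : nat).
Context (gamma : 'I_d -> R) (delta : nat -> nat -> R).

(* The sample points are z_0, ..., z_(N-1), and their subsets are represented
   by sets of labels in 'I_N; [listing A] is the order in which the points of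
   A are listed. *)
Context (listing : {set 'I_N} -> seq 'I_N).
Context (tau : vec R d) (z : N.-tuple (vec R d)).

Definition coord (l : seq 'I_N) := ('I_(size l) + active_box L gamma)%type.

Definition point_vector (l : seq 'I_N) (j : 'I_(size l)) :
    'rV[R]_#|{: coord l}| :=
  \row_(k < #|{: coord l}|)
    match enum_val k with
    | inl j' => (j' == j)%:R
    | inr B => box_weight gamma (val B) *
               \1_(shifted_box tau (val B)) (tnth z (tnth (in_tuple l) j))
    end.

Definition split_set (A : {set 'I_N}) : law R ({set 'I_N} * {set 'I_N}) :=
  let l := listing A in
  dmap (fun c => ([set a in mask (map negb c) l]%SET, [set a in mask c l]%SET))
    (bal_subg_disc delta [seq point_vector j | j <- enum 'I_(size l)]).

(* The sets A_t^(0), A_t^(1), ... are kept in a list, so that the two parts of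
   the i-th set get positions 2i and 2i+1. *)
Fixpoint split_all (As : seq {set 'I_N}) : law R (seq {set 'I_N}) :=
  if As is A :: As' then
    dbind (split_set A) (fun p =>
      dmap (fun r => p.1 :: p.2 :: r) (split_all As'))
  else dret R [::].

Definition wsubgtrans (T : nat) : law R (seq {set 'I_N}) :=
  iter T (fun mu => dbind mu split_all) (dret R [:: [set: 'I_N]%SET]).

Definition err (A : {set 'I_N}) (f : vec R d -> R) : R :=
  (#|A|%:R)^-1 * (\sum_(a in A) f (tnth z a)) - integ f.

End WSubgTrans.

Section MeanSquareError.
Context (R : realType) (d L N : nat).
Context (gamma : 'I_d -> R) (delta : nat -> nat -> R).
Context (listing : {set 'I_N} -> seq 'I_N).

Definition sample_space : set (vec R d * N.-tuple (vec R d)) :=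
  [set w | half_open_cube w.1 /\ forall a, cube (tnth w.2 a)].

(* E[err(A_T^(i), f)^2] over the shift, the samples and the walks. *)
Definition mean_sq_err (T i : nat) (f : vec R d -> R) : \bar R :=
  (\int[unif R d \x tuple_prob (unif R d) N]_(w in sample_space)
     (expect (wsubgtrans L gamma delta listing w.1 w.2 T)
        (fun As => err w.2 (nth finset.set0 As i) f ^+ 2))%:E)%E.

End MeanSquareError.

Definition level (R : realType) (C : R) (d n : nat) : nat :=
  `|Num.ceil (C * ln (d * n)%:R)|%N.

(* The convention on the failure parameter, with implied constant Cdelta. *)
Definition admissible_failure (R : realType) (Cdelta : R)
    (delta : nat -> nat -> R) : Prop :=
  forall m N : nat, (1 < m * N)%N ->
    [/\ 0 < delta m N, delta m N <= 1 / 2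
      & ln (1 / delta m N) <= Cdelta * ln (m * N)%:R].

Definition first_weights (R : realType) (d s : nat) (j : 'I_d) : R :=
  (j < s)%N%:R.

Definition error_bound (R : realType) (d s n : nat) (f : vec R d -> R) :
    \bar R :=
  ereal_inf [set e : \bar R | exists g h : vec R d -> R,
    [/\ L2 g, depends_on_first s h,
        (forall x, cube x -> f x = g x + h x) &
        e = ((ln n%:R / n%:R * sigma2 g)%:E +
             (ln (d * n)%:R ^+ s.+1 / n%:R ^+ 2)%:E * sigmaSO2 h)%E]].

(* Main.v *)
(* Fix a truncation level M and write f - int f = g' + h' on the cube, where h'
   is the trigonometric polynomial formed by the Fourier coefficients of h at the
   nonzero frequencies in the box of size M, and g' is the rest.  By Bessel's
   inequality E g'^2 is at most twice the squared truncation error of f plus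
   2 sigma(g)^2, so letting M tend to infinity it suffices to treat a
   trigonometric polynomial h' with frequencies supported on the first s
   coordinates plus a square-integrable g' of mean zero.

   Sampling the characters at the left endpoints of the shifted dyadic cells and
   telescoping over the levels writes h' as a sum over boxes of phi_B(tau) 1_B,
   plus a remainder of order 2^-L in mean square.  After averaging over the shift
   tau, orthogonality of characters bounds the sum of the phi_B^2 by
   121^s sigma_SO(h)^2.

   The signs c_j of the self-balancing walk on v_1, v_2, ... satisfy
   E (sum_j c_j (theta_j + <v_j, phi>))^2 <= const (|theta|^2 + lambda |phi|^2)
   for all theta and phi, because this quadratic bound can be propagated
   backwards along the walk.  A walk fails with probability at most 1/2 (the same
   backward induction for an exponential moment), and by symmetry the signs have
   mean zero even conditionally on success; so the normalized errors along the
   splitting tree form a martingale whose increments have geometrically growing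
   second moments.  Here theta collects g' and the remainder, while phi collects
   the coefficients phi_B. *)
From HB Require Import structures.
Require Import Defs.
From mathcomp Require Import all_boot all_order all_algebra.
From mathcomp Require Import complex.
From mathcomp Require Import all_classical all_reals all_analysis.
From mathcomp Require Import measurable_realfun ring lra zify.
Set Implicit Arguments.
Unset Strict Implicit.
Unset Printing Implicit Defensive.
Import Order.TTheory GRing.Theory Num.Theory.
Import numFieldNormedType.Exports.
Local Open Scope ring_scope.

(** * Self-balancing walks *)

(** The exponent s+1 of the logarithm has two sources. One factor is lambda, a logarithm of a box
    count that is exponential in L s; the other s factors are the squared norm of a point vector,
    since a point lies in one box for each choice of levels in the first s coordinates. The number
    theta_j stays attached to its sign and is not encoded in the basis coordinates of the vectors.
    It is then charged without lambda, so the rough part costs a constant times sigma(g)^2/n, and ln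
    n >= 1/2 gives the required form. sigma_SO is linear in each |k_j|, whereas moving the argument
    of a character by x costs (k x)^2. Boundedness of characters has to be used too: min(4, (2 pi
    k/2^j)^2), summed over the 2^j intervals of each level j, is O(|k|); in the remainder the
    minimum is replaced by a linear bound. For a fixed shift, squares of the phi_B contain cross
    terms between frequencies. The phi_B and, after substituting x = tau + y, the remainder are
    trigonometric polynomials in tau, so the average over tau removes these terms. *)

Section Expect.
Context (R : realType).

Lemma expect_dret A (a : A) (F : A -> R) : expect (dret R a) F = F a.
Proof. by rewrite /expect /dret big_seq1 mul1r. Qed.

Lemma expect_dbind A B (mu : law R A) (k : A -> law R B) F :
  expect (dbind mu k) F = expect mu (fun a => expect (k a) F).
Proof.
rewrite /expect /dbind big_flatten big_map; apply: eq_bigr => p _.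
rewrite big_map big_distrr; apply: eq_bigr => q _ /=.
by rewrite mulrA.
Qed.

Lemma expect_dmap A B (f : A -> B) (mu : law R A) F :
  expect (dmap f mu) F = expect mu (F \o f).
Proof. by rewrite /expect /dmap big_map. Qed.

Lemma expect_dcoin p (F : bool -> R) :
  expect (dcoin p) F = p * F true + (1 - p) * F false.
Proof. by rewrite /expect /dcoin big_cons big_seq1. Qed.

Lemma eq_expect A (mu : law R A) F G : F =1 G -> expect mu F = expect mu G.
Proof. by move=> FG; apply: eq_bigr => p _; rewrite FG. Qed.

Lemma expectD A (mu : law R A) F G :
  expect mu (fun a => F a + G a) = expect mu F + expect mu G.
Proof. by rewrite /expect -big_split; apply: eq_bigr => p _; rewrite mulrDr. Qed.

Lemma expectZ A (mu : law R A) c F :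
  expect mu (fun a => c * F a) = c * expect mu F.
Proof.
by rewrite /expect big_distrr; apply: eq_bigr => p _; rewrite mulrCA.
Qed.

Lemma fail_probE A (mu : law R (option A)) :
  fail_prob mu = expect mu (fun o => (~~ isSome o)%:R).
Proof.
rewrite /fail_prob /expect big_mkcond; apply: eq_bigr => p _.
by case: (isSome p.2) => /=; rewrite ?mulr0 ?mulr1.
Qed.

Definition nneg_law A (mu : law R A) := all (fun p => 0 <= p.1) mu.

Lemma le_expect A (mu : law R A) F G :
  nneg_law mu -> (forall a, F a <= G a) -> expect mu F <= expect mu G.
Proof.
elim: mu => [|p mu IH] /=; first by rewrite /expect !big_nil.
move=> /andP[p0 hmu] FG; rewrite /expect !big_cons.
by apply: lerD; [exact: ler_wpM2l | exact: IH].
Qed.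

Lemma nneg_dbind A B (mu : law R A) (k : A -> law R B) :
  nneg_law mu -> (forall a, nneg_law (k a)) -> nneg_law (dbind mu k).
Proof.
rewrite /dbind => hmu hk; elim: mu hmu => //= p mu IH /andP[p0 hmu].
rewrite /nneg_law all_cat; apply/andP; split; last exact: IH.
rewrite all_map; have := hk p.2; apply: sub_all => q q0 /=.
exact: mulr_ge0.
Qed.

Lemma nneg_dmap A B (f : A -> B) (mu : law R A) :
  nneg_law mu -> nneg_law (dmap f mu).
Proof. by rewrite /nneg_law all_map. Qed.

Lemma lim_geometric (p q : R) : 0 <= q < 1 ->
  limn (series (geometric p q)) = p / (1 - q).
Proof.
move=> /andP[q0 q1]; apply/cvg_lim => //; apply: cvg_geometric_series.
by rewrite ger0_norm.
Qed.

(** Summing the geometric weights shows that repetition until success is conditioning on success. *)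
Lemma expect_retry A (mu : law R (option A)) F :
  0 <= fail_prob mu < 1 ->
  expect (retry mu) F =
  (1 - fail_prob mu)^-1 * expect mu (fun o => if o is Some a then F a else 0).
Proof.
move=> hq; rewrite /retry /expect.
elim: {2 4}mu => [|[p [a|]] mu' IH] /=; rewrite ?big_nil ?mulr0// !big_cons.
  by rewrite IH lim_geometric // mulrDr /=; congr (_ + _); ring.
by rewrite IH /= mulr0 add0r.
Qed.

Lemma nneg_retry A (mu : law R (option A)) :
  nneg_law mu -> 0 <= fail_prob mu < 1 -> nneg_law (retry mu).
Proof.
move=> + hq; rewrite /retry /nneg_law.
elim: {1 3}mu => [|[p [a|]] mu' IH] //= /andP[p0 hmu']; last exact: IH.
rewrite IH // andbT lim_geometric // divr_ge0 // subr_ge0.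
by case/andP: hq => _ /ltW.
Qed.

End Expect.

Section Dot.
Context (R : realType) (m : nat).
Implicit Types u v w : 'rV[R]_m.

Lemma dotC u v : dot u v = dot v u.
Proof. by apply: eq_bigr => k _; rewrite mulrC. Qed.

Lemma dotDl u v w : dot (u + v) w = dot u w + dot v w.
Proof. by rewrite /dot -big_split; apply: eq_bigr => k _; rewrite mxE mulrDl. Qed.

Lemma dotZl c u w : dot (c *: u) w = c * dot u w.
Proof. by rewrite /dot big_distrr; apply: eq_bigr => k _ /=; rewrite mxE mulrA. Qed.

Lemma dotDr u v w : dot w (u + v) = dot w u + dot w v.
Proof. by rewrite dotC dotDl ![dot w _]dotC. Qed.

Lemma dotZr c u w : dot w (c *: u) = c * dot w u.
Proof. by rewrite dotC dotZl dotC. Qed.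

Lemma dotNl u w : dot (- u) w = - dot u w.
Proof. by rewrite -scaleN1r dotZl mulN1r. Qed.

Lemma dotNr u w : dot w (- u) = - dot w u.
Proof. by rewrite dotC dotNl dotC. Qed.

Lemma dot0l w : dot 0 w = 0.
Proof. by rewrite -(scale0r 0) dotZl mul0r. Qed.

Lemma dot_ge0 u : 0 <= dot u u.
Proof. by apply: sumr_ge0 => k _; rewrite -expr2 sqr_ge0. Qed.

Definition dotE := (dotDl, dotDr, dotZl, dotZr, dotNl, dotNr).

Lemma dot_sqr_le u y : dot u u <= 1 -> dot u y ^+ 2 <= dot y y.
Proof.
move=> u1; have := dot_ge0 (y - dot u y *: u).
rewrite !dotE (dotC y u) => h.
have : dot u y ^+ 2 * dot u u <= dot u y ^+ 2 by rewrite ler_piMr ?sqr_ge0.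
move: h; set a := dot u y; set b := dot u u; set c := dot y y => h1 h2.
have -> : a ^+ 2 = 2 * (a * a) - a ^+ 2 by ring.
by move: h1 h2; rewrite !expr2 !mulrA => h1 h2; lra.
Qed.

Lemma norm_inftyN w : norm_infty (- w) = norm_infty w.
Proof. by rewrite /norm_infty; apply: eq_bigr => k _; rewrite mxE normrN. Qed.

Lemma norm2_sqr w : norm2 w ^+ 2 = dot w w.
Proof. by rewrite sqr_sqrtr // dot_ge0. Qed.

End Dot.

(** * One run of the walk: symmetry, second moment, failure probability *)

Section Walk.
Context (R : realType) (m : nat) (lam : R).
Implicit Types (u v w y : 'rV[R]_m).

Definition alive w v := ~~ ((lam < `|dot w v|) || (lam < norm_infty w)).

Lemma expect_walk_cons w v vs F :
  expect (walk_from lam w (v :: vs)) F =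
  if alive w v then
    (1 / 2 - dot w v / (2 * lam)) *
      expect (walk_from lam (w + v) vs) (F \o omap (cons true)) +
    (1 / 2 + dot w v / (2 * lam)) *
      expect (walk_from lam (w - v) vs) (F \o omap (cons false))
  else F None.
Proof.
rewrite /alive /=; case: ifP => _ /=; first by rewrite expect_dret.
rewrite expect_dbind expect_dcoin !expect_dmap /sgn scale1r scaleN1r.
by congr (_ + _ * _); set q := dot w v / _; field.
Qed.

Lemma walk_mass w vs : expect (walk_from lam w vs) (fun=> 1) = 1.
Proof.
elim: vs w => [|v vs IH] w; first by rewrite /= expect_dret.
rewrite expect_walk_cons; case: ifP => // _.
have H (e : bool) w' : expect (walk_from lam w' vs) ((fun=> 1) \o omap (cons e)) = 1.
  by rewrite -[RHS](IH w'); apply: eq_expect.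
by rewrite !H; set q := dot w v / _; field.
Qed.

Hypothesis lam_ge2 : 2 <= lam.

Let lam_gt0 : 0 < lam.
Proof. by rewrite (lt_le_trans _ lam_ge2). Qed.

Lemma alive_drift w v : alive w v -> - 1 <= dot w v / lam <= 1.
Proof.
rewrite /alive negb_or -!leNgt => /andP[+ _].
by rewrite ler_norml ler_pdivrMr // ler_pdivlMr // mulN1r mul1r.
Qed.

Lemma coin_prob w v :
  dot w v / (2 * lam) = (dot w v / lam) / 2.
Proof. by field; rewrite gt_eqF. Qed.

Lemma nneg_walk w vs : nneg_law (walk_from lam w vs).
Proof.
elim: vs w => [|v vs IH] w /=; first by rewrite /nneg_law /= ler01.
case: ifPn => [_|/alive_drift]; first by rewrite /nneg_law /= ler01.
move=> h; apply: nneg_dbind => [|c]; last exact/nneg_dmap/IH.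
by rewrite /nneg_law /= coin_prob; apply/and3P; split=> //; lra.
Qed.

(** The failure tests are even and the drift is odd in [w], so reflecting the position and all signs
    maps the walk to itself. Started at 0, the walk has a symmetric law of signs. *)
Lemma walk_sym w vs F :
  expect (walk_from lam (- w) vs) (F \o omap (map negb)) =
  expect (walk_from lam w vs) F.
Proof.
elim: vs w F => [|v vs IH] w F; first by rewrite /= !expect_dret.
rewrite !expect_walk_cons /alive dotNl normrN norm_inftyN.
case: ifP => // _; rewrite -[RHS]addrC mulNr opprK; congr (_ * _ + _ * _).
- by rewrite -(IH (w - v)) opprB addrC; apply: eq_expect; case.
- by rewrite -(IH (w + v)) opprD; apply: eq_expect; case.
Qed.

(** Bounds the cost of the correction [(al / lam) *: v] that the drift forces on a test vector. The
    factor 1/2 comes from [lam >= 2], and both backward inductions rely on it. *)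
Lemma drift_step (al : R) v :
  dot v v <= 1 -> (al / lam) ^+ 2 * lam * dot v v <= al ^+ 2 / 2.
Proof.
move=> v1; have -> : (al / lam) ^+ 2 * lam = al ^+ 2 / lam by field; rewrite gt_eqF.
apply: (@le_trans _ _ (al ^+ 2 / lam)).
  by rewrite ler_piMr // divr_ge0 ?sqr_ge0 // ltW.
by rewrite ler_wpM2l ?sqr_ge0 // lef_pV2 ?posrE.
Qed.

Definition signed_sum (phi : 'rV[R]_m) (ps : seq ('rV[R]_m * R)) (xs : seq bool) : R :=
  \sum_(q <- zip ps xs) sgn R q.2 * (q.1.2 + dot q.1.1 phi).

(* Backward induction: the upper bound for the expected square of an affine
   functional of the signs keeps the form (affine form of w)^2 + r. *)
Lemma walk_second_moment (ps : seq ('rV[R]_m * R)) (phi : 'rV[R]_m) :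
  all (fun p => dot p.1 p.1 <= 1) ps ->
  exists y r, [/\ lam * dot y y + r / 2 <=
                    \sum_(p <- ps) p.2 ^+ 2 + lam * dot phi phi,
    0 <= r &
    forall a w, expect (walk_from lam w (map fst ps))
      (fun o => if o is Some xs then
         (a + dot w phi + signed_sum phi ps xs) ^+ 2
         else 0) <= (a + dot w y) ^+ 2 + r].
Proof.
elim: ps => [|[u th] ps IH] /=.
  move=> _; exists phi, 0; rewrite big_nil mul0r add0r addr0; split=> // a w.
  by rewrite expect_dret /signed_sum big_nil !addr0.
move=> /andP[u1 /IH[y [r [hyr r0 hE]]]].
(* [al] is the total coefficient of the current sign. That sign has mean [- dot w u / lam], so
   averaging over it moves [y] by [- (al / lam) *: u] and adds at most [al ^+ 2] to [r]. *)
pose al := th + dot y u.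
exists (y - (al / lam) *: u), (r + al ^+ 2); split.
- rewrite big_cons /=.
  have hyu : dot y u = al - th by rewrite /al addrC addKr.
  have h := drift_step al u1.
  have -> : lam * dot (y - (al / lam) *: u) (y - (al / lam) *: u) =
    lam * dot y y - 2 * al * (al - th) + (al / lam) ^+ 2 * lam * dot u u.
    by rewrite !dotE (dotC u y) hyu; field; rewrite gt_eqF.
  have := sqr_ge0 (al - th).
  move: h hyr; set X := _ * dot u u; set Y := lam * dot y y.
  set S := \sum_(_ <- _) _; set Z := lam * _ => h1 h2 h3.
  (* Completing the square leaves [- al ^+ 2], half of which pays for [drift_step] and half for the
     growth of [r / 2]; the term [th ^+ 2] is the one the budget allows. *)
  have -> : Y - 2 * al * (al - th) = Y - al ^+ 2 - (al - th) ^+ 2 + th ^+ 2 by ring.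
  by lra.
- by rewrite addr_ge0 // sqr_ge0.
move=> a w; rewrite expect_walk_cons; case: ifPn => [hal|_]; last first.
  by rewrite addr_ge0 ?sqr_ge0 // addr_ge0 ?sqr_ge0.
have hm := alive_drift hal.
rewrite coin_prob.
have H b w' (e : bool) : a + dot w phi + sgn R e * (th + dot u phi) = b + dot w' phi ->
  expect (walk_from lam w' (map fst ps)) ((fun o => if o is Some xs then
         (a + dot w phi + signed_sum phi ((u, th) :: ps) xs) ^+ 2
         else 0) \o omap (cons e)) <= (b + dot w' y) ^+ 2 + r.
  move=> hb; apply: le_trans (hE b w'); rewrite le_eqVlt; apply/orP; left; apply/eqP.
  apply: eq_expect; case=> //= xs; rewrite /signed_sum big_cons /=.
  by rewrite addrA hb.
have H1 := H (a + th) (w + u) true _; have H2 := H (a - th) (w - u) false _.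
set E1 := expect _ _ in H1 *; set E2 := expect _ _ in H2 *.
have {}H1 : E1 <= (a + th + dot (w + u) y) ^+ 2 + r.
  by apply: H1; rewrite /sgn mul1r !dotE; ring.
have {}H2 : E2 <= (a - th + dot (w - u) y) ^+ 2 + r.
  by apply: H2; rewrite /sgn mulN1r !dotE; ring.
apply: le_trans (_ : (1 / 2 - dot w u / lam / 2) * ((a + th + dot (w + u) y) ^+ 2 + r) +
  (1 / 2 + dot w u / lam / 2) * ((a - th + dot (w - u) y) ^+ 2 + r) <= _).
  by apply: lerD; apply: ler_wpM2l => //; lra.
rewrite !dotE.
have -> : a + th + (dot w y + dot u y) = (a + dot w y) + al by rewrite /al (dotC y u); ring.
have -> : a - th + (dot w y - dot u y) = (a + dot w y) - al by rewrite /al (dotC y u); ring.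
have -> : a + (dot w y - al / lam * dot w u) = (a + dot w y) - al * (dot w u / lam) by ring.
set D := a + dot w y; set q := dot w u / lam.
(* A sign c of mean -q gives E (D + al c)^2 = D^2 - 2 q al D + al^2, which falls short of the
   claimed bound by exactly (al q)^2. *)
rewrite -subr_ge0.
have -> : (D - al * q) ^+ 2 + (r + al ^+ 2) - ((1 / 2 - q / 2) * ((D + al) ^+ 2 + r) +
  (1 / 2 + q / 2) * ((D - al) ^+ 2 + r)) = (al * q) ^+ 2 by field.
exact: sqr_ge0.
Qed.

(** exp x = 1 / exp(-x) <= 1 / (1 - x), and for x <= 1/2 the quadratic times 1 - x is at least 1. *)
Lemma expR_le_quad (x : R) : `|x| <= 1 / 2 -> expR x <= 1 + x + 2 * x ^+ 2.
Proof.
rewrite ler_norml => /andP[x1 x2].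
have h : 1 - x <= expR (- x) by rewrite -[1 - x]/(1 + - x) expR_ge1Dx.
have hx : 0 < 1 - x by lra.
rewrite -[x in expR x]opprK expRN.
apply: (@le_trans _ _ (1 - x)^-1); first by rewrite lef_pV2 ?posrE ?expR_gt0.
rewrite -[leLHS]mul1r ler_pdivrMr // -subr_ge0.
have -> : (1 + x + 2 * x ^+ 2) * (1 - x) - 1 = x ^+ 2 * (1 - 2 * x) by ring.
by apply: mulr_ge0; [exact: sqr_ge0 | lra].
Qed.

(** The linear terms of the quadratic bounds combine to the mean -q al of the coin step, and 1 + t
    <= exp t restores an exponential. Exponential tests therefore keep their form under one step of
    the walk. *)
Lemma coin_mgf (q al : R) : -1 <= q <= 1 -> `|al| <= 1 / 2 ->
  (1 / 2 - q / 2) * expR al + (1 / 2 + q / 2) * expR (- al) <=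
  expR (- (q * al) + 2 * al ^+ 2).
Proof.
move=> hq hal; have h1 := expR_le_quad hal.
have h2 : expR (- al) <= 1 + - al + 2 * al ^+ 2.
  by rewrite -(sqrrN al); apply: expR_le_quad; rewrite normrN.
apply: le_trans (expR_ge1Dx _).
apply: (@le_trans _ _ ((1 / 2 - q / 2) * (1 + al + 2 * al ^+ 2) +
   (1 / 2 + q / 2) * (1 + - al + 2 * al ^+ 2))).
  by apply: lerD; apply: ler_wpM2l => //; lra.
by rewrite le_eqVlt; apply/orP; left; apply/eqP; field.
Qed.

Lemma dot_delta w k : dot w (delta_mx 0 k) = w 0 k.
Proof.
rewrite /dot (bigD1 k) //= big1 ?addr0 ?mxE ?eqxx ?mulr1 // => i /negPf hik.
by rewrite !mxE hik andbF mulr0.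
Qed.

(* A pair (y, r) stands for the bad event <w, y> + r > 0; the walk fails only
   if <w, ±v> > lam or ±w_k > lam at some step. *)
Lemma walk_fail_tests (vs : seq 'rV[R]_m) :
  all (fun v => dot v v <= 1) vs ->
  exists ts : seq ('rV[R]_m * R),
    [/\ size ts = (2 * m.+1 * size vs)%N,
      all (fun t => (dot t.1 t.1 <= 1 / 16) &&
                    (t.2 + 2 * lam * dot t.1 t.1 <= - lam / 8)) ts &
      forall w, expect (walk_from lam w vs) (fun o => (~~ isSome o)%:R) <=
        \sum_(t <- ts) expR (dot w t.1 + t.2)].
Proof.
elim: vs => [|v vs IH] /=.
  by exists [::]; rewrite muln0; split=> // w; rewrite big_nil expect_dret.
move=> /andP[v1 /IH[ts [hsz hall hE]]].
(* Both signs of a direction [y] are tested, scaled by 1/4 with offset -lam/4, so that |<w, y>| >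
   lam makes one exponent positive. The invariant starts with -lam/4 + 2 lam/16 = -lam/8. *)
pose base y : seq ('rV[R]_m * R) :=
  [:: (4^-1 *: y, - lam / 4); (- (4^-1 *: y), - lam / 4)].
(* Going back one step removes the drift from the test vector and adds the cost [2 * al ^+ 2] of
   [coin_mgf] to the offset. The term 2 lam |y|^2 drops by at least 3 al^2, so the invariant
   survives. *)
pose step (t : 'rV[R]_m * R) :=
  let al := dot t.1 v in (t.1 - (al / lam) *: v, t.2 + 2 * al ^+ 2).
(* Failure is detected along [v] or along one of the m coordinate axes: m + 1 directions, hence 2 (m
   + 1) new tests per step. *)
pose us := v :: [seq delta_mx 0 k | k <- enum 'I_m].
have hus : all (fun y => dot y y <= 1) us.
  rewrite /= v1 /= all_map; apply/allP => k _ /=.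
  by rewrite dot_delta mxE !eqxx.
exists (flatten (map base us) ++ map step ts); split.
- rewrite size_cat size_map hsz size_flatten /shape -map_comp.
  rewrite (_ : [seq _ | _ <- us] = nseq (size us) 2%N); last first.
    by elim: us {hus} => //= _ us ->.
  by rewrite sumn_nseq /= size_map size_enum_ord [RHS]mulnS.
- rewrite all_cat; apply/andP; split.
    apply/allP => t /flatten_mapP[y /(allP hus) hy].
    have h16 : lam * dot y y <= lam by rewrite ler_piMr // ltW.
    by rewrite !inE => /orP[]/eqP -> /=; rewrite !dotE ?opprK; apply/andP; split; lra.
  rewrite all_map; apply: sub_all hall => -[y r] /= /andP[hy hr].
  set al := dot y v.
  have hk := drift_step al v1.
  have -> : dot (y - (al / lam) *: v) (y - (al / lam) *: v) =
    dot y y - (2 * al ^+ 2 - (al / lam) ^+ 2 * lam * dot v v) / lam.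
    by rewrite !dotE (dotC v y) -/al; field; rewrite gt_eqF.
  set X := _ * dot v v in hk *.
  have ha := sqr_ge0 al.
  have hX : 0 <= (2 * al ^+ 2 - X) / lam.
    by rewrite divr_ge0 ?(ltW lam_gt0) //; lra.
  have hX2 : 2 * lam * (dot y y - (2 * al ^+ 2 - X) / lam) =
     2 * lam * dot y y - 4 * al ^+ 2 + 2 * X by field; rewrite gt_eqF.
  rewrite hX2.
  by move: hX; set Z := _ / lam => hZ; apply/andP; split; lra.
move=> w; rewrite expect_walk_cons; set B := flatten _; rewrite big_cat /=; case: ifPn => [hal|hd]; last first.
  apply: ler_wpDr; first by apply: sumr_ge0 => t _; exact: expR_ge0.
  have [y yus hy] : exists2 y, y \in us & lam < `|dot w y|.
    move: hd; rewrite /alive negbK => /orP[h|]; first by exists v; rewrite ?inE ?eqxx.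
    move=> h; suff [k hk] : exists k, lam < `|w 0 k|.
      by exists (delta_mx 0 k); rewrite ?dot_delta // inE map_f ?orbT ?mem_enum.
    apply: contrapT => /forallNP hk; move: h; apply/negP; rewrite -leNgt.
    by apply: bigmax_le => [|k _]; [exact: ltW | rewrite leNgt; apply/negP].
  rewrite /B big_flatten big_map.
  have : expR 0 <= \sum_(j <- base y) expR (dot w j.1 + j.2).
    rewrite big_cons big_seq1 /= !dotE.
    have [h|h] := leP 0 (dot w y).
      apply: ler_wpDr; first exact: expR_ge0.
      by rewrite ler_expR; move: hy; rewrite ger0_norm // => hy; lra.
    apply: ler_wpDl; first exact: expR_ge0.
    by rewrite ler_expR; move: hy; rewrite ltr0_norm // => hy; lra.
  rewrite expR0 => /le_trans; apply; rewrite (big_rem y) //=.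
  by apply: ler_wpDr => //; apply: sumr_ge0 => z _; apply: sumr_ge0 => t _; exact: expR_ge0.
apply: ler_wpDl.
  by apply: sumr_ge0 => t _; exact: expR_ge0.
have hm := alive_drift hal; rewrite coin_prob.
have hO (b : bool) w' : expect (walk_from lam w' vs) ((fun o => (~~ isSome o)%:R) \o omap (cons b))
   = expect (walk_from lam w' vs) (fun o => (~~ isSome o)%:R).
  by apply: eq_expect; case.
rewrite !hO big_map.
apply: (@le_trans _ _ ((1 / 2 - dot w v / lam / 2) * (\sum_(t <- ts) expR (dot (w + v) t.1 + t.2)) +
  (1 / 2 + dot w v / lam / 2) * (\sum_(t <- ts) expR (dot (w - v) t.1 + t.2)))).
  by apply: lerD; apply: ler_wpM2l => //; lra.
rewrite !big_distrr -big_split /= big_seq [leRHS]big_seq; apply: ler_sum => -[y r] /(allP hall) /=.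
move=> /andP[hy _]; rewrite !dotE (dotC v y); set al := dot y v.
have hal2 : `|al| <= 1 / 2.
  have := dot_sqr_le y v1; rewrite -(dotC y) -/al => h.
  rewrite -(@ler_sqr _ `|al|) ?nnegrE ?divr_ge0 // real_normK ?num_real //.
  have -> : (1 / 2) ^+ 2 = 1 / 4 :> R by field.
  by lra.
have -> : dot w y + al + r = dot w y + r + al by ring.
have -> : dot w y - al + r = dot w y + r + - al by ring.
have -> : dot w y - al / lam * dot w v + (r + 2 * al ^+ 2) =
   dot w y + r + (- (dot w v / lam * al) + 2 * al ^+ 2) by ring.
rewrite !(expRD (dot w y + r)) !(mulrCA _ (expR (dot w y + r))) -mulrDr.
by apply: ler_wpM2l; [exact: expR_ge0 | exact: coin_mgf].
Qed.

(** At [w = 0] each exponent reduces to its offset, which the invariant bounds by -lam/8. *)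
Lemma walk_fail_le (vs : seq 'rV[R]_m) :
  all (fun v => dot v v <= 1) vs ->
  fail_prob (walk_from lam 0 vs) <= (2 * m.+1 * size vs)%:R * expR (- lam / 8).
Proof.
move=> /walk_fail_tests[ts [hsz hall hE]]; rewrite fail_probE.
apply: le_trans (hE 0) _; rewrite -hsz.
elim: ts hall {hsz hE} => [_|t ts IH] /=; first by rewrite big_nil mul0r.
move=> /andP[/andP[_ ht] /IH hts]; rewrite big_cons -natr1 mulrDl mul1r addrC lerD //.
rewrite ler_expR dot0l add0r; apply: le_trans ht.
by rewrite lerDl mulr_ge0 ?dot_ge0 // mulr_ge0 // ltW.
Qed.

End Walk.

Section Support.
Context (R : realType).

Definition supported A (P : pred A) (mu : law R A) := all (fun p => P p.2) mu.

Lemma supported_dbind A B P Q (mu : law R A) (k : A -> law R B) :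
  supported P mu -> (forall a, P a -> supported Q (k a)) -> supported Q (dbind mu k).
Proof.
rewrite /dbind => hmu hk; elim: mu hmu => //= p mu IH /andP[hp hmu].
rewrite /supported all_cat; apply/andP; split; last exact: IH.
by rewrite all_map; exact: hk.
Qed.

Lemma supported_dmap A B (f : A -> B) P (mu : law R A) :
  supported (fun a => P (f a)) mu -> supported P (dmap f mu).
Proof. by rewrite /supported all_map. Qed.

Lemma eq_expect_in A P (mu : law R A) F G :
  supported P mu -> (forall a, P a -> F a = G a) -> expect mu F = expect mu G.
Proof.
move=> hmu FG; rewrite /expect; elim: mu hmu => [|p mu IH] /=; first by rewrite !big_nil.
by move=> /andP[hp /IH hmu]; rewrite !big_cons hmu FG.
Qed.

Lemma le_expect_in A P (mu : law R A) F G :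
  nneg_law mu -> supported P mu -> (forall a, P a -> F a <= G a) ->
  expect mu F <= expect mu G.
Proof.
move=> + + FG; rewrite /expect; elim: mu => [|p mu IH] /=; first by rewrite !big_nil.
move=> /andP[p0 hmu] /andP[hp hs]; rewrite !big_cons.
by apply: lerD; [apply: ler_wpM2l => //; exact: FG | exact: IH].
Qed.

Lemma supported_retry A P (mu : law R (option A)) :
  supported (fun o => if o is Some a then P a else true) mu -> supported P (retry mu).
Proof.
rewrite /retry /supported; elim: {1 3}mu => [|[p [a|]] mu' IH] //= /andP[ha hmu'].
by rewrite ha IH.
Qed.

Lemma supported_walk m lam w (vs : seq 'rV[R]_m) :
  supported (fun o => if o is Some xs then size xs == size vs else true)
    (walk_from lam w vs).
Proof.
elim: vs w => [|v vs IH] w //=; case: ifP => // _.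
apply: (@supported_dbind _ _ predT) => [|c _]; first by rewrite /supported /=.
apply: supported_dmap; have := IH (w + sgn R c *: v).
by apply: sub_all => -[p [xs|]] //=.
Qed.

End Support.

(** * The walk repeated until it succeeds *)

Section RetriedWalk.
Context (R : realType) (m : nat) (del : R) (us : seq 'rV[R]_m).
Hypothesis hus : all (fun v => dot v v <= 1) us.
Hypothesis hdel : (1 < m * size us)%N -> 0 < del <= 1 / 2.
Hypothesis hm : (0 < size us)%N -> (1 < m)%N.

Let lam := 30 * ln ((m * size us)%:R / del).
Let mu := self_balancing_walk del us.

(** ln X >= 1 - 1/X, applied with X >= 4. *)
Lemma lam_ge2 : (0 < size us)%N -> 2 <= lam.
Proof.
move=> us0; have mN : (2 <= m * size us)%N by rewrite -[2%N]muln1 leq_mul // hm.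
have /andP[d0 d1] := hdel mN.
have hX : 4 <= (m * size us)%:R / del.
  rewrite ler_pdivlMr //.
  by have : 2 <= (m * size us)%:R :> R; [rewrite ler_nat | lra].
set X := _ / _ in hX; have X0 : 0 < X by lra.
have hi : X^-1 <= 1 / 4 by rewrite div1r lef_pV2 ?posrE.
have hi0 : 0 < X^-1 by rewrite invr_gt0.
have h : ln (1 + (X^-1 - 1)) <= X^-1 - 1 by apply: le_ln1Dx; lra.
have e : 1 + (X^-1 - 1) = X^-1 by rewrite addrC subrK.
by rewrite e lnV ?posrE // in h; rewrite /lam -/X; lra.
Qed.

Lemma sbw_fail : 0 <= fail_prob mu <= 1 / 2.
Proof.
rewrite /mu /self_balancing_walk -/lam.
case: (posnP (size us)) => [/size0nil ->|us0].
  by rewrite fail_probE /= expect_dret /= lexx; lra.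
have l2 := lam_ge2 us0; apply/andP; split.
  rewrite fail_probE; have h := nneg_walk l2 0 us.
  rewrite -[leLHS](mul0r (expect (walk_from lam 0 us) (fun=> 1))) -expectZ.
  by apply: le_expect => // a; rewrite mul0r.
apply: le_trans (walk_fail_le l2 hus) _.
have mN : (2 <= m * size us)%N by rewrite -[2%N]muln1 leq_mul // hm.
have /andP[d0 d1] := hdel mN.
have mN2 : 2 <= (m * size us)%:R :> R by rewrite ler_nat.
set N := (m * size us)%:R : R in mN2 *.
have hX : 4 <= N / del by rewrite ler_pdivlMr //; lra.
have hNX : N <= N / del by rewrite ler_pdivlMr //; nra.
rewrite /lam -/N; set X := N / del in hX hNX *.
have X0 : 0 < X by lra.
have hl0 : 0 <= ln X by rewrite ln_ge0 //; lra.
(* Since 30/8 >= 3, the exponential factor is at most X^-3. There are at most 4 X tests, and 4 X^-2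
   <= 1/4. *)
have he : expR (- (30 * ln X) / 8) <= X ^- 3.
  rewrite -[X in _ <= X ^- 3](@lnK _ X) ?posrE // -expRM_natr -expRN ler_expR; lra.
apply: (@le_trans _ _ (4 * X * X ^- 3)).
  apply: ler_pM; rewrite ?expR_ge0 ?ler0n //.
  apply: (@le_trans _ _ (4 * N)); last by lra.
  by rewrite /N -natrM ler_nat mulnA leq_mul2r; apply/orP; right; have := hm us0; lia.
have -> : 4 * X * X ^- 3 = 4 * X^-1 * X^-1 by field; rewrite gt_eqF.
have : X^-1 <= 4^-1 by rewrite lef_pV2 ?posrE //; lra.
have : 0 < X^-1 by rewrite invr_gt0.
by set Y := X^-1; nra.
Qed.

Let sbw_fail1 : 0 <= fail_prob mu < 1.
Proof. by have /andP[-> h] := sbw_fail; lra. Qed.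

Lemma nneg_sbw : nneg_law mu.
Proof.
rewrite /mu /self_balancing_walk -/lam.
case: (posnP (size us)) => [/size0nil ->|us0]; first by rewrite /nneg_law /= ler01.
exact: nneg_walk (lam_ge2 us0) _ _.
Qed.

Lemma nneg_retried : nneg_law (retry mu).
Proof. exact: nneg_retry nneg_sbw sbw_fail1. Qed.

Lemma retried_size : supported (fun xs => size xs == size us) (retry mu).
Proof. exact/supported_retry/supported_walk. Qed.

Lemma retried_mass : expect (retry mu) (fun=> 1) = 1.
Proof.
rewrite expect_retry //.
have -> : expect mu (fun o => if o is Some _ then 1 else 0) = 1 - fail_prob mu.
  have h : expect mu (fun=> 1) = 1 by exact: walk_mass.
  have h2 : expect mu (fun=> 1) = expect mu (fun o => if o is Some _ then 1 else 0) + fail_prob mu.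
    by rewrite fail_probE -expectD; apply: eq_expect; case=> [a|] /=; lra.
  by rewrite h2 in h; exact: (canRL (addrK _) h).
by rewrite mulVf // gt_eqF // subr_gt0; case/andP: sbw_fail1.
Qed.

Lemma retried_sym F :
  expect (retry mu) (F \o map negb) = expect (retry mu) F.
Proof.
rewrite !expect_retry //; congr (_ * _).
rewrite /mu /self_balancing_walk -[RHS]walk_sym oppr0.
by apply: eq_expect; case.
Qed.

(** The potential controls only r/2, which costs a factor 2, and conditioning on an event of
    probability at least 1/2 costs another. Starting from [a = 0] and [w = 0] makes the affine part
    of the bound vanish. *)
Lemma retried_second_moment (ps : seq ('rV[R]_m * R)) phi :
  us = map fst ps -> (0 < size us)%N ->
  expect (retry mu) (fun xs => signed_sum phi ps xs ^+ 2) <=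
  4 * (\sum_(p <- ps) p.2 ^+ 2 + lam * dot phi phi).
Proof.
move=> hps us0; rewrite expect_retry //.
have l2 := lam_ge2 us0.
have : all (fun p => dot p.1 p.1 <= 1) ps.
  by move: hus; rewrite hps all_map.
move=> /(walk_second_moment l2 phi)[y [r [hyr r0 hE]]].
have {hE} := hE 0 0; rewrite !dot0l !addr0 expr0n add0r -hps => hE.
have hE' : expect mu (fun o => if o is Some xs then signed_sum phi ps xs ^+ 2 else 0) <= r.
  apply: le_trans hE; rewrite le_eqVlt; apply/orP; left; apply/eqP.
  by apply: eq_expect; case=> // xs; rewrite add0r.
have /andP[q0 q1] := sbw_fail.
have hi : (1 - fail_prob mu)^-1 <= 2.
  by rewrite -[leRHS]invrK lef_pV2 ?posrE ?invr_gt0 //; lra.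
have hi0 : 0 <= (1 - fail_prob mu)^-1 by rewrite invr_ge0; lra.
apply: (@le_trans _ _ ((1 - fail_prob mu)^-1 * r)); first exact: ler_wpM2l.
apply: (@le_trans _ _ (2 * r)); first exact: ler_wpM2r.
have : 0 <= lam * dot y y by rewrite mulr_ge0 ?dot_ge0 //; lra.
by set Y := lam * dot y y in hyr *; lra.
Qed.

End RetriedWalk.

(** * Balanced colorings as signed sums over consecutive pairs *)

Section Pairs.
Context (T : Type).

Fixpoint pairs (s : seq T) : seq (T * T) :=
  if s is a :: b :: s' then (a, b) :: pairs s' else [::].

Lemma seq2_ind (P : seq T -> Prop) :
  P [::] -> (forall x, P [:: x]) -> (forall x y s, P s -> P (x :: y :: s)) ->
  forall s, P s.
Proof.
move=> h0 h1 h2 s; suff : P s /\ forall x, P (x :: s) by case.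
elim: s => [|y s [IH1 IH2]]; first by split.
by split=> [|x]; [exact: IH2 | exact: h2].
Qed.

Lemma size_pairs s : size (pairs s) = (size s)./2.
Proof. by elim/seq2_ind: s => //= x y s ->. Qed.

Lemma pair_diffs_map (R : realType) m (v : T -> 'rV[R]_m) s :
  pair_diffs (map v s) = [seq v p.1 - v p.2 | p <- pairs s].
Proof. by elim/seq2_ind: s => //= x y s ->. Qed.

Lemma sum_pairs (R : realType) (G : T -> R) s : ~~ odd (size s) ->
  \sum_(p <- pairs s) (G p.1 + G p.2) = \sum_(a <- s) G a.
Proof.
elim/seq2_ind: s => //= [_|x y s IH]; first by rewrite !big_nil.
by rewrite negbK => hs; rewrite !big_cons IH //= addrA.
Qed.

Definition disc (R : realType) (G : T -> R) (s : seq T) (xs : seq bool) : R :=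
  \sum_(q <- zip (pairs s) xs) sgn R q.2 * (G q.1.1 - G q.1.2).

Lemma disc_negb (R : realType) (G : T -> R) s xs :
  disc G s (map negb xs) = - disc G s xs.
Proof.
rewrite /disc; elim: (pairs s) xs => [|p ps IH] [|x xs] /=; rewrite ?big_nil ?oppr0 //.
by rewrite !big_cons IH /= opprD; congr (_ + _); case: x; rewrite /sgn /=; ring.
Qed.

(** Exactly one element of each pair is kept, and its value is half the sum of the pair plus or
    minus half the difference. *)
Lemma sum_mask_balanced (R : realType) (G : T -> R) s xs :
  size s = (size xs).*2 ->
  \sum_(a <- mask (balanced xs) s) G a = (\sum_(a <- s) G a + disc G s xs) / 2.
Proof.
rewrite /disc; elim/seq2_ind: s xs => [|x|x y s IH] [|c xs] //=.
  by rewrite !big_nil addr0 mul0r.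
move=> [hs]; rewrite !big_cons /= -[flatten _]/(balanced xs).
by case: c; rewrite /= ?big_cons IH // /sgn; field.
Qed.

Lemma size_mask_balanced (s : seq T) xs :
  size s = (size xs).*2 -> size (mask (balanced xs) s) = size xs.
Proof.
elim/seq2_ind: s xs => [|x|x y s IH] [|c xs] //= [hs].
by rewrite -[flatten _]/(balanced xs); case: c; rewrite /= IH.
Qed.

Lemma balanced_negb (xs : seq bool) : map negb (balanced xs) = balanced (map negb xs).
Proof. by elim: xs => //= x xs; rewrite /balanced /= => ->. Qed.

End Pairs.

Section BalSubgDisc.
Context (R : realType) (m : nat) (T : eqType) (v : T -> 'rV[R]_m) (s : seq T).
Context (delta : nat -> nat -> R).

Let M := \big[Num.max/0]_(u <- map v s) norm2 u.
Let us := [seq (2 * M)^-1 *: u | u <- pair_diffs (map v s)].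

Lemma max_norm2 a : a \in s -> dot (v a) (v a) <= M ^+ 2.
Proof.
move=> ha; rewrite -norm2_sqr; apply: lerXn2r; rewrite ?nnegrE ?sqrtr_ge0 //.
  by apply: bigmax_ge_id.
by apply: (le_bigmax_seq _ (v a)); rewrite ?map_f.
Qed.

Lemma mem_pairs (p : T * T) : p \in pairs s -> (p.1 \in s) && (p.2 \in s).
Proof.
clear M us; elim/seq2_ind: s => //= x y s' IH; rewrite !inE => /orP[/eqP ->|/IH/andP[-> ->]].
  by rewrite !eqxx orbT.
by rewrite !orbT.
Qed.

(** |a - b|^2 <= 2 |a|^2 + 2 |b|^2 <= 4 M^2. If [M = 0], the inverse is 0 by convention and the
    scaled vectors vanish. *)
Lemma scaled_diff_norm : all (fun u => dot u u <= 1) us.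
Proof.
rewrite /us pair_diffs_map -map_comp all_map; apply/allP => -[a b] /mem_pairs/andP[/= ha hb].
have := max_norm2 ha; have := max_norm2 hb => h1 h2.
have h3 := dot_ge0 (v a + v b); rewrite !dotE (dotC (v b)) in h3.
rewrite dotZl dotZr mulrA -expr2 exprVn.
have [M0|M0] := eqVneq M 0; first by rewrite M0 mulr0 expr0n invr0 mul0r.
rewrite !dotE (dotC (v b)) ler_pdivrMl ?exprn_gt0 // ?mulr1; last first.
  by rewrite mulr_gt0 // lt_neqAle eq_sym M0 /= bigmax_ge_id.
have -> : (2 * M) ^+ 2 = 4 * M ^+ 2 by ring.
move: h1 h2 h3; set X := dot (v a) (v b); lra.
Qed.

Lemma size_us : size us = (size s)./2.
Proof. by rewrite /us size_map pair_diffs_map size_map size_pairs. Qed.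

Hypothesis hM : 0 < M.
Hypothesis hdel : (1 < m * size us)%N -> 0 < delta m (size us) <= 1 / 2.
Hypothesis hm : (0 < size us)%N -> (1 < m)%N.

(** Replacing [phi] by [(2 * M) *: phi] undoes the normalization of the walk input and turns the
    factor 4 into 16 M^2; for [th], the bound (a - b)^2 <= 2 (a^2 + b^2) turns 4 into 8. *)
Lemma disc_second_moment (th : T -> R) (phi : 'rV[R]_m) :
  ~~ odd (size s) -> (0 < size us)%N ->
  expect (retry (self_balancing_walk (delta m (size us)) us))
    (fun xs => disc (fun a => th a + dot (v a) phi) s xs ^+ 2) <=
  8 * \sum_(a <- s) th a ^+ 2 +
  16 * (30 * ln ((m * size us)%:R / delta m (size us))) * M ^+ 2 * dot phi phi.
Proof.
move=> hs us0.
pose ps := [seq ((2 * M)^-1 *: (v p.1 - v p.2), th p.1 - th p.2) | p <- pairs s].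
have hps : us = map fst ps by rewrite /us pair_diffs_map /ps -!map_comp.
have := @retried_second_moment _ _ _ us scaled_diff_norm hdel hm ps ((2 * M) *: phi) hps us0.
have -> : expect (retry (self_balancing_walk (delta m (size us)) us))
    (fun xs => signed_sum ((2 * M) *: phi) ps xs ^+ 2) =
  expect (retry (self_balancing_walk (delta m (size us)) us))
    (fun xs => disc (fun a => th a + dot (v a) phi) s xs ^+ 2).
  apply: eq_expect => xs; congr (_ ^+ 2); rewrite /signed_sum /disc /ps.
  elim: (pairs s) xs => [|p pp IH] [|x xs] /=; rewrite ?big_nil //.
  rewrite !big_cons IH /=; congr (_ * _ + _).
  rewrite !dotE; set X := dot (v p.1) phi; set Y := dot (v p.2) phi.
  by field; rewrite gt_eqF.
move=> /le_trans; apply.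
have : \sum_(p <- ps) p.2 ^+ 2 <= 2 * \sum_(a <- s) th a ^+ 2.
  rewrite -(@sum_pairs _ _ (fun a => th a ^+ 2) s hs) big_map big_distrr /=.
  apply: ler_sum => p _; have := sqr_ge0 (th p.1 + th p.2).
  have -> : 2 * (th p.1 ^+ 2 + th p.2 ^+ 2) = (th p.1 + th p.2) ^+ 2 + (th p.1 - th p.2) ^+ 2 by ring.
  by lra.
rewrite dotZl dotZr; set l := 30 * _; set S1 := \sum_(p <- ps) _; set S2 := \sum_(a <- s) _.
have -> : l * (2 * M * (2 * M * dot phi phi)) = 4 * (l * M ^+ 2 * dot phi phi) by ring.
have -> : 16 * l * M ^+ 2 * dot phi phi = 16 * (l * M ^+ 2 * dot phi phi) by ring.
by set Z := _ * dot phi phi; lra.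
Qed.

End BalSubgDisc.

(** * Splitting a point set *)

Section SplitSet.
Context (R : realType) (d L N : nat) (gamma : 'I_d -> R).
Context (delta : nat -> nat -> R) (Cdelta : R).
Context (listing : {set 'I_N} -> seq 'I_N).
Context (tau : vec R d) (z : N.-tuple (vec R d)).
Hypothesis hdelta : admissible_failure Cdelta delta.
Hypothesis hlisting : forall A, perm_eq (listing A) (enum A).

Local Notation active := (active_box L gamma).
Local Notation l A := (listing A).
Local Notation labels A := (enum 'I_(size (l A))).
Local Notation lab A := (tnth (in_tuple (l A))).
Local Notation pv A := (@point_vector R d L N gamma tau z (l A)).
Local Notation dim A := #|{: Defs.coord L gamma (l A)}|.

Definition max_norm (A : {set 'I_N}) : R :=
  \big[Num.max/0]_(u <- map (pv A) (labels A)) norm2 u.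

Definition walk_input (A : {set 'I_N}) : seq 'rV[R]_(dim A) :=
  [seq (2 * max_norm A)^-1 *: u | u <- pair_diffs (map (pv A) (labels A))].

Definition signs (A : {set 'I_N}) : law R (seq bool) :=
  retry (self_balancing_walk (delta (dim A) (size (walk_input A))) (walk_input A)).

Local Notation M A := (max_norm A).
Local Notation us A := (walk_input A).
Local Notation split := (split_set L gamma delta listing tau z).
Local Notation split_list := (split_all L gamma delta listing tau z).

Definition half (A : {set 'I_N}) (xs : seq bool) : {set 'I_N} :=
  [set a in mask (balanced xs) (l A)]%SET.

Lemma size_listing (A : {set 'I_N}) : size (l A) = #|A|.
Proof. by rewrite (perm_size (hlisting A)) cardE. Qed.

Lemma listing_uniq (A : {set 'I_N}) : uniq (l A).
Proof. by rewrite (perm_uniq (hlisting A)) enum_uniq. Qed.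

Lemma size_walk_input (A : {set 'I_N}) : size (us A) = (#|A|)./2.
Proof. by rewrite /walk_input size_us size_enum_ord size_listing. Qed.

Lemma dim_us (A : {set 'I_N}) : (0 < size (us A))%N -> (1 < dim A)%N.
Proof.
rewrite size_walk_input -size_listing => h.
by rewrite card_sum card_ord; move: h; case: (size _) => [|[|k]].
Qed.

Lemma admissible_us (A : {set 'I_N}) : (1 < dim A * size (us A))%N ->
  0 < delta (dim A) (size (us A)) <= 1 / 2.
Proof. by move=> /hdelta[-> ->]. Qed.

Lemma signs_mass (A : {set 'I_N}) : expect (signs A) (fun=> 1) = 1.
Proof.
by apply: retried_mass; [exact: scaled_diff_norm|exact: admissible_us|exact: dim_us].
Qed.

Lemma nneg_signs (A : {set 'I_N}) : nneg_law (signs A).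
Proof.
by apply: nneg_retried; [exact: scaled_diff_norm|exact: admissible_us|exact: dim_us].
Qed.

Lemma signs_sym (A : {set 'I_N}) F : expect (signs A) (F \o map negb) = expect (signs A) F.
Proof.
by apply: retried_sym; [exact: scaled_diff_norm|exact: admissible_us|exact: dim_us].
Qed.

Lemma signs_size (A : {set 'I_N}) : supported (fun xs => size xs == (#|A|)./2) (signs A).
Proof.
rewrite -(size_walk_input A); exact: retried_size.
Qed.

(** The two parts come from opposite colorings, and the law of the signs is symmetric. Each part has
    the law of [half], so the index of the output set affects only which ancestors are followed. *)
Lemma expect_split (A : {set 'I_N}) (b : bool) F :
  expect (split A) (fun p => F (if b then p.2 else p.1)) =
  expect (signs A) (fun xs => F (half A xs)).
Proof.
rewrite /split_set /bal_subg_disc !expect_dmap; case: b; first exact: eq_expect.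
by rewrite -[RHS]signs_sym; apply: eq_expect => xs /=; rewrite /half -balanced_negb.
Qed.

Lemma split_mass (A : {set 'I_N}) : expect (split A) (fun=> 1) = 1.
Proof. by rewrite (expect_split A true (fun=> 1)) signs_mass. Qed.

Lemma nneg_split (A : {set 'I_N}) : nneg_law (split A).
Proof. exact/nneg_dmap/nneg_dmap/nneg_signs. Qed.

Lemma split_list_mass As : expect (split_list As) (fun=> 1) = 1.
Proof.
elim: As => [|A As IH]; first by rewrite /= expect_dret.
rewrite /= expect_dbind -[RHS](split_mass A); apply: eq_expect => p.
by rewrite expect_dmap -[RHS]IH; exact: eq_expect.
Qed.

Lemma nneg_split_list As : nneg_law (split_list As).
Proof.
elim: As => [|A As IH] /=; first by rewrite /nneg_law /= ler01.
by apply: nneg_dbind => [|p]; [exact: nneg_split | exact: nneg_dmap].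
Qed.

Lemma supported_split_list As k : size As = k ->
  supported (fun r => size r == k.*2) (split_list As).
Proof.
elim: As k => [|A As IH] [|k] //= [/IH hk].
apply: (@supported_dbind _ _ _ predT) => [|p _]; first exact/allP.
by apply: supported_dmap; apply: sub_all hk => p' /= /eqP ->.
Qed.

(** Sets of one level are split independently. Only the parent [i./2] matters; the other splits
    integrate out with mass 1. *)
Lemma expect_split_list As F i : (i < (size As).*2)%N ->
  expect (split_list As) (fun r => F (nth finset.set0 r i)) =
  expect (split (nth finset.set0 As i./2)) (fun p => F (if odd i then p.2 else p.1)).
Proof.
elim: As i => [|A As IH] // i hi; rewrite /= expect_dbind.
have hmass (c : R) : expect (split_list As) (fun=> c) = c.
  by rewrite -[RHS]mulr1 -(split_list_mass As) -expectZ; apply: eq_expect => ?; rewrite mulr1.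
case: i hi => [_|[_|i hi]].
- by apply: eq_expect => p; rewrite expect_dmap; exact: (hmass (F p.1)).
- by apply: eq_expect => p; rewrite expect_dmap; exact: (hmass (F p.2)).
rewrite /= negbK -IH //.
transitivity (expect (split A)
    (fun=> expect (split_list As) (fun r => F (nth finset.set0 r i)) * 1)).
  by apply: eq_expect => p; rewrite expect_dmap mulr1.
by rewrite expectZ split_mass mulr1.
Qed.

Definition halved (F : {set 'I_N} -> R) (A : {set 'I_N}) := expect (signs A) (fun xs => F (half A xs)).

Local Notation wsub := (wsubgtrans L gamma delta listing tau z).

Lemma nneg_wsub T : nneg_law (wsub T).
Proof.
elim: T => [|T IH]; first by rewrite /nneg_law /= ler01.
by apply: nneg_dbind => // As; exact: nneg_split_list.
Qed.

Lemma supported_wsub T : supported (fun As => size As == (2 ^ T)%N) (wsub T).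
Proof.
elim: T => [|T IH] //.
apply: (supported_dbind IH) => As /eqP /supported_split_list.
by rewrite expnS mul2n.
Qed.

Lemma expect_wsub_step T i F : (i < 2 ^ T.+1)%N ->
  expect (wsub T.+1) (fun As => F (nth finset.set0 As i)) =
  expect (wsub T) (fun As => halved F (nth finset.set0 As i./2)).
Proof.
move=> hi; rewrite /= expect_dbind.
apply: (eq_expect_in (supported_wsub T)) => As /eqP hs.
by rewrite expect_split_list ?expect_split // hs -mul2n -expnS.
Qed.

Section Half.
Context (A : {set 'I_N}) (h : nat) (xs : seq bool).
Hypothesis hA : #|A| = h.*2.
Hypothesis hxs : size xs = h.

Lemma mask_listing c : mask c (l A) = map (lab A) (mask c (labels A)).
Proof. by rewrite map_mask map_tnth_enum. Qed.

Lemma sum_labels (G : 'I_N -> R) :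
  \sum_(j <- labels A) G (lab A j) = \sum_(a in A) G a.
Proof.
rewrite -(big_map (lab A) predT G) map_tnth_enum /=.
by rewrite (perm_big _ (hlisting A)) big_enum.
Qed.

Lemma sum_half (G : 'I_N -> R) :
  \sum_(a in half A xs) G a =
  (\sum_(a in A) G a + disc (G \o lab A) (labels A) xs) / 2.
Proof.
under eq_bigl do rewrite inE.
rewrite -big_uniq ?mask_uniq ?listing_uniq // mask_listing big_map.
by rewrite (@sum_mask_balanced _ _ (G \o lab A)) ?sum_labels // size_enum_ord size_listing hA hxs.
Qed.

Lemma card_half : #|half A xs| = h.
Proof.
rewrite cardsE; have /card_uniqP -> : uniq (mask (balanced xs) (l A)).
  by rewrite mask_uniq ?listing_uniq.
by rewrite size_mask_balanced // size_listing hA hxs.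
Qed.

End Half.

Lemma le_halved (A : {set 'I_N}) h F G : #|A| = h.*2 ->
  (forall P : {set 'I_N}, #|P| = h -> F P <= G P) -> halved F A <= halved G A.
Proof.
move=> hA FG; apply: (le_expect_in (nneg_signs A) (signs_size A)) => xs.
by rewrite hA doubleK => /eqP hxs; apply: FG; rewrite (card_half hA).
Qed.

Lemma signs_disc (A : {set 'I_N}) (G : 'I_N -> R) :
  expect (signs A) (disc (G \o lab A) (labels A)) = 0.
Proof.
have := signs_sym A (disc (G \o lab A) (labels A)).
rewrite (_ : _ \o _ = fun xs => -1 * disc (G \o lab A) (labels A) xs); last first.
  by apply/funext => xs /=; rewrite disc_negb mulN1r.
by rewrite expectZ; lra.
Qed.

Context (th : 'I_N -> R) (phi : active -> R).
Let F a := th a +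
  \sum_(B : active) box_weight gamma (val B) * \1_(shifted_box tau (val B)) (tnth z a) * phi B.
Let S (A : {set 'I_N}) := \sum_(a in A) F a.
Let Th (A : {set 'I_N}) := \sum_(a in A) th a ^+ 2.

(** The form propagated from the leaves of the splitting tree to its root: squared mean, energy of
    [th], constant. Only [al] and [be] change with the level. *)
Definition quad (al be : R) (A : {set 'I_N}) : R := (S A / #|A|%:R) ^+ 2 + al * Th A + be.

Let gphi (A : {set 'I_N}) (c : Defs.coord L gamma (l A)) : R :=
  match c with inl _ => 0 | inr B => phi B end.

Let rowphi (A : {set 'I_N}) : 'rV[R]_(dim A) :=
  \row_(k < dim A) gphi (enum_val k).

Let rowphiE (A : {set 'I_N}) k : rowphi A 0 k = gphi (enum_val k).
Proof. by rewrite mxE. Qed.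

Lemma dot_coord (A : {set 'I_N}) (u w : 'rV[R]_(dim A)) (gu gw : Defs.coord L gamma (l A) -> R) :
  (forall k, u 0 k = gu (enum_val k)) -> (forall k, w 0 k = gw (enum_val k)) ->
  dot u w = \sum_(j < size (l A)) gu (inl j) * gw (inl j) +
            \sum_(B : active) gu (inr B) * gw (inr B).
Proof.
move=> hu hw; rewrite /dot; under eq_bigr do rewrite hu hw.
by rewrite -(big_enum_val (fun c => gu c * gw c)) big_sumType.
Qed.

Lemma dot_rowphi (A : {set 'I_N}) : dot (rowphi A) (rowphi A) = \sum_(B : active) phi B ^+ 2.
Proof.
rewrite (dot_coord (@rowphiE A) (@rowphiE A)).
by rewrite big1 ?add0r // => j _; rewrite mul0r.
Qed.

Let gv (A : {set 'I_N}) (j : 'I_(size (l A))) (c : Defs.coord L gamma (l A)) : R :=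
  match c with
  | inl j' => (j' == j)%:R
  | inr B => box_weight gamma (val B) * \1_(shifted_box tau (val B)) (tnth z (lab A j))
  end.

Let pvE (A : {set 'I_N}) j k : pv A j 0 k = gv j (enum_val k).
Proof. by rewrite mxE. Qed.

Lemma dot_pv_rowphi (A : {set 'I_N}) j : th (lab A j) + dot (pv A j) (rowphi A) = F (lab A j).
Proof.
rewrite (dot_coord (pvE j) (@rowphiE A)).
by rewrite big1 ?add0r // => j' _; rewrite mulr0.
Qed.

Context (Q : R).
Hypothesis hQ : forall x : vec R d,
  \sum_(B : active) (box_weight gamma (val B) * \1_(shifted_box tau (val B)) x) ^+ 2 <= Q.

Lemma dot_pv (A : {set 'I_N}) j : 1 <= dot (pv A j) (pv A j) <= 1 + Q.
Proof.
rewrite (dot_coord (pvE j) (pvE j)).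
rewrite (bigD1 j) //= eqxx mulr1 big1 ?addr0; last first.
  by move=> i /negPf ->; rewrite mul0r.
rewrite lerDl lerD2l; apply/andP; split; last exact: hQ.
by apply: sumr_ge0 => B _; rewrite -expr2 sqr_ge0.
Qed.

(** Every point vector has a basis coordinate equal to 1, so the normalization by [2 * M] never
    divides by zero. *)
Lemma M_ge1 (A : {set 'I_N}) : (0 < #|A|)%N -> 1 <= M A.
Proof.
rewrite -size_listing => h; pose j := Ordinal h.
have hj : pv A j \in map (pv A) (labels A) by rewrite map_f // mem_enum.
apply: le_trans (_ : norm2 (pv A j) <= _).
  by rewrite -[1]sqrtr1 ler_sqrt; have /andP[] := dot_pv j => // h1 _; apply: le_trans h1.
by apply: (le_bigmax_seq _ (pv A j)).
Qed.

Lemma M_sqr_le (A : {set 'I_N}) : M A ^+ 2 <= 1 + Q.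
Proof.
have Q0 : 0 <= 1 + Q.
  have := hQ tau; have : 0 <= \sum_(B : active) (box_weight gamma (val B) * \1_(shifted_box tau (val B)) tau) ^+ 2.
    by apply: sumr_ge0 => B _; exact: sqr_ge0.
  lra.
rewrite -[leRHS]sqr_sqrtr // lerXn2r ?nnegrE ?sqrtr_ge0 //; first exact: bigmax_ge_id.
rewrite /max_norm big_map; apply: bigmax_le; first exact: sqrtr_ge0.
by move=> j _; rewrite ler_sqrt //; have /andP[] := dot_pv j.
Qed.

(** Makes lambda uniform over the tree: dimension and length are largest for the full sample, and
    [admissible_failure] absorbs ln(1/delta) into the same logarithm. *)
Lemma lam_le (A : {set 'I_N}) : (1 < #|A|)%N ->
  ln ((dim A * size (us A))%:R / delta (dim A) (size (us A))) <=
  (1 + `|Cdelta|) * ln ((N + #|{: active}|) * N)%:R.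
Proof.
move=> hA; have hs := size_walk_input A.
have us0 : (0 < size (us A))%N by rewrite hs; case: #|A| hA => [|[]].
have hAN : (#|A| <= N)%N by rewrite -[X in (_ <= X)%N]card_ord max_card.
have hdim : dim A = (#|A| + #|{: active}|)%N by rewrite card_sum card_ord size_listing.
have mN : (1 < dim A * size (us A))%N by rewrite (leq_trans (dim_us us0)) // leq_pmulr.
have [d0 d1 hln] := hdelta mN.
have mN0 : 0 < (dim A * size (us A))%:R :> R by rewrite ltr0n ltnW.
rewrite lnM ?posrE ?invr_gt0 // -[_^-1]div1r.
have hl0 : 0 <= ln (dim A * size (us A))%:R :> R by rewrite ln_ge0 // ler1n ltnW.
have h1 : ln (dim A * size (us A))%:R <= ln ((N + #|{: active}|) * N)%:R :> R.
  rewrite ler_ln ?posrE //.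
    rewrite ler_nat; apply: leq_mul; first by rewrite hdim leq_add2r.
    by rewrite hs; apply: leq_trans hAN; lia.
  rewrite ltr0n muln_gt0; have hN : (0 < N)%N by apply: leq_trans hAN; exact: ltnW.
  by rewrite hN ltn_addr.
have hC := ler_norm Cdelta; have hC0 := normr_ge0 Cdelta.
apply: (@le_trans _ _ ((1 + `|Cdelta|) * ln (dim A * size (us A))%:R)).
  rewrite mulrDl (mul1r (ln _)) lerD2l; apply: le_trans hln _.
  exact: ler_wpM2r.
by apply: ler_wpM2l => //; lra.
Qed.

(** Dominates lambda times squared maximal norm times |phi|^2 for every set of the tree at once;
    [1 + Q] bounds the squared norm. *)
Definition Lambda : R :=
  30 * ((1 + `|Cdelta|) * ln ((N + #|{: active}|) * N)%:R) * (1 + Q) *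
  \sum_(B : active) phi B ^+ 2.

Lemma signs_disc_sqr (A : {set 'I_N}) : ~~ odd #|A| -> (0 < #|A|)%N ->
  expect (signs A) (fun xs => disc (F \o lab A) (labels A) xs ^+ 2) <=
  8 * Th A + 16 * (30 * ln ((dim A * size (us A))%:R / delta (dim A) (size (us A)))) *
    M A ^+ 2 * \sum_(B : active) phi B ^+ 2.
Proof.
move=> hodd hA; have M0 : 0 < M A by apply: lt_le_trans (M_ge1 hA).
have us0 : (0 < size (us A))%N by rewrite size_walk_input; move: hodd hA; case: #|A| => [|[]].
have hodd' : ~~ odd (size (labels A)) by rewrite size_enum_ord size_listing.
have := disc_second_moment M0 (@admissible_us A) (@dim_us A)
  (th \o lab A) (rowphi A) hodd' us0.
rewrite dot_rowphi (@sum_labels A (fun a => th a ^+ 2)) => hh.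
apply: le_trans hh; rewrite le_eqVlt; apply/orP; left; apply/eqP.
apply: eq_expect => xs; congr (_ ^+ 2).
by apply: eq_bigr => q _ /=; rewrite !dot_pv_rowphi.
Qed.

(** The mean over a half is (S + D) / |A| with D the discrepancy. D has mean zero, so only E D^2 /
    |A|^2 is added; for the same reason the energy of [th] is halved on average. *)
Lemma halved_quad (A : {set 'I_N}) h al be : #|A| = h.*2 -> (0 < h)%N ->
  halved (quad al be) A <=
  quad (al / 2 + 8 / #|A|%:R ^+ 2) (be + 16 * Lambda / #|A|%:R ^+ 2) A.
Proof.
move=> hA h0.
have hA1 : (1 < #|A|)%N by rewrite hA; lia.
pose D xs := disc (F \o lab A) (labels A) xs.
pose D2 xs := disc ((fun a => th a ^+ 2) \o lab A) (labels A) xs.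
have -> : halved (quad al be) A = expect (signs A) (fun xs =>
   ((S A / #|A|%:R) ^+ 2 + al / 2 * Th A + be) * 1 +
   (2 * S A / #|A|%:R ^+ 2 * D xs + (al / 2 * D2 xs + (#|A|%:R ^+ 2)^-1 * D xs ^+ 2))).
  apply: (eq_expect_in (signs_size A)) => xs.
  rewrite hA doubleK => /eqP hxs; rewrite /quad (card_half hA hxs) /S /Th.
  rewrite !(sum_half hA hxs) -/(S A) -/(Th A) -/(D xs) -/(D2 xs).
  rewrite -muln2 natrM; field.
  by rewrite pnatr_eq0 -lt0n.
rewrite !expectD !expectZ signs_mass mulr1 !signs_disc !mulr0 !add0r.
have hE : expect (signs A) (fun xs => D xs ^+ 2) <= 8 * Th A + 16 * Lambda.
  have hs : (0 < size (us A))%N by rewrite size_walk_input hA doubleK.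
  apply: le_trans (signs_disc_sqr _ _) _; rewrite ?hA ?odd_double ?double_gt0 //.
  rewrite lerD2l /Lambda -[leLHS]mulrA -[leLHS]mulrA ler_pM2l //.
  rewrite mulrA; apply: ler_wpM2r; first by apply: sumr_ge0 => B _; exact: sqr_ge0.
  have hl := lam_le hA1.
  have hl2 := @lam_ge2 _ _ _ _ (@admissible_us A) (@dim_us A) hs.
  apply: ler_pM; rewrite ?sqr_ge0 ?M_sqr_le //; last by rewrite ler_pM2l.
  by apply: le_trans hl2.
rewrite /quad.
have hA0 : 0 <= (#|A|%:R ^+ 2)^-1 :> R by rewrite invr_ge0 sqr_ge0.
have := ler_wpM2l hA0 hE.
set E := expect _ _; set i2 := _^-1; set Z := _ ^+ 2; set Y := Th A.
move=> hh; apply: le_trans (_ : Z + al / 2 * Y + be + i2 * (8 * Y + 16 * Lambda) <= _).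
  by rewrite lerD2l.
by rewrite le_eqVlt; apply/orP; left; apply/eqP; ring.
Qed.

(** [k] counts the levels already undone from the leaves, where sets have n 2^k points. The closed
    forms sum the increments 8/(n 2^(k+1))^2, halved at each later level, and 16 Lambda/(n
    2^(k+1))^2. The first solves its recursion exactly, the second only from above. *)
Lemma expect_wsub_quad n T t k i (G : {set 'I_N} -> R) : (0 < n)%N ->
  N = (n * 2 ^ T)%N -> T = (k + t)%N -> (i < 2 ^ t)%N ->
  0 <= Lambda ->
  (forall P : {set 'I_N}, #|P| = (n * 2 ^ k)%N ->
     G P <= quad (8 * (1 - 2 ^- k) / (n%:R ^+ 2 * 2 ^+ k)) (16 * Lambda * (1 - 2 ^- k) / n%:R ^+ 2) P) ->
  expect (wsub t) (fun As => G (nth finset.set0 As i)) <=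
  quad (8 * (1 - 2 ^- T) / (n%:R ^+ 2 * 2 ^+ T)) (16 * Lambda * (1 - 2 ^- T) / n%:R ^+ 2) [set: 'I_N]%SET.
Proof.
move=> n0 hN + + hL; elim: t k i G => [|t IH] k i G hT hi hG.
  move: hi; rewrite expn0 ltnS leqn0 => /eqP ->.
  rewrite /= expect_dret /= hT addn0; apply: hG.
  by rewrite cardsT card_ord hN hT addn0.
rewrite expect_wsub_step //; apply: (IH k.+1); first by rewrite hT addnS.
  by rewrite ltn_half_double -mul2n -expnS.
move=> P hP.
have hP2 : #|P| = (n * 2 ^ k).*2 by rewrite hP -mul2n expnS mulnCA.
apply: le_trans (le_halved hP2 hG) _.
apply: le_trans (halved_quad _ _ hP2 _) _; first by rewrite muln_gt0 n0 expn_gt0.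
have Th0 : 0 <= Th P by apply: sumr_ge0 => a _; exact: sqr_ge0.
rewrite /quad hP natrM natrX.
have n0' : n%:R != 0 :> R by rewrite pnatr_eq0 -lt0n.
have p0 : 2 ^+ k != 0 :> R by rewrite expf_neq0.
have ni : 0 <= (n%:R ^+ 2)^-1 :> R by rewrite invr_ge0 sqr_ge0.
have pk : 0 <= ((2 : R) ^+ k)^-1 <= 1.
  apply/andP; split; first by rewrite invr_ge0 exprn_ge0.
  by rewrite invf_le1 ?exprn_gt0 // exprn_ege1 // ler1n.
rewrite !exprS.
set y := ((2 : R) ^+ k)^-1 in pk.
have ey : 2 ^+ k = y^-1 :> R by rewrite /y invrK.
have y0 : y != 0 by rewrite /y invr_eq0.
rewrite -!addrA lerD2l; apply: lerD.
  apply: ler_wpM2r => //; rewrite le_eqVlt; apply/orP; left; apply/eqP.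
  rewrite ey; field; by rewrite y0.
rewrite ey -subr_ge0.
have e : 0 <= 16 * Lambda * (n%:R ^+ 2)^-1 * (y / 2 - y ^+ 2 / 4).
  apply: mulr_ge0; first by apply: mulr_ge0 ni; apply: mulr_ge0 hL.
  by case/andP: pk => h1 h2; nra.
apply: le_trans e _; rewrite le_eqVlt; apply/orP; left; apply/eqP; field.
by rewrite n0' y0.
Qed.

End SplitSet.

Local Open Scope classical_set_scope.
Local Open Scope ring_scope.

(** * Product measures and translations modulo 1 *)

Section LowerIntegral.
Context dT (T : measurableType dT) (R : realType) (mu : {measure set T -> \bar R}).
Local Open Scope ereal_scope.

(* The integral of a nonnegative function is a lower integral, so the function
   on the left need not be measurable. *)
Lemma le_lower_integral (D : set T) (f g : T -> \bar R) :
  (forall x, D x -> 0 <= f x <= g x) -> (forall x, 0 <= g x) ->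
  \int[mu]_(x in D) f x <= \int[mu]_x g x.
Proof.
move=> fg g0; rewrite integral_mkcond ge0_integralTE; last first.
  move=> x; rewrite patchE; case: ifPn => // /set_mem /fg /andP[] //.
rewrite ge0_integralTE //; apply: le_ereal_sup => _ [h hf <-].
exists h => // x; apply: le_trans (hf x) _.
by rewrite patchE; case: ifPn => // /set_mem /fg /andP[].
Qed.

End LowerIntegral.

Section TupleIntegral.
Context dT (T : measurableType dT) (R : realType) (P : probability T R).
Local Open Scope ereal_scope.

Lemma integral_probability_cst (dU : measure_display) (U : measurableType dU)
  (Q : probability U R) (c : \bar R) : \int[Q]_x c = c.
Proof. by rewrite integral_cst // [X in _ * X]probability_setT mule1. Qed.

Lemma measurable_cons_pair n (F : n.+1.-tuple T -> \bar R) :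
  measurable_fun setT F -> measurable_fun setT (F \o @tuple_cons _ _ n).
Proof. by move=> mF; exact: (measurableT_comp mF (@measurable_tuple_cons _ T n)). Qed.

Lemma integral_tuple_prob n (F : n.+1.-tuple T -> \bar R) :
  measurable_fun setT F -> (forall x, 0 <= F x) ->
  \int[tuple_prob P n.+1]_x F x =
  \int[P]_a \int[tuple_prob P n]_x F (tuple_cons (a, x)).
Proof.
move=> mF F0.
transitivity (\int[pushforward (P \x tuple_prob P n) (@tuple_cons _ T n)]_x F x); first by [].
have h0 : {in setT, forall y, 0 <= F y} by move=> y _.
rewrite (ge0_integral_pushforward (@measurable_tuple_cons _ T n) _ measurableT mF h0).
by rewrite preimage_setT (fubini_tonelli1 _ (measurable_cons_pair mF) (fun x => F0 _)).
Qed.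

Lemma measurable_cons_left n (F : n.+1.-tuple T -> \bar R) a :
  measurable_fun setT F -> measurable_fun setT (fun x => F (tuple_cons (a, x))).
Proof.
move=> /measurable_cons_pair mF.
exact: (measurableT_comp mF (measurable_pair1 a)).
Qed.

Lemma measurable_integral_cons n (F : n.+1.-tuple T -> \bar R) :
  measurable_fun setT F -> (forall x, 0 <= F x) ->
  measurable_fun setT (fun a => \int[tuple_prob P n]_x F (tuple_cons (a, x))).
Proof.
move=> /measurable_cons_pair mF F0.
exact: (@measurable_fun_fubini_tonelli_F _ _ _ _ _ (tuple_prob P n) (F \o @tuple_cons _ _ n) mF (fun x => F0 _)).
Qed.

Lemma tnth_cons0 n (a : T) (x : n.-tuple T) : tnth (tuple_cons (a, x)) ord0 = a.
Proof. by []. Qed.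

Lemma tnth_consS n (a : T) (x : n.-tuple T) i :
  tnth (tuple_cons (a, x)) (lift ord0 i) = tnth x i.
Proof. by rewrite /tuple_cons tnthS. Qed.

Lemma integral_tnth n (i : 'I_n) (G : T -> \bar R) :
  measurable_fun setT G -> (forall x, 0 <= G x) ->
  \int[tuple_prob P n]_x G (tnth x i) = \int[P]_a G a.
Proof.
move=> mG G0; elim: n i => [|n IH] i; first by case: i.
rewrite integral_tuple_prob //; last first.
  by apply: (measurableT_comp mG); exact: measurable_tnth.
have [j ->|->] := unliftP ord0 i.
  under eq_integral do under eq_integral do rewrite tnth_consS.
  by under eq_integral do rewrite IH; rewrite integral_probability_cst.
under eq_integral do under eq_integral do rewrite tnth_cons0.
by under eq_integral do rewrite integral_probability_cst.
Qed.

Definition tmap n (phi : 'I_n -> T -> T) (x : n.-tuple T) : n.-tuple T :=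
  [tuple phi i (tnth x i) | i < n].

Lemma tmap_cons n (phi : 'I_n.+1 -> T -> T) a x :
  tmap phi (tuple_cons (a, x)) =
  tuple_cons (phi ord0 a, tmap (fun i => phi (lift ord0 i)) x).
Proof.
apply: eq_from_tnth => i; rewrite tnth_mktuple.
have [j ->|->] := unliftP ord0 i; last by rewrite !tnth_cons0.
by rewrite !tnth_consS tnth_mktuple.
Qed.

Lemma measurable_tmap n (phi : 'I_n -> T -> T) :
  (forall i, measurable_fun setT (phi i)) -> measurable_fun setT (tmap phi).
Proof.
move=> mphi; apply/measurable_fun_tnthP => i.
rewrite (_ : _ \o _ = (phi i) \o (@tnth n T ^~ i)); last first.
  by apply/funext => x /=; rewrite tnth_mktuple.
by apply: measurableT_comp => //; exact: measurable_tnth.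
Qed.

Lemma integral_tmap n (phi : 'I_n -> T -> T) (F : n.-tuple T -> \bar R) :
  (forall i, measurable_fun setT (phi i)) ->
  (forall i G, measurable_fun setT G -> (forall a, 0 <= G a) ->
     \int[P]_a G (phi i a) = \int[P]_a G a) ->
  measurable_fun setT F -> (forall x, 0 <= F x) ->
  \int[tuple_prob P n]_x F (tmap phi x) = \int[tuple_prob P n]_x F x.
Proof.
elim: n phi F => [|n IH] phi F mphi hphi mF F0.
  by apply: eq_integral => x _; congr F; apply: eq_from_tnth => -[].
have mFt : measurable_fun setT (fun x => F (tmap phi x)).
  by apply: (measurableT_comp mF); exact: measurable_tmap.
rewrite (integral_tuple_prob mF F0) (integral_tuple_prob mFt (fun x => F0 _)).
under eq_integral => a _.
  under eq_integral do rewrite tmap_cons.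
  rewrite (IH _ (fun x => F (tuple_cons (phi ord0 a, x))) (fun i => mphi _) (fun i => hphi _)
    (measurable_cons_left _ mF) (fun x => F0 _)).
  over.
rewrite (hphi ord0 (fun a => \int[tuple_prob P n]_x F (tuple_cons (a, x)))) //.
  exact: measurable_integral_cons.
by move=> a; apply: integral_ge0.
Qed.

(* The constant c makes the induction on n close. *)
Lemma integral_sqr_iid n (f : T -> R) (c s : R) :
  measurable_fun setT f -> \int[P]_a (f a ^+ 2)%:E = s%:E ->
  (\int[P]_a f a = 0)%R ->
  \int[tuple_prob P n]_x ((c + \sum_(i < n) f (tnth x i)) ^+ 2)%:E =
  (c ^+ 2 + n%:R * s)%:E.
Proof.
move=> mf hs hf; have s0 : (0 <= s)%R.
  by rewrite -lee_fin -hs integral_ge0 // => x _; rewrite lee_fin sqr_ge0.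
have if2 : P.-integrable setT (fun a => (f a ^+ 2)%:E).
  apply/integrableP; split; first exact/measurable_EFinP/measurable_funX.
  under eq_integral do rewrite gee0_abs ?lee_fin ?sqr_ge0 //.
  by rewrite hs ltry.
have i1 : P.-integrable setT (EFin \o f).
  have h1 : P.-integrable setT (fun a => (1 + f a ^+ 2)%:E).
    apply: (eq_integrable _ ((fun=> 1%:E) \+ (fun a => (f a ^+ 2)%:E))) => //.
    by apply: integrableD => //; exact: finite_measure_integrable_cst.
  apply: le_integrable h1 => //; first exact/measurable_EFinP.
  move=> x _ /=; rewrite lee_fin.
  have h2 : (0 <= 1 + f x ^+ 2)%R by rewrite addr_ge0 ?sqr_ge0.
  rewrite (ger0_norm h2) ler_norml.
  have := sqr_ge0 (f x - 1); have := sqr_ge0 (f x + 1).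
  by rewrite sqrrD sqrrB => h3 h4; apply/andP; split; lra.
have hE : \int[P]_a (f a)%:E = 0.
  have fin : \int[P]_a (f a)%:E \is a fin_num by exact: integrable_fin_num.
  by rewrite -[LHS]fineK // [X in X%:E]hf.
elim: n c => [|n IH] c.
  under eq_integral do rewrite big_ord0 addr0.
  by rewrite integral_probability_cst mul0r addr0.
rewrite integral_tuple_prob //; first last.
- by move=> x; rewrite lee_fin sqr_ge0.
- apply/measurable_EFinP/measurable_funX/measurable_funD => //.
  apply: measurable_sum => i.
  by apply: (measurableT_comp mf); exact: measurable_tnth.
under eq_integral => a _.
  under eq_integral => x _.
    rewrite big_ord_recl tnth_cons0 addrA.
    under eq_bigr do rewrite tnth_consS.
    over.
  rewrite IH (_ : ((c + f a) ^+ 2 + n%:R * s)%R =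
     (c ^+ 2 + n%:R * s + (2 * c * f a + f a ^+ 2))%R); last by ring.
  rewrite !EFinD [X in _ + (X + _)]EFinM -EFinD.
  over.
rewrite /= integralD //; first last.
- by apply: integrableD => //; exact: integrableZl.
- exact: finite_measure_integrable_cst.
rewrite integralD //; last exact: integrableZl.
rewrite integralZl // hE mule0 add0e hs integral_probability_cst -EFinD.
by congr EFin; rewrite -natr1; ring.
Qed.

End TupleIntegral.

Section Uniform.
Context (R : realType).
Local Open Scope ereal_scope.
Local Notation mu := (@lebesgue_measure R).
Local Notation U := (uniform_prob (@ltr01 R)).

Definition translate (c : R) (x : measurableTypeR R) : measurableTypeR R := (x + c)%R.

Lemma measurable_translate c : measurable_fun setT (translate c).
Proof. exact: measurable_funD. Qed.

HB.instance Definition _ c :=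
  isMeasurableFun.Build _ _ _ _ (translate c) (measurable_translate c).

Lemma lebesgue_measure_translate c (A : set (measurableTypeR R)) :
  measurable A -> mu A = pushforward mu (translate c) A.
Proof.
apply: (@lebesgue_measure_unique R (pushforward mu (translate c))) => X.
move=> [[a b] _ <-] /=.
rewrite /pushforward [X in _ = mu X](_ : _ = `](a - c)%R, (b - c)%R]%classic); last first.
  by apply/seteqP; split=> x /=; rewrite /translate !in_itv /= => /andP[h1 h2]; apply/andP; split; lra.
rewrite !lebesgue_measure_itv /= !lte_fin; case: ltP => h; case: ltP => h' //; rewrite -?EFinD.
- by congr EFin; ring.
- by exfalso; lra.
- by exfalso; lra.
Qed.

Lemma integral_translate (c : R) (D : set (measurableTypeR R))
    (F : measurableTypeR R -> \bar R) :
  measurable D -> measurable_fun setT F -> (forall x, 0 <= F x) ->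
  \int[mu]_(x in translate c @^-1` D) F (translate c x) = \int[mu]_(x in D) F x.
Proof.
move=> mD mF F0.
have h0 : {in D, forall y, 0 <= F y} by move=> y _.
rewrite -(ge0_integral_pushforward (measurable_translate c) mu mD (measurable_funTS mF) h0).
by apply: eq_measure_integral => A mA _; exact/esym/lebesgue_measure_translate.
Qed.

Definition fract (x : R) : R := (x - (Num.floor x)%:~R)%R.

Lemma frac_itv x : (0 <= fract x < 1)%R.
Proof.
rewrite /fract subr_ge0 floor_le_tmp /= ltrBlDl.
by have := floorD1_gt x; rewrite intrD addrC => /lt_le_trans; apply; lra.
Qed.

Lemma fracDz x (n : int) : fract (x + n%:~R) = fract x.
Proof. by rewrite /fract floorDrz ?intr_int // intrKfloor rmorphD /=; ring. Qed.

Lemma frac_id x : (0 <= x < 1)%R -> fract x = x.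
Proof.
move=> /andP[x0 x1]; rewrite /fract (_ : Num.floor x = 0%R) ?subr0 //.
by apply/eqP; rewrite floor_eq ?num_real //= x0 /= add0r.
Qed.

Lemma measurable_floor : measurable_fun setT (fun x : R => (Num.floor x)%:~R : R).
Proof.
apply: nondecreasing_measurable => // x y xy.
by rewrite ler_int le_floor.
Qed.

Lemma measurable_frac : measurable_fun setT (fract : measurableTypeR R -> measurableTypeR R).
Proof. by apply: measurable_funB => //; exact: measurable_floor. Qed.

Lemma integral_uniform_co (F : measurableTypeR R -> \bar R) :
  measurable_fun setT F -> (forall x, 0 <= F x) ->
  \int[U]_x F x = \int[mu]_(x in `[0%R, 1%R[) F x.
Proof.
move=> mF F0; rewrite integral_uniform // subr0 invr1 mul1e.
by rewrite -integral_itv_bndo_bndc //; exact: measurable_funTS.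
Qed.

(** Rotation of the circle: once t is reduced to [0,1), the pieces [0,1-t) and [1-t,1) are
    translated by t and by t - 1 onto [t,1) and [0,t). *)
Lemma integral_frac_shift (t : R) (F : measurableTypeR R -> \bar R) :
  measurable_fun setT F -> (forall x, 0 <= F x) ->
  \int[U]_x F (fract (x + t)) = \int[U]_x F x.
Proof.
move=> mF F0.
have -> : (fun x => F (fract (x + t))) = (fun x => F (fract (x + fract t))).
  apply/funext => x; congr F; rewrite {2}/fract addrA -[RHS](fracDz _ (Num.floor t)).
  by rewrite subrK.
have /andP[t0 t1] := frac_itv t; move: (fract t) t0 t1 => {}t t0 t1.
have mFs : measurable_fun setT (fun x : measurableTypeR R => F (fract (x + t))).
  apply: (measurableT_comp mF); apply: (measurableT_comp measurable_frac).
  exact: measurable_funD.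
rewrite !integral_uniform_co //.
have e1 : `[0%R, 1%R[%classic = `[0%R, (1 - t)%R[%classic `|` `[(1 - t)%R, 1%R[%classic :> set R.
  apply/seteqP; split=> x /=; rewrite !in_itv /=.
    by move=> /andP[h1 h2]; have [h|h] := ltP x (1 - t)%R; [left|right]; apply/andP; split.
  by move=> [|] /andP[h1 h2]; apply/andP; split; lra.
have e2 : `[0%R, 1%R[%classic = `[0%R, t[%classic `|` `[t, 1%R[%classic :> set R.
  apply/seteqP; split=> x /=; rewrite !in_itv /=.
    by move=> /andP[h1 h2]; have [h|h] := ltP x t; [left|right]; apply/andP; split.
  by move=> [|] /andP[h1 h2]; apply/andP; split; lra.
have disj (a : R) : [disjoint `[0%R, a[%classic & `[a, 1%R[%classic : set R].
  apply/disj_setPS => x /= [] /=; rewrite !in_itv /= => /andP[_ h1] /andP[h2 _].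
  by move: (lt_le_trans h1 h2); rewrite ltxx.
rewrite {1}e1 e2 !ge0_integral_setU //; try exact: measurable_funTS.
rewrite addeC; congr (_ + _).
- rewrite -(@integral_translate (t - 1) `[0%R, t[%classic) //.
  rewrite [X in _ = \int[mu]_(x in X) _](_ : _ = `[(1 - t)%R, 1%R[%classic ); last first.
    by apply/seteqP; split=> x /=; rewrite /translate !in_itv /= => /andP[h1 h2]; apply/andP; split; lra.
  apply: eq_integral => x; rewrite inE /= in_itv /= => /andP[h1 h2]; congr F.
  have e : ((-1)%:~R = -1 :> R)%R by [].
  rewrite -(fracDz _ (-1)) /translate e frac_id; first by ring.
  by apply/andP; split; lra.
- rewrite -(@integral_translate t `[t, 1%R[%classic) //.
  rewrite [X in _ = \int[mu]_(x in X) _](_ : _ = `[0%R, (1 - t)%R[%classic ); last first.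
    by apply/seteqP; split=> x /=; rewrite /translate !in_itv /= => /andP[h1 h2]; apply/andP; split; lra.
  apply: eq_integral => x; rewrite inE /= in_itv /= => /andP[h1 h2]; congr F.
  by rewrite frac_id //; apply/andP; split; lra.
Qed.

End Uniform.

(** * Trigonometric polynomials on the torus *)

Section SquareIntegrable.
Context dT (T : measurableType dT) (R : realType) (P : probability T R).
Implicit Types u v w : T -> R.

Definition square_integrable u :=
  measurable_fun setT u /\ (\int[P]_x (u x ^+ 2)%:E < +oo)%E.

Local Notation E u := (\int[P]_x u x).

Lemma integrable_sqr u : square_integrable u ->
  P.-integrable setT (EFin \o (fun x => u x ^+ 2)).
Proof.
move=> [mu hu]; apply/integrableP; split; first exact/measurable_EFinP/measurable_funX.
rewrite (eq_integral (fun x => (u x ^+ 2)%:E)) // => x _ /=.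
by rewrite ger0_norm ?sqr_ge0.
Qed.

Lemma integrable_addR u v : P.-integrable setT (EFin \o u) ->
  P.-integrable setT (EFin \o v) -> P.-integrable setT (EFin \o (fun x => u x + v x)).
Proof. by move=> hu hv; apply: eq_integrable (integrableD measurableT hu hv). Qed.

Lemma integrable_scaleR c u : P.-integrable setT (EFin \o u) ->
  P.-integrable setT (EFin \o (fun x => c * u x)).
Proof. by move=> hu; apply: eq_integrable (integrableZl measurableT c hu). Qed.

Lemma integrable_sumR I (s : seq I) (u : I -> T -> R) :
  (forall i, P.-integrable setT (EFin \o u i)) ->
  P.-integrable setT (EFin \o (fun x => \sum_(i <- s) u i x)).
Proof.
move=> hu; elim: s => [|i s IH].
  apply: (@eq_integrable _ _ _ _ _ measurableT (EFin \o cst 0)).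
    by move=> x _ /=; rewrite big_nil.
  exact: finite_measure_integrable_cst.
apply: eq_integrable (integrable_addR (hu i) IH) => // x _ /=.
by rewrite big_cons.
Qed.

Lemma integrable_le_sqr u v w : measurable_fun setT w ->
  square_integrable u -> square_integrable v ->
  (forall x, `|w x| <= u x ^+ 2 + v x ^+ 2) -> P.-integrable setT (EFin \o w).
Proof.
move=> mw hu hv hw.
have h : P.-integrable setT (EFin \o (fun x => u x ^+ 2 + v x ^+ 2)).
  by apply: integrable_addR; exact: integrable_sqr.
apply: le_integrable h => //; first exact/measurable_EFinP.
move=> x _; rewrite /= lee_fin; apply: le_trans (hw x) _.
exact: ler_norm.
Qed.

Lemma integrable_mul u v : square_integrable u -> square_integrable v ->
  P.-integrable setT (EFin \o (fun x => u x * v x)).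
Proof.
move=> hu hv; apply: (integrable_le_sqr _ hu hv).
  by apply: measurable_funM; [case: hu | case: hv].
move=> x; rewrite ler_norml; have := sqr_ge0 (u x - v x); have := sqr_ge0 (u x + v x).
have := sqr_ge0 (u x); have := sqr_ge0 (v x).
by rewrite sqrrD sqrrB => h1 h2 h3 h4; apply/andP; split; lra.
Qed.

Lemma square_integrable_bounded u (M : R) : measurable_fun setT u ->
  (forall x, `|u x| <= M) -> square_integrable u.
Proof.
move=> mu hu; split=> //.
apply: (@le_lt_trans _ _ (\int[P]_x (M ^+ 2)%:E)%E); last first.
  by rewrite integral_probability_cst ltry.
apply: le_lower_integral => x; last by rewrite lee_fin sqr_ge0.
move=> _; rewrite !lee_fin sqr_ge0 /= -real_normK ?num_real //.
by rewrite lerXn2r ?nnegrE //; apply: le_trans (hu x).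
Qed.

Lemma square_integrable_cst c : square_integrable (fun=> c).
Proof. exact: (@square_integrable_bounded _ `|c|). Qed.

Lemma square_integrableZ c u : square_integrable u -> square_integrable (fun x => c * u x).
Proof.
move=> [mu hu]; split; first exact: measurable_funM.
under eq_integral do rewrite exprMn EFinM.
rewrite ge0_integralZl_EFin ?sqr_ge0 //; last exact/measurable_EFinP/measurable_funX.
  by rewrite lte_mul_pinfty // lee_fin sqr_ge0.
by move=> x _; rewrite lee_fin sqr_ge0.
Qed.

Lemma square_integrableD u v : square_integrable u -> square_integrable v ->
  square_integrable (fun x => u x + v x).
Proof.
move=> hu hv; have [[mu _] [mv _]] := (hu, hv); split; first exact: measurable_funD.
have hw := integrableD measurableT (integrable_sqr (square_integrableZ 2 hu))
  (integrable_sqr (square_integrableZ 2 hv)).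
have /(integrable_lty measurableT) := hw; apply: le_lt_trans.
apply: le_lower_integral => x.
  move=> _; rewrite lee_fin sqr_ge0 /= lee_fin !exprMn sqrrD.
  have := sqr_ge0 (u x - v x); rewrite sqrrB.
  have := sqr_ge0 (u x); have := sqr_ge0 (v x); lra.
by rewrite /= lee_fin addr_ge0 ?sqr_ge0.
Qed.

Lemma square_integrableB u v : square_integrable u -> square_integrable v ->
  square_integrable (fun x => u x - v x).
Proof.
move=> hu /(square_integrableZ (-1)) hv.
rewrite (_ : (fun x => _) = fun x => u x + -1 * v x); first exact: square_integrableD.
by apply/funext => x; rewrite mulN1r.
Qed.

Lemma square_integrable_sum I (s : seq I) (u : I -> T -> R) :
  (forall i, square_integrable (u i)) -> square_integrable (fun x => \sum_(i <- s) u i x).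
Proof.
move=> hu; elim: s => [|i s IH].
  by under eq_fun do rewrite big_nil; exact: square_integrable_cst.
by under eq_fun do rewrite big_cons; exact: square_integrableD.
Qed.

Lemma square_integrable_integrable u : square_integrable u -> P.-integrable setT (EFin \o u).
Proof.
move=> hu; apply: eq_integrable (integrable_mul hu (square_integrable_cst 1)) => //.
by move=> x _ /=; rewrite mulr1.
Qed.

Lemma mean_sum I (s : seq I) (u : I -> T -> R) :
  (forall i, P.-integrable setT (EFin \o u i)) ->
  E (fun x => \sum_(i <- s) u i x) = \sum_(i <- s) E (u i).
Proof.
move=> hu; elim: s => [|i s IH].
  by under eq_Rintegral do rewrite big_nil; rewrite big_nil Rintegral_cst // mul0r.
rewrite big_cons -IH -RintegralD //; last exact: integrable_sumR.
by apply: eq_Rintegral => x _; rewrite big_cons.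
Qed.

Lemma meanZ c u : P.-integrable setT (EFin \o u) -> E (fun x => c * u x) = c * E u.
Proof. by move=> hu; rewrite RintegralZl. Qed.

Lemma meanD u v : P.-integrable setT (EFin \o u) -> P.-integrable setT (EFin \o v) ->
  E (fun x => u x + v x) = E u + E v.
Proof. by move=> hu hv; rewrite RintegralD. Qed.

Lemma mean_cst c : E (fun=> c) = c.
Proof. by rewrite Rintegral_cst // [X in fine X]probability_setT mulr1. Qed.

Lemma mean_sqrE u : square_integrable u ->
  (\int[P]_x (u x ^+ 2)%:E = (E (fun x => u x ^+ 2))%:E)%E.
Proof.
move=> /integrable_sqr h; rewrite /Rintegral fineK //.
exact: integrable_fin_num h.
Qed.

Lemma mean_sqr_ge0 u : 0 <= E (fun x => u x ^+ 2).
Proof. by apply: Rintegral_ge0 => x _; exact: sqr_ge0. Qed.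

Lemma le_mean u v : P.-integrable setT (EFin \o u) -> P.-integrable setT (EFin \o v) ->
  (forall x, u x <= v x) -> E u <= E v.
Proof. by move=> hu hv uv; apply: le_Rintegral. Qed.

Lemma mean_sqrB u v : square_integrable u -> square_integrable v ->
  E (fun x => (u x - v x) ^+ 2) =
  E (fun x => u x ^+ 2) - 2 * E (fun x => u x * v x) + E (fun x => v x ^+ 2).
Proof.
move=> hu hv; have h1 := integrable_sqr hu; have h2 := integrable_sqr hv.
have h3 := integrable_mul (square_integrableZ (-2) hu) hv.
rewrite (_ : - (2 * _) = E (fun x => -2 * u x * v x)); last first.
  rewrite -mulNr -meanZ; last exact: integrable_mul.
  by apply: eq_Rintegral => x _; rewrite mulrA.
rewrite -!meanD //.
  by apply: eq_Rintegral => x _; ring.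
exact: integrable_addR.
Qed.

Lemma mean_sqrD_le u v : square_integrable u -> square_integrable v ->
  E (fun x => (u x + v x) ^+ 2) <=
  2 * E (fun x => u x ^+ 2) + 2 * E (fun x => v x ^+ 2).
Proof.
move=> hu hv; have h1 := integrable_sqr hu; have h2 := integrable_sqr hv.
rewrite -mulrDr -meanD // -meanZ; last first.
  exact: integrable_addR.
apply: le_mean; first exact: integrable_sqr (square_integrableD hu hv).
  exact/integrable_scaleR/integrable_addR.
by move=> x; have := sqr_ge0 (u x - v x); rewrite sqrrB sqrrD; lra.
Qed.

Lemma variance_le u : square_integrable u ->
  E (fun x => (u x - E u) ^+ 2) = E (fun x => u x ^+ 2) - E u ^+ 2.
Proof.
move=> hu; rewrite mean_sqrB //; last exact: square_integrable_cst.
rewrite mean_cst (_ : E (fun x => u x * E u) = E u * E u); first by ring.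
rewrite -[RHS]meanZ; last exact: square_integrable_integrable.
by apply: eq_Rintegral => x _; rewrite mulrC.
Qed.

End SquareIntegrable.

(** * Rotation invariance and orthogonality of characters on the torus *)

Section Torus.
Context (R : realType) (d : nat).
Local Notation P := (unif R d).
Local Notation E u := (\int[unif R d]_x u x).
Implicit Types (k : freq d) (x t : vec R d).

Definition tshift t : vec R d -> vec R d :=
  tmap (fun i (a : measurableTypeR R) => fract (a + (tnth t i : R)) : measurableTypeR R).

Lemma tnth_shift t x i : tnth (tshift t x) i = fract ((tnth x i : R) + tnth t i).
Proof. by rewrite tnth_mktuple. Qed.

Let measurable_frac_shift (c : R) :
  measurable_fun setT (fun a : measurableTypeR R => fract (a + c) : measurableTypeR R).
Proof.
apply: (measurableT_comp (@measurable_frac R)).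
exact: measurable_funD.
Qed.

Lemma measurable_shift t : measurable_fun setT (tshift t).
Proof. by apply: measurable_tmap => i; exact: measurable_frac_shift. Qed.

Lemma integral_shift t (F : vec R d -> \bar R) :
  measurable_fun setT F -> (forall x, (0 <= F x)%E) ->
  (\int[P]_x F (tshift t x) = \int[P]_x F x)%E.
Proof.
move=> mF F0; apply: integral_tmap => // i.
by move=> G mG G0; exact: integral_frac_shift.
Qed.

Lemma mean_shift t (u : vec R d -> R) : measurable_fun setT u ->
  E (fun x => u (tshift t x)) = E u.
Proof.
move=> mu; rewrite /Rintegral; congr fine; rewrite [LHS]integralE [RHS]integralE.
have mE : measurable_fun setT (EFin \o u) by exact/measurable_EFinP.
congr (_ - _)%E.
  have := integral_shift t (measurable_funepos mE) (fun x => funepos_ge0 (EFin \o u) x).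
  by move=> <-; apply: eq_integral => x _; rewrite !unlock.
have := integral_shift t (measurable_funeneg mE) (fun x => funeneg_ge0 (EFin \o u) x).
by move=> <-; apply: eq_integral => x _; rewrite !unlock.
Qed.

Lemma freq_dotB k k' x : freq_dot (k - k') x = freq_dot k x - freq_dot k' x.
Proof.
rewrite /freq_dot -sumrB; apply: eq_bigr => i _.
by rewrite !ffunE rmorphB /= mulrBl.
Qed.

Lemma freq_dotN k x : freq_dot (- k) x = - freq_dot k x.
Proof.
rewrite /freq_dot -sumrN; apply: eq_bigr => i _.
by rewrite ffunE rmorphN /= mulNr.
Qed.

Lemma freq_dot0 x : freq_dot 0 x = 0 :> R.
Proof. by rewrite /freq_dot big1 // => i _; rewrite ffunE mul0r. Qed.

Lemma freq_dot_shift k t x : exists m : int,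
  freq_dot k (tshift t x) = freq_dot k x + freq_dot k t + m%:~R.
Proof.
exists (- \sum_(i < d) k i * Num.floor ((tnth x i : R) + tnth t i)).
rewrite /freq_dot -big_split /= rmorphN rmorph_sum /= -sumrB; apply: eq_bigr => i _.
by rewrite tnth_shift /fract rmorphM /=; ring.
Qed.

Lemma cosDint (a : R) (m : int) : cos (2 * pi * (a + m%:~R)) = cos (2 * pi * a).
Proof.
case: m => n.
  rewrite mulrDr -(periodicn (@cosD2pi R) n (2 * pi * a)); congr (cos (_ + _)).
  by rewrite -pmulrn -mulr_natr -[pi *+ 2]mulr_natl; ring.
rewrite -(periodicn (@cosD2pi R) n.+1 (2 * pi * (a + _))); congr cos.
by rewrite NegzE rmorphN /= -pmulrn -mulr_natr -[pi *+ 2]mulr_natl; ring.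
Qed.

Lemma sinDint (a : R) (m : int) : sin (2 * pi * (a + m%:~R)) = sin (2 * pi * a).
Proof.
case: m => n.
  rewrite mulrDr -(periodicn (@sinD2pi R) n (2 * pi * a)); congr (sin (_ + _)).
  by rewrite -pmulrn -mulr_natr -[pi *+ 2]mulr_natl; ring.
rewrite -(periodicn (@sinD2pi R) n.+1 (2 * pi * (a + _))); congr sin.
by rewrite NegzE rmorphN /= -pmulrn -mulr_natr -[pi *+ 2]mulr_natl; ring.
Qed.

Definition Cf k x : R := cos (2 * pi * freq_dot k x).
Definition Sf k x : R := sin (2 * pi * freq_dot k x).

Lemma Cf_shift k t x : Cf k (tshift t x) = cos (2 * pi * (freq_dot k x + freq_dot k t)).
Proof. by rewrite /Cf; have [m ->] := freq_dot_shift k t x; rewrite cosDint. Qed.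

Lemma Sf_shift k t x : Sf k (tshift t x) = sin (2 * pi * (freq_dot k x + freq_dot k t)).
Proof. by rewrite /Sf; have [m ->] := freq_dot_shift k t x; rewrite sinDint. Qed.

Lemma measurable_freq_dot k : measurable_fun setT (fun x : vec R d => freq_dot k x).
Proof.
apply: measurable_sum => i; apply: measurable_funM => //.
exact: measurable_tnth.
Qed.

Lemma measurable_Cf k : measurable_fun setT (Cf k).
Proof.
apply: (measurableT_comp (f := cos)).
  by apply: continuous_measurable_fun; exact: continuous_cos.
by apply: measurable_funM => //; exact: measurable_freq_dot.
Qed.

Lemma measurable_Sf k : measurable_fun setT (Sf k).
Proof.
apply: (measurableT_comp (f := sin)).
  by apply: continuous_measurable_fun; exact: continuous_sin.
by apply: measurable_funM => //; exact: measurable_freq_dot.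
Qed.

Lemma square_integrable_Cf k : square_integrable P (Cf k).
Proof.
apply: (@square_integrable_bounded _ _ _ _ _ 1) => [|x]; first exact: measurable_Cf.
exact: cos_max.
Qed.

Lemma square_integrable_Sf k : square_integrable P (Sf k).
Proof.
apply: (@square_integrable_bounded _ _ _ _ _ 1) => [|x]; first exact: measurable_Sf.
exact: sin_max.
Qed.

(** Moving by half a period in one coordinate negates the character. With rotation invariance its
    mean equals its own negative, so no trigonometric function has to be integrated explicitly. *)
Definition half_period k (i : 'I_d) : vec R d :=
  [tuple if j == i then (2 * (k i)%:~R)^-1 else 0 | j < d].

Lemma freq_dot_half_period k i : k i != 0 -> freq_dot k (half_period k i) = 2^-1.
Proof.
move=> ki; rewrite /freq_dot (bigD1 i) //= big1 ?addr0; last first.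
  by move=> j /negPf ji; rewrite tnth_mktuple ji mulr0.
by rewrite tnth_mktuple eqxx; field; rewrite intr_eq0.
Qed.

Lemma Cf_half_period k i x : k i != 0 -> Cf k (tshift (half_period k i) x) = - Cf k x.
Proof.
move=> ki; rewrite Cf_shift freq_dot_half_period // -cosDpi; congr cos.
by field.
Qed.

Lemma Sf_half_period k i x : k i != 0 -> Sf k (tshift (half_period k i) x) = - Sf k x.
Proof.
move=> ki; rewrite Sf_shift freq_dot_half_period // -sinDpi; congr sin.
by field.
Qed.

Lemma mean_anti k i (u : vec R d -> R) : measurable_fun setT u ->
  P.-integrable setT (EFin \o u) ->
  (forall x, u (tshift (half_period k i) x) = - u x) -> E u = 0.
Proof.
move=> mu iu hu; have := mean_shift (half_period k i) mu.
have -> : E (fun x => u (tshift (half_period k i) x)) = -1 * E u.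
  by rewrite -meanZ //; apply: eq_Rintegral => x _; rewrite hu mulN1r.
by move=> h; lra.
Qed.

Lemma neq0_freq k : k != 0 -> exists i, k i != 0.
Proof.
move=> k0; apply: contrapT => /forallNP h; move/eqP: k0; apply.
by apply/ffunP => i; rewrite ffunE; apply/eqP; have := h i; case: (k i == 0).
Qed.

Lemma mean_Cf k : E (Cf k) = (k == 0)%:R.
Proof.
have [->|/neq0_freq[i ki]] := eqVneq k 0.
  rewrite -[RHS](mean_cst P); apply: eq_Rintegral => x _.
  by rewrite /Cf freq_dot0 mulr0 cos0.
apply: (@mean_anti k i); first exact: measurable_Cf.
  exact: square_integrable_integrable (square_integrable_Cf k).
by move=> x; exact: Cf_half_period.
Qed.

Lemma mean_Sf k : E (Sf k) = 0.
Proof.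
have [->|/neq0_freq[i ki]] := eqVneq k 0.
  rewrite -[RHS](mean_cst P); apply: eq_Rintegral => x _.
  by rewrite /Sf freq_dot0 mulr0 sin0.
apply: (@mean_anti k i); first exact: measurable_Sf.
  exact: square_integrable_integrable (square_integrable_Sf k).
by move=> x; exact: Sf_half_period.
Qed.

Lemma CfB k k' x : Cf (k - k') x = Cf k x * Cf k' x + Sf k x * Sf k' x.
Proof. by rewrite /Cf /Sf freq_dotB mulrBr cosB. Qed.

Lemma SfB k k' x : Sf (k - k') x = Sf k x * Cf k' x - Cf k x * Sf k' x.
Proof. by rewrite /Cf /Sf freq_dotB mulrBr sinB. Qed.

Section TrigPoly.
Context (I : finType) (kap : I -> freq d).
Implicit Types A B : I -> R.

Definition trig A B x : R := \sum_i (A i * Cf (kap i) x + B i * Sf (kap i) x).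

Lemma square_integrable_trig A B : square_integrable P (trig A B).
Proof.
apply: square_integrable_sum => i.
by apply: square_integrableD; apply: square_integrableZ;
  [exact: square_integrable_Cf | exact: square_integrable_Sf].
Qed.

Lemma mean_mul_trig (u : vec R d -> R) A B : square_integrable P u ->
  E (fun x => u x * trig A B x) =
  \sum_i (A i * E (fun x => u x * Cf (kap i) x) + B i * E (fun x => u x * Sf (kap i) x)).
Proof.
move=> hu.
have hC i := integrable_mul hu (square_integrable_Cf (kap i)).
have hS i := integrable_mul hu (square_integrable_Sf (kap i)).
have hAC i := integrable_mul hu (square_integrableZ (A i) (square_integrable_Cf (kap i))).
have hBS i := integrable_mul hu (square_integrableZ (B i) (square_integrable_Sf (kap i))).
transitivity (E (fun x => \sum_i (u x * (A i * Cf (kap i) x) + u x * (B i * Sf (kap i) x)))).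
  by apply: eq_Rintegral => x _; rewrite mulr_sumr; apply: eq_bigr => i _; rewrite mulrDr.
rewrite mean_sum; last first.
  move=> i; apply: eq_integrable (integrableD measurableT (hAC i) (hBS i)) => //.
apply: eq_bigr => i _; rewrite meanD // -!meanZ //.
by congr (_ + _); apply: eq_Rintegral => x _; rewrite mulrCA.
Qed.

Hypothesis kap_inj : injective kap.

(* Adding the square of the conjugate trigonometric polynomial gives the squared
   modulus of a complex one, where orthogonality applies. *)
Lemma mean_sqr_trig A B :
  E (fun x => trig A B x ^+ 2) <= \sum_i (A i ^+ 2 + B i ^+ 2).
Proof.
pose A' i := - B i; pose B' i := A i.
have hT := square_integrable_trig A B; have hT' := square_integrable_trig A' B'.
have hTT x : trig A B x ^+ 2 + trig A' B' x ^+ 2 = \sum_i \sum_j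
   ((A i * A j + B i * B j) * Cf (kap i - kap j) x +
    (B i * A j - A i * B j) * Sf (kap i - kap j) x).
  rewrite !expr2 /trig !mulr_suml -big_split /=; apply: eq_bigr => i _.
  rewrite !mulr_sumr -big_split /=; apply: eq_bigr => j _.
  by rewrite CfB SfB /A' /B'; ring.
have hI i j : P.-integrable setT (EFin \o (fun x => (A i * A j + B i * B j) * Cf (kap i - kap j) x +
    (B i * A j - A i * B j) * Sf (kap i - kap j) x)).
  apply: square_integrable_integrable; apply: square_integrableD; apply: square_integrableZ.
    exact: square_integrable_Cf.
  exact: square_integrable_Sf.
have iT := integrable_sqr hT; have iT' := integrable_sqr hT'.
apply: (@le_trans _ _ (E (fun x => trig A B x ^+ 2 + trig A' B' x ^+ 2))).
  rewrite meanD // lerDl; exact: mean_sqr_ge0.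
rewrite le_eqVlt; apply/orP; left; apply/eqP.
transitivity (E (fun x => \sum_i \sum_j
   ((A i * A j + B i * B j) * Cf (kap i - kap j) x +
    (B i * A j - A i * B j) * Sf (kap i - kap j) x))).
  by apply: eq_Rintegral => x _; rewrite hTT.
have hI2 i : P.-integrable setT (EFin \o (fun x => \sum_j ((A i * A j + B i * B j) * Cf (kap i - kap j) x +
    (B i * A j - A i * B j) * Sf (kap i - kap j) x))).
  exact: integrable_sumR.
rewrite mean_sum //; apply: eq_bigr => i _; rewrite mean_sum //.
have hval j : E (fun x => (A i * A j + B i * B j) * Cf (kap i - kap j) x +
    (B i * A j - A i * B j) * Sf (kap i - kap j) x) = (A i * A j + B i * B j) * (j == i)%:R.
  have h1 := square_integrable_Cf (kap i - kap j).
  have h2 := square_integrable_Sf (kap i - kap j).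
  rewrite (meanD (square_integrable_integrable (square_integrableZ _ h1))
    (square_integrable_integrable (square_integrableZ _ h2))).
  rewrite (meanZ _ (square_integrable_integrable h1)) (meanZ _ (square_integrable_integrable h2)).
  rewrite mean_Cf mean_Sf mulr0 addr0.
  by rewrite subr_eq0 (inj_eq kap_inj) eq_sym.
rewrite (bigD1 i) //= hval eqxx mulr1 big1 ?addr0 //.
by move=> j /negPf ji; rewrite hval ji mulr0.
Qed.

(** Expand E (u - T)^2 >= 0 for the T built from the coefficients of [u], and bound E T^2 by
    [mean_sqr_trig]. The frequencies may include both k and -k, so the real functions involved need
    not be orthogonal. *)
Lemma bessel (u : vec R d -> R) : square_integrable P u ->
  \sum_i (E (fun x => u x * Cf (kap i) x) ^+ 2 + E (fun x => u x * Sf (kap i) x) ^+ 2) <=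
  E (fun x => u x ^+ 2).
Proof.
move=> hu; pose A i := E (fun x => u x * Cf (kap i) x).
pose B i := E (fun x => u x * Sf (kap i) x).
have hT := square_integrable_trig A B.
have := mean_sqr_ge0 P (fun x => u x - trig A B x); rewrite mean_sqrB // mean_mul_trig //.
have := mean_sqr_trig A B.
under [X in _ - 2 * X]eq_bigr do rewrite -!expr2.
by rewrite -/A -/B; lra.
Qed.

End TrigPoly.
End Torus.

(** * Dyadic point sampling of characters *)

Section UnitCircle.
Context (R : realType).
Implicit Types (z w : R[i]) (a b t : R).

Definition nsq z : R := complex.Re z ^+ 2 + complex.Im z ^+ 2.

Lemma cplx_ReD z w : complex.Re (z + w) = complex.Re z + complex.Re w.
Proof. by case: z w => [a b] [a' b']. Qed.

Lemma cplx_ReM z w :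
  complex.Re (z * w) = complex.Re z * complex.Re w - complex.Im z * complex.Im w.
Proof. by case: z w => [a b] [a' b']. Qed.

Lemma cplx_ImM z w :
  complex.Im (z * w) = complex.Re z * complex.Im w + complex.Im z * complex.Re w.
Proof. by case: z w => [a b] [a' b']. Qed.

Lemma cplx_Re_sum (I : Type) (r : seq I) (P : pred I) (F : I -> R[i]) :
  complex.Re (\sum_(i <- r | P i) F i) = \sum_(i <- r | P i) complex.Re (F i).
Proof. by apply: (big_morph (@complex.Re R)); [exact: cplx_ReD|]. Qed.

Lemma nsqM z w : nsq (z * w) = nsq z * nsq w.
Proof. by rewrite /nsq cplx_ReM cplx_ImM; ring. Qed.

Lemma nsq1 : nsq 1 = 1.
Proof. by rewrite /nsq /= expr1n expr0n addr0. Qed.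

Lemma nsq0 : nsq 0 = 0.
Proof. by rewrite /nsq /= expr0n addr0. Qed.

Lemma nsq_ge0 z : 0 <= nsq z.
Proof. by rewrite addr_ge0 ?sqr_ge0. Qed.

Lemma nsq_prod (I : finType) (F : I -> R[i]) :
  nsq (\prod_i F i) = \prod_i nsq (F i).
Proof. by apply: (big_morph nsq); [exact: nsqM | exact: nsq1]. Qed.

Definition e1 t : R[i] := (cos (2 * pi * t) +i* sin (2 * pi * t))%C.

Lemma e1D a b : e1 (a + b) = e1 a * e1 b.
Proof.
apply/eqP; rewrite eq_complex /= mulrDr cosD sinD.
by apply/andP; split; apply/eqP; ring.
Qed.

Lemma e1_0 : e1 0 = 1.
Proof. by rewrite /e1 mulr0 cos0 sin0. Qed.

Lemma nsq_e1 t : nsq (e1 t) = 1.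
Proof. exact: cos2Dsin2. Qed.

Lemma e1Dz t (m : int) : e1 (t + m%:~R) = e1 t.
Proof. by rewrite /e1 cosDint sinDint. Qed.

Lemma e1z (m : int) : e1 m%:~R = 1.
Proof. by rewrite -[m%:~R]add0r e1Dz e1_0. Qed.

Lemma e1_sum (I : finType) (F : I -> R) : e1 (\sum_i F i) = \prod_i e1 (F i).
Proof. by apply: (big_morph e1); [exact: e1D | exact: e1_0]. Qed.

Lemma normr_sin_le t : `|sin t| <= `|t|.
Proof.
wlog t0 : t / 0 <= t => [h|].
  have [/h//|/ltW t0] := leP 0 t.
  by rewrite -normrN -sinN -(normrN t); apply: h; rewrite oppr_ge0.
have [|c _] := @MVT_segment R sin cos 0 t t0.
  by apply: continuous_subspaceT; exact: continuous_sin.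
rewrite sin0 !subr0 => ->; rewrite normrM.
by rewrite ler_piMl // cos_max.
Qed.

Lemma nsq_e1B a b : nsq (e1 a - e1 b) = 4 * sin (pi * (a - b)) ^+ 2.
Proof.
have -> : e1 a = e1 b * e1 (a - b) by rewrite -e1D addrC subrK.
rewrite -{2}[e1 b]mulr1 -mulrBr nsqM nsq_e1 mul1r.
set t := a - b; rewrite /nsq /= subr0.
have -> : 2 * pi * t = pi * t + pi * t by ring.
rewrite cosD sinD -(cos2Dsin2 (pi * t)).
have := cos2Dsin2 (pi * t); set c := cos _; set s := sin _ => h.
have -> : (c * c - s * s - (c ^+ 2 + s ^+ 2)) ^+ 2 + (s * c + c * s) ^+ 2 =
  4 * s ^+ 2 * (c ^+ 2 + s ^+ 2) by ring.
by rewrite h mulr1.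
Qed.

Lemma nsq_e1B_le4 a b : nsq (e1 a - e1 b) <= 4.
Proof.
rewrite nsq_e1B; have := cos2Dsin2 (pi * (a - b)); have := sqr_ge0 (cos (pi * (a - b))).
by set c := cos _; set s := sin _; lra.
Qed.

Lemma nsq_e1B_le_sqr a b : nsq (e1 a - e1 b) <= (2 * pi * (a - b)) ^+ 2.
Proof.
rewrite nsq_e1B; have := normr_sin_le (pi * (a - b)).
rewrite -(@ler_pXn2r _ 2) ?nnegrE // !real_normK ?num_real //.
have -> : (2 * pi * (a - b)) ^+ 2 = 4 * (pi * (a - b)) ^+ 2 by ring.
by set c := sin _ ^+ 2; lra.
Qed.

Lemma pi_le4 : pi <= 4 :> R.
Proof. by have /andP[_] := @pihalf_02 R; lra. Qed.

(** Interpolates between the bounds 4 and (2 pi (a - b))^2, according to whether pi |a - b| <= 1.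
    Linear growth is the point: it yields |k_j| to the first power, as in [SO_weight]. *)
Lemma nsq_e1B_le a b : nsq (e1 a - e1 b) <= 16 * `|a - b|.
Proof.
have h4 := nsq_e1B_le4 a b; have h2 := nsq_e1B_le_sqr a b.
set x := `|a - b|; have x0 : 0 <= x by exact: normr_ge0.
have e : (2 * pi * (a - b)) ^+ 2 = 4 * pi ^+ 2 * x ^+ 2.
  by rewrite /x real_normK ?num_real //; ring.
rewrite e in h2; have p0 := pi_gt0 R; have p4 := pi_le4.
have [hx|hx] := leP (pi * x) 1.
  have : pi ^+ 2 * x ^+ 2 <= pi * x.
    by rewrite -exprMn expr2 ler_piMl // mulr_ge0 // ltW.
  have : pi * x <= 4 * x by exact: ler_wpM2r.
  by rewrite -mulrA in h2; lra.
have : pi * x <= 4 * x by exact: ler_wpM2r.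
lra.
Qed.

End UnitCircle.

(** * Telescoping a character over dyadic levels in one dimension *)

Section Cells.
Context (R : realType).
Implicit Types (y : R) (j l : nat) (q : int).

(* The half-open dyadic interval of level j containing y is
   (cell j y / 2^j, (cell j y + 1) / 2^j]. *)
Definition cell j y : int := Num.ceil (2 ^+ j * y) - 1.

Lemma cell_itv j y : (cell j y)%:~R < 2 ^+ j * y <= (cell j y)%:~R + 1.
Proof.
have := ceil_itv (2 ^+ j * y); rewrite /cell rmorphB /= => /andP[h1 h2].
by apply/andP; split; lra.
Qed.

Lemma cell_eq j y q : q%:~R < 2 ^+ j * y <= q%:~R + 1 -> cell j y = q.
Proof.
move=> h; rewrite /cell (@ceil_def _ _ (q + 1)) ?addrK //.
by rewrite rmorphD.
Qed.

Definition res j y : nat := `|(cell j y %% (2 ^ j)%N)%Z|%N.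

Lemma res_spec j y : (res j y < 2 ^ j)%N /\
  exists q, cell j y = q * (2 ^ j)%N%:Z + (res j y)%:Z.
Proof.
have h0 : (2 ^ j)%N%:Z != 0 by rewrite eqz_nat expn_eq0.
have e : (res j y)%:Z = (cell j y %% (2 ^ j)%N)%Z by rewrite /res gez0_abs // modz_ge0.
split; first by rewrite -ltz_nat e ltz_pmod // ltz_nat expn_gt0.
by exists (cell j y %/ (2 ^ j)%N)%Z; rewrite e -divz_eq.
Qed.

Lemma res_uniq j y l q : (l < 2 ^ j)%N -> cell j y = q * (2 ^ j)%N%:Z + l%:Z ->
  l = res j y.
Proof.
move=> hl; rewrite /res => ->; rewrite modzMDl modz_nat modn_small //.
Qed.

(** Membership modulo 1 determines the cell index only modulo 2^j, and the residue is the label of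
    the interval. *)
Lemma in_dyadic_cell L (I : dyadic L) y :
  (exists b : R, exists k : int, in_dyadic I b /\ y = b + k%:~R) <->
  (tagged I = res (tag I) y :> nat).
Proof.
case: I => j l /=; rewrite /in_dyadic /=.
have p0 : 0 < 2 ^+ j :> R by rewrite exprn_gt0.
have pE : ((2 ^ j)%N%:Z)%:~R = 2 ^+ j :> R by rewrite -pmulrn natrX.
split.
  move=> [b [k [[h1 h2] ->]]]; apply: (@res_uniq j _ l k) => //; apply: cell_eq.
  move: h1 h2; rewrite ltr_pdivrMr // ler_pdivlMr // => h1 h2.
  rewrite rmorphD rmorphM /= pE -pmulrn mulrDr; rewrite -natr1 in h2.
  by apply/andP; split; lra.
move=> hl; have [_ [q hq]] := res_spec j y; rewrite -hl in hq.
exists (y - q%:~R), q; split; last by rewrite subrK.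
have := cell_itv j y; rewrite hq rmorphD rmorphM /= pE -pmulrn => /andP[h1 h2].
have hl1 : l.+1%:R = l%:R + 1 :> R by rewrite -natr1.
by split; rewrite ?ltr_pdivrMr ?ler_pdivlMr // mulrBl ?hl1; lra.
Qed.

Lemma cell_res_half j y q r : cell j.+1 y = q * (2 ^ j.+1)%N%:Z + r%:Z ->
  cell j y = q * (2 ^ j)%N%:Z + (r./2)%:Z.
Proof.
move=> hq; have := cell_itv j.+1 y; rewrite hq => h; apply: cell_eq.
have pE i : ((2 ^ i)%N%:Z)%:~R = 2 ^+ i :> R by rewrite -pmulrn natrX.
move: h; rewrite !rmorphD !rmorphM /= !pE -!pmulrn exprS => /andP[h1 h2].
have hr : r%:R = (odd r)%:R + 2 * (r./2)%:R :> R.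
  by rewrite -natrM mul2n -natrD odd_double_half.
have ho : 0 <= ((odd r)%:R : R) <= 1 by rewrite ler0n lern1 leq_b1.
move: h1 h2; rewrite hr => h1 h2; case/andP: ho => ho1 ho2.
by apply/andP; split; lra.
Qed.

(** The increment of the character from the left endpoint of the parent interval to that of the
    interval. An even [l] shares its left endpoint with the parent and contributes nothing; for odd
    [l] the parent starts at (l-1)/2^j. Level 0 carries the initial value e(0) = 1. *)
Definition step_coef j l (k : int) : R[i] :=
  if j == 0%N then 1 else
  if odd l then e1 (k%:~R * (l%:R / 2 ^+ j)) - e1 (k%:~R * (l.-1%:R / 2 ^+ j)) else 0.

Lemma step_coef_telescope j y (k : int) :
  e1 (k%:~R * ((cell j.+1 y)%:~R / 2 ^+ j.+1)) =
  e1 (k%:~R * ((cell j y)%:~R / 2 ^+ j)) + step_coef j.+1 (res j.+1 y) k.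
Proof.
have [_ [q hq]] := res_spec j.+1 y; set r := res j.+1 y in hq *.
rewrite (cell_res_half hq) hq /step_coef /=.
have pE i : ((2 ^ i)%N%:Z)%:~R = 2 ^+ i :> R by rewrite -pmulrn natrX.
have p0 i : 2 ^+ i != 0 :> R by rewrite expf_neq0.
have split_q (i l : nat) : e1 (k%:~R * ((q * (2 ^ i)%N%:Z + l%:Z)%:~R / 2 ^+ i)) =
    e1 (k%:~R * (l%:R / 2 ^+ i)) :> R[i].
  rewrite -[RHS](e1Dz _ (k * q)); congr e1.
  rewrite rmorphD !rmorphM /= pE -pmulrn.
  have := p0 i; set X := 2 ^+ i => hX; field; exact: hX.
rewrite !split_q.
have hr : r%:R = (odd r)%:R + 2 * (r./2)%:R :> R.
  by rewrite -natrM mul2n -natrD odd_double_half.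
have hh : (r./2)%:R / 2 ^+ j = (r - odd r)%N%:R / 2 ^+ j.+1 :> R.
  rewrite exprS -{2}(odd_double_half r) addKn -mul2n natrM.
  have := p0 j; set X := 2 ^+ j => hX; field; exact: hX.
rewrite hh; case: ifP => hodd; last by rewrite subn0 addr0.
by rewrite subn1 addrC subrK.
Qed.

Lemma sum_step_coef L y (k : int) :
  \sum_(j < L.+1) step_coef j (res j y) k = e1 (k%:~R * ((cell L y)%:~R / 2 ^+ L)).
Proof.
elim: L => [|L IH].
  by rewrite big_ord_recr big_ord0 /= add0r /step_coef /= expr0 divr1 -rmorphM e1z.
by rewrite big_ord_recr /= IH step_coef_telescope.
Qed.

Lemma sum_dyadic (V : nmodType) L (F : dyadic L -> V) :
  \sum_I F I = \sum_(j < L.+1) \sum_(l < 2 ^ j) F (Tagged (fun j : 'I_L.+1 => 'I_(2 ^ j)) l).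
Proof.
rewrite sig_big_dep /=; apply: eq_bigr => -[j l] _ //.
Qed.

Definition ind L (I : dyadic L) y : R := (tagged I == res (tag I) y :> nat)%:R.

Definition coef L (I : dyadic L) (k : int) : R[i] := step_coef (tag I) (tagged I) k.

Lemma sum_ind (V : pzSemiRingType) L (F : nat -> nat -> V) y :
  \sum_(I : dyadic L) F (tag I) (tagged I) * (tagged I == res (tag I) y :> nat)%:R =
  \sum_(j < L.+1) F j (res j y).
Proof.
rewrite sum_dyadic; apply: eq_bigr => j _ /=.
have [hr _] := res_spec j y.
rewrite (bigD1 (Ordinal hr)) //= eqxx mulr1 big1 ?addr0 // => l hl.
have /negPf -> : val l != res j y by apply: contra hl => /eqP h; apply/eqP/val_inj.
by rewrite mulr0.
Qed.

Lemma nsq_step_coef j l (k : int) : (0 < j)%N ->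
  nsq (step_coef j l k) <= nsq (e1 (k%:~R / 2 ^+ j) - e1 0).
Proof.
rewrite /step_coef => /lt0n_neq0/negPf ->; case: ifP => hl; last by rewrite nsq0 nsq_ge0.
rewrite !nsq_e1B subr0 le_eqVlt; apply/orP; left; apply/eqP.
congr (4 * sin (pi * _) ^+ 2); case: l hl => // l _ /=.
by rewrite -natr1; ring.
Qed.

(* [a / (1 + a)] telescopes along [a = X / 2^j] against [min(4 / a, a)]. *)
Lemma level_weight (X v : R) j : 0 < X -> 0 <= v -> v <= 4 ->
  v <= (X / 2 ^+ j) ^+ 2 ->
  2 ^+ j * v <= 15 * X * ((2 * (X / 2 ^+ j)) / (1 + 2 * (X / 2 ^+ j)) -
                          (X / 2 ^+ j) / (1 + X / 2 ^+ j)).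
Proof.
move=> X0 v0 v4 va; have p0 : 0 < 2 ^+ j :> R by rewrite exprn_gt0.
set a := X / 2 ^+ j in va *; have a0 : 0 < a by rewrite divr_gt0.
have -> : 2 ^+ j = X / a by rewrite /a; field; rewrite !gt_eqF.
have -> : 15 * X * (2 * a / (1 + 2 * a) - a / (1 + a)) =
   X / a * (15 * a ^+ 2 / ((1 + 2 * a) * (1 + a))).
  by field; rewrite !gt_eqF //; lra.
rewrite ler_pM2l ?divr_gt0 // ler_pdivlMr; last by rewrite mulr_gt0 //; lra.
have [h|h] := leP a 2.
  apply: (@le_trans _ _ (a ^+ 2 * ((1 + 2 * a) * (1 + a)))).
    by apply: ler_wpM2r => //; rewrite mulr_ge0 //; lra.
  rewrite [leRHS]mulrC; apply: ler_wpM2l; first exact: sqr_ge0.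
  by nra.
apply: (@le_trans _ _ (4 * ((1 + 2 * a) * (1 + a)))); last by nra.
by apply: ler_wpM2r => //; rewrite mulr_ge0 //; lra.
Qed.

(** Each of the 2^j intervals of level j >= 1 contributes at most min(4, (2 pi k/2^j)^2). By
    [level_weight] these levels telescope to at most 15 * 2 pi |k| <= 120 |k|, using pi <= 4; level
    0 adds 1 <= |k|, whence 121. *)
Lemma sum_nsq_coef L (k : int) :
  \sum_(I : dyadic L) nsq (coef I k) <= if k == 0 then 1 else 121 * `|k%:~R|.
Proof.
pose v j : R := nsq (e1 (k%:~R / 2 ^+ j) - e1 0).
have hsum : \sum_(I : dyadic L) nsq (coef I k) <= 1 + \sum_(j < L) 2 ^+ j.+1 * v j.+1.
  rewrite sum_dyadic big_ord_recl /=; apply: lerD.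
    rewrite (eq_bigr (fun=> 1)) ?sumr_const ?card_ord // => l _.
    by rewrite /coef /step_coef /= nsq1.
  apply: ler_sum => j _; apply: (@le_trans _ _ (\sum_(l < 2 ^ lift ord0 j) v j.+1)).
    by apply: ler_sum => l _; apply: nsq_step_coef.
  by rewrite sumr_const card_ord -[leLHS]mulr_natl natrX lexx.
apply: le_trans hsum _; case: eqVneq => [k0|k0].
  rewrite big1 ?addr0 // => j _.
  by rewrite /v k0 mul0r subrr nsq0 mulr0.
have k1 : 1 <= `|k%:~R| :> R.
  by rewrite -intr_norm ler1z -gtz0_ge1 normr_gt0.
pose X : R := 2 * pi * `|k%:~R|.
have X0 : 0 < X by rewrite !mulr_gt0 ?pi_gt0 //; lra.
pose g j : R := (X / 2 ^+ j) / (1 + X / 2 ^+ j).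
have hX j : 0 < X / 2 ^+ j by rewrite divr_gt0 ?exprn_gt0.
have hb : \sum_(j < L) 2 ^+ j.+1 * v j.+1 <= 15 * X * (g 0%N - g L).
  elim: L => [|n IH]; first by rewrite big_ord0 subrr mulr0.
  rewrite big_ord_recr /=.
  have -> : 15 * X * (g 0%N - g n.+1) = 15 * X * (g 0%N - g n) + 15 * X * (g n - g n.+1) by ring.
  apply: lerD IH _.
  have e : X / 2 ^+ n = 2 * (X / 2 ^+ n.+1).
    by rewrite exprS; field; rewrite expf_neq0.
  rewrite /g e; apply: level_weight => //; first exact: nsq_ge0.
    exact: nsq_e1B_le4.
  apply: le_trans (nsq_e1B_le_sqr _ _) _; rewrite subr0 /X !exprMn real_normK ?num_real //.
  by rewrite !exprVn; set Y := _ ^-1; rewrite le_eqVlt; apply/orP; left; apply/eqP; ring.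
have g0 : g 0%N <= 1.
  by rewrite /g ler_pdivrMr; have := hX 0%N; lra.
have gL : 0 <= g L by rewrite /g divr_ge0 //; have := hX L; lra.
apply: (@le_trans _ _ (1 + 15 * X)).
  rewrite lerD2l; apply: le_trans hb _; rewrite -[leRHS]mulr1.
  by apply: ler_wpM2l; lra.
rewrite /X; have p4 := pi_le4 R.
have : pi * `|k%:~R| <= 4 * `|k%:~R| :> R by apply: ler_wpM2r => //; lra.
by rewrite -[2 * pi * _]mulrA; lra.
Qed.

End Cells.

Lemma card_lt_first s d (hsd : (s <= d)%N) : #|[pred i : 'I_d | (i < s)%N]| = s.
Proof.
have inj : injective (widen_ord hsd) by move=> a b /(congr1 val) /= /val_inj.
rewrite -[RHS](card_ord s) -(card_imset _ inj).
apply: eq_card => i; rewrite unfold_in; apply/idP/imsetP => [hi|[j _ ->]]; last exact: (valP j).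
by exists (Ordinal hi) => //; apply: val_inj.
Qed.

(** * Products over the coordinates: boxes, their weights and their number *)

Section BoxSums.
Context (R : realType) (d L : nat).
Implicit Types (B : box d L) (tau x : vec R d) (k : freq d) (y : 'I_d -> R).

Definition disp tau x (i : 'I_d) : R := (tnth x i : R) - tnth tau i.

Lemma indic_shifted_box tau B x :
  \1_(shifted_box tau B) x = \prod_i ind (B i) (disp tau x i) :> R.
Proof.
rewrite indicE; case: (boolP (x \in _)) => [/set_mem hx|/negP hx].
  rewrite big1 // => i _; rewrite /ind.
  have [b [k [hb hk]]] := hx i.
  have -> : tagged (B i) = res (tag (B i)) (disp tau x i) :> nat.
    apply/in_dyadic_cell; exists b, k; split=> //.
    by rewrite /disp hk; ring.
  by rewrite eqxx.
apply/esym/eqP/prodf_eq0.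
have /existsNP[i hi] : ~ forall i, tagged (B i) = res (tag (B i)) (disp tau x i) :> nat.
  move=> h; apply: hx; apply/mem_set => i.
  have /in_dyadic_cell[b [k [hb hk]]] := h i.
  exists b, k; split=> //; move: hk; rewrite /disp => hk.
  by rewrite -[LHS](subrK (tnth tau i : R)) hk; ring.
exists i => //; rewrite /ind.
have /negPf -> : tagged (B i) != res (tag (B i)) (disp tau x i) :> nat by apply/eqP.
by rewrite eqxx.
Qed.

Definition box_coef B k : R[i] := \prod_i coef R (B i) (k i).

Definition grid_dot k y : R := \sum_i (k i)%:~R * ((cell L (y i))%:~R / 2 ^+ L).

(** Distributivity: a sum over boxes of products is the product over coordinates of the
    one-dimensional telescoping sums. *)
Lemma sum_box_coef tau k x :
  \sum_B box_coef B k * (\1_(shifted_box tau B) x)%:C%C = e1 (grid_dot k (disp tau x)).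
Proof.
under eq_bigr do rewrite indic_shifted_box.
transitivity (\sum_(B : box d L) \prod_(i < d) (coef R (B i) (k i) * (ind (B i) (disp tau x i))%:C%C)).
  apply: eq_bigr => B _; rewrite big_split /=; congr (_ * _).
  by apply: (big_morph (fun r : R => r%:C%C)) => // a b; rewrite rmorphM.
rewrite -(bigA_distr_bigA (fun i (I : dyadic L) =>
  coef R I (k i) * (ind I (disp tau x i))%:C%C)) /grid_dot e1_sum.
apply: eq_bigr => i _; rewrite -sum_step_coef -(@sum_ind R _ L (fun j l => step_coef R j l (k i))).
apply: eq_bigr => I _; rewrite /ind /coef.
by case: (_ == _); rewrite ?rmorph1 ?rmorph0.
Qed.

Lemma sum_nsq_box_coef k :
  \sum_B nsq (box_coef B k) <= \prod_i (if k i == 0 then 1 else 121 * `|(k i)%:~R|).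
Proof.
rewrite (eq_bigr (fun B : box d L => \prod_i nsq (coef R (B i) (k i)))); last first.
  by move=> B _; exact: nsq_prod.
rewrite -(bigA_distr_bigA (fun i (I : dyadic L) => nsq (coef R I (k i)))).
apply: ler_prod => i _; rewrite sum_nsq_coef andbT.
by apply: sumr_ge0 => I _; exact: nsq_ge0.
Qed.

(** For [k i = 0] the character is constant in coordinate i, so its increments above level 0 vanish.
    Frequencies supported on the first s coordinates thus use only boxes of nonzero weight. *)
Lemma box_coef_inactive B k i : tag (B i) != ord0 -> k i = 0 -> box_coef B k = 0.
Proof.
move=> hB hk; apply/eqP/prodf_eq0; exists i => //; rewrite hk /coef /step_coef.
have /negPf -> : (tag (B i) : nat) != 0%N by apply: contra hB => /eqP h; apply/eqP/val_inj.
by rewrite !mul0r e1_0 subrr; case: ifP.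
Qed.

Section FirstWeights.
Variable s : nat.
Hypothesis hsd : (s <= d)%N.
Local Notation gam := (@first_weights R d s).
Local Notation active := (active_box L gam).

Let wt (i : 'I_d) (j : nat) : R := if j != 0%N then gam i else 1.

Let box_weightE B : box_weight gam B = \prod_i wt i (tag (B i)).
Proof.
rewrite /box_weight big_mkcond; apply: eq_bigr => i _ /=; rewrite /wt.
have -> : (tag (B i) != ord0) = ((tag (B i) : nat) != 0%N) by [].
by case: ifP.
Qed.

Let gam01 i : gam i = 0 \/ gam i = 1.
Proof. by rewrite /first_weights; case: (_ < _)%N; [right|left]. Qed.

Lemma box_weight01 B : box_weight gam B = (box_weight gam B != 0)%:R.
Proof.
have : box_weight gam B = 0 \/ box_weight gam B = 1.
  rewrite /box_weight; apply: (big_ind (fun r => r = 0 \/ r = 1)) => //; first by right.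
  by move=> a b [->|->] [->|->]; rewrite ?mul0r ?mulr0 ?mulr1; auto.
by case=> ->; rewrite ?eqxx ?oner_eq0.
Qed.

Lemma sum_active (F : box d L -> R) :
  \sum_(B : active) F (val B) = \sum_B box_weight gam B * F B.
Proof.
rewrite -(big_sub (fun B : box d L => box_weight gam B != 0) F) big_mkcond.
apply: eq_bigr => B _; rewrite [in RHS]box_weight01 unfold_in.
by case: (_ != 0); rewrite ?mul1r ?mul0r.
Qed.

Lemma prod_first (c : R) : \prod_(i < d) (if (i < s)%N then c else 1) = c ^+ s.
Proof.
by rewrite -big_mkcond /= prodr_const card_lt_first.
Qed.

(** On each level exactly one interval contains a given coordinate: L + 1 choices in each of the
    first s coordinates, and only level 0 elsewhere. This supplies [Q]. *)
Lemma sum_sqr_active tau x :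
  \sum_(B : active) (box_weight gam (val B) * \1_(shifted_box tau (val B)) x) ^+ 2 <=
  L.+1%:R ^+ s.
Proof.
rewrite (sum_active (fun B => (box_weight gam B * \1_(shifted_box tau B) x) ^+ 2)).
rewrite (eq_bigr (fun B => \prod_i (wt i (tag (B i)) * ind (B i) (disp tau x i)))); last first.
  move=> B _; rewrite big_split /= -box_weightE -indic_shifted_box.
  by rewrite box_weight01 indicE; case: (_ != 0); case: (_ \in _);
    rewrite /= ?mulr0n ?mulr1n; ring.
rewrite -(bigA_distr_bigA (fun i (I : dyadic L) => wt i (tag I) * ind I (disp tau x i))).
rewrite -prod_first; apply: ler_prod => i _.
have -> : \sum_(I : dyadic L) wt i (tag I) * ind I (disp tau x i) = \sum_(j < L.+1) wt i j.
  exact: (@sum_ind R R L (fun j _ => wt i j) (disp tau x i)).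
apply/andP; split.
  by apply: sumr_ge0 => j _; rewrite /wt; case: ifP => // _; exact: ler0n.
rewrite /wt /first_weights; case: ifP => hi.
  apply: (@le_trans _ _ (\sum_(j < L.+1) 1)); last by rewrite sumr_const card_ord.
  by apply: ler_sum => j _; case: ifP.
by rewrite big_ord_recl big1 ?addr0.
Qed.

(** An active coordinate has 1 + 2 + ... + 2^L < 2^(L+1) intervals. This crude count suffices
    because only its logarithm enters lambda. *)
Lemma card_active : (#|{: active}|%:R : R) <= (2 ^+ (L.+1 * s)).
Proof.
have -> : #|{: active}|%:R = \sum_(B : active) (1 : R) by rewrite sumr_const.
rewrite (sum_active (fun=> 1)).
under eq_bigr do rewrite mulr1 box_weightE.
rewrite -(bigA_distr_bigA (fun i (I : dyadic L) => wt i (tag I))).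
rewrite exprM -prod_first; apply: ler_prod => i _; rewrite sum_dyadic.
under eq_bigr do rewrite sumr_const card_ord.
apply/andP; split.
  apply: sumr_ge0 => j _; apply: mulrn_wge0; rewrite /wt /=; case: ifP => // _; exact: ler0n.
rewrite /wt /first_weights; case: ifP => hi.
  apply: (@le_trans _ _ (\sum_(j < L.+1) 2 ^+ j)).
    by apply: ler_sum => j _; rewrite -natrX /=; case: ifP.
  elim: (L) => [|n IH]; first by rewrite big_ord_recl big_ord0 addr0 expr0 ler1n.
  rewrite big_ord_recr /=; apply: le_trans (lerD IH (lexx _)) _.
  by rewrite [leRHS]exprS mulr_natl mulr2n.
by rewrite big_ord_recl big1 ?addr0 // => j _; rewrite mul0rn.
Qed.

End FirstWeights.
End BoxSums.

Section SOWeight.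
Context (R : realType) (d : nat).
Implicit Types k : freq d.

(** For nonzero [k], the single term of [SO_weight] in which u is the support of [k]. *)
Definition supp_prod k : R := \prod_i (if k i == 0 then 1 else `|(k i)%:~R|).

Lemma norm_int_ge1 (m : int) : m != 0 -> 1 <= `|m%:~R| :> R.
Proof. by move=> m0; rewrite -intr_norm ler1z -gtz0_ge1 normr_gt0. Qed.

Lemma supp_prod_ge1 k : 1 <= supp_prod k.
Proof.
rewrite /supp_prod; apply: (big_ind (fun r : R => 1 <= r)) => // [a b ha hb|i _].
  by rewrite -[1]mulr1; apply: ler_pM.
by case: ifPn => // /norm_int_ge1.
Qed.

Lemma supp_prod_le k : k != 0 -> supp_prod k <= SO_weight R k.
Proof.
move=> /neq0_freq[i ki]; pose u := [set j | k j != 0]%SET.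
have hu : u != finset.set0 by apply/set0Pn; exists i; rewrite inE.
rewrite /SO_weight (bigD1 u) //=; apply: ler_wpDr.
  by apply: sumr_ge0 => v _; apply: prodr_ge0 => j _; exact: normr_ge0.
rewrite le_eqVlt; apply/orP; left; apply/eqP.
rewrite /supp_prod [RHS]big_mkcond; apply: eq_bigr => j _ /=.
by rewrite inE; case: eqP.
Qed.

Lemma norm_le_supp_prod k i : `|(k i)%:~R| <= supp_prod k.
Proof.
case: (eqVneq (k i) 0) => [->|ki].
  by rewrite normr0; apply: le_trans (supp_prod_ge1 k).
rewrite /supp_prod (bigD1 i) //= (negPf ki) -[leLHS]mulr1.
apply: ler_wpM2l => //.
apply: (big_ind (fun r : R => 1 <= r)) => // [a b ha hb|j _].
  by rewrite -[1]mulr1; apply: ler_pM.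
by case: ifPn => // /norm_int_ge1.
Qed.

Lemma sum_norm_le s k : (s <= d)%N -> (forall j : 'I_d, (s <= j)%N -> k j = 0) ->
  \sum_i `|(k i)%:~R| <= s%:R * supp_prod k.
Proof.
move=> hsd hk; apply: (@le_trans _ _ (\sum_(i < d | (i < s)%N) supp_prod k)).
  rewrite [leRHS]big_mkcond; apply: ler_sum => i _; case: ifPn => hi.
    exact: norm_le_supp_prod.
  by rewrite hk ?normr0 // leqNgt.
by rewrite sumr_const (card_lt_first hsd) mulr_natl.
Qed.

End SOWeight.

(** * Box decomposition of a trigonometric polynomial under a random shift *)

Section TrigDecomposition.
Context (R : realType) (d L s : nat) (I : finType) (kap : I -> freq d) (w : I -> R[i]).
Hypothesis hsd : (s <= d)%N.
Hypothesis kap_inj : injective kap.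
Hypothesis kap_neq0 : forall i, kap i != 0.
Hypothesis kap_first : forall i (j : 'I_d), (s <= j)%N -> kap i j = 0.
Local Notation P := (unif R d).
Local Notation E u := (\int[unif R d]_x u x).
Local Notation gam := (@first_weights R d s).
Local Notation active := (active_box L gam).
Implicit Types (tau x y : vec R d) (B : box d L) (c : I -> R[i]).

(** The minus sign makes this the real part of the complex sum of c_i e(<k_i, x>). *)
Definition ctrig c : vec R d -> R :=
  trig kap (fun i => complex.Re (c i)) (fun i => - complex.Im (c i)).

Lemma ctrigE c x : ctrig c x = \sum_i complex.Re (c i * e1 (freq_dot (kap i) x)).
Proof. by apply: eq_bigr => i _; rewrite cplx_ReM mulNr. Qed.

Lemma mean_sqr_ctrig c : E (fun x => ctrig c x ^+ 2) <= \sum_i nsq (c i).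
Proof.
apply: le_trans (mean_sqr_trig kap_inj _ _) _.
by apply: ler_sum => i _; rewrite sqrrN.
Qed.

(** The coefficient phi_B(tau). Cells are measured from the shifted origin, so every frequency
    carries a factor e(<k, tau>) and phi_B is a trigonometric polynomial in [tau]. *)
Definition box_value B tau : R := ctrig (fun i => w i * box_coef R B (kap i)) tau.

Definition remainder tau x : R :=
  \sum_i complex.Re (w i * (e1 (freq_dot (kap i) x) -
    e1 (freq_dot (kap i) tau + grid_dot L (kap i) (disp tau x)))).

Lemma ctrig_decomp tau x :
  ctrig w x = remainder tau x + \sum_B \1_(shifted_box tau B) x * box_value B tau.
Proof.
have -> : \sum_B \1_(shifted_box tau B) x * box_value B tau =
  \sum_i complex.Re (w i * e1 (freq_dot (kap i) tau + grid_dot L (kap i) (disp tau x))).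
  transitivity (\sum_(B : box d L) \sum_i complex.Re (w i * e1 (freq_dot (kap i) tau) *
      (box_coef R B (kap i) * (\1_(shifted_box tau B) x)%:C%C))).
    apply: eq_bigr => B _; rewrite /box_value ctrigE mulr_sumr; apply: eq_bigr => i _.
    by rewrite !cplx_ReM !cplx_ImM /=; ring.
  rewrite exchange_big /=; apply: eq_bigr => i _.
  by rewrite -cplx_Re_sum -mulr_sumr sum_box_coef e1D mulrA.
rewrite ctrigE /remainder -big_split /=; apply: eq_bigr => i _.
by rewrite -cplx_ReD -mulrDr subrK.
Qed.

Lemma box_value_inactive B tau : box_weight gam B = 0 -> box_value B tau = 0.
Proof.
move=> /eqP/prodf_eq0[j hj /eqP gj].
have sj : (s <= j)%N.
  by rewrite leqNgt; apply/negP => h; move: gj; rewrite /first_weights h => /eqP; rewrite oner_eq0.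
rewrite /box_value ctrigE big1 // => i _.
by rewrite (box_coef_inactive _ hj) ?kap_first // mulr0 mul0r.
Qed.

Lemma ctrig_decomp_active tau x :
  ctrig w x = remainder tau x +
  \sum_(B : active) box_weight gam (val B) * \1_(shifted_box tau (val B)) x * box_value (val B) tau.
Proof.
rewrite (ctrig_decomp tau) (@sum_active R d L s (fun B =>
  box_weight gam B * \1_(shifted_box tau B) x * box_value B tau)).
congr (_ + _); apply: eq_bigr => B _.
have [h|h] := eqVneq (box_weight gam B) 0.
  by rewrite box_value_inactive // !mulr0.
by rewrite box_weight01 h /= mulr1n; ring.
Qed.

Definition so_sum : R := \sum_i nsq (w i) * SO_weight R (kap i).

Lemma sum_nsq_supp_prod_le : \sum_i nsq (w i) * supp_prod R (kap i) <= so_sum.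
Proof.
by apply: ler_sum => i _; apply: ler_wpM2l; [exact: nsq_ge0 | exact: supp_prod_le].
Qed.

Lemma sum_nsq_box_coef_le i :
  \sum_(B : box d L) nsq (box_coef R B (kap i)) <= 121 ^+ s * supp_prod R (kap i).
Proof.
apply: le_trans (sum_nsq_box_coef _ _ _) _.
rewrite -(prod_first hsd) /supp_prod -big_split /=; apply: ler_prod => j _.
case: eqVneq => [h|h]; last first.
  case: ltnP => hj; last by rewrite kap_first ?eqxx in h.
  by rewrite lexx andbT mulr_ge0.
by rewrite ler01 mulr1; case: ifP => _; lra.
Qed.

Lemma square_integrable_ctrig c : square_integrable P (ctrig c).
Proof. exact: square_integrable_trig. Qed.

(** Orthogonality in tau separates the frequencies box by box; then the sums are exchanged, and for
    each frequency the squared coefficients are summed over all boxes. *)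
Lemma mean_box_values :
  (\int[P]_tau (\sum_(B : active) box_value (val B) tau ^+ 2)%:E <=
   (121 ^+ s * so_sum)%:E)%E.
Proof.
have hI (B : active) : P.-integrable setT (EFin \o (fun tau => box_value (val B) tau ^+ 2)).
  exact: integrable_sqr (square_integrable_ctrig _).
have -> : (\int[P]_tau (\sum_(B : active) box_value (val B) tau ^+ 2)%:E)%E =
  (\sum_(B : active) E (fun tau => box_value (val B) tau ^+ 2))%:E.
  rewrite -mean_sum // /Rintegral fineK //; apply: integrable_fin_num => //.
  exact: integrable_sumR.
rewrite lee_fin; apply: (@le_trans _ _ (\sum_(B : box d L) \sum_i nsq (w i * box_coef R B (kap i)))).
  rewrite (@sum_active R d L s (fun B => E (fun tau => box_value B tau ^+ 2))).
  apply: ler_sum => B _; rewrite box_weight01; case: (_ != 0); rewrite /= ?mulr1n ?mulr0n.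
    by rewrite mul1r; exact: mean_sqr_ctrig.
  by rewrite mul0r; apply: sumr_ge0 => i _; exact: nsq_ge0.
rewrite exchange_big /=.
apply: (@le_trans _ _ (\sum_i nsq (w i) * (121 ^+ s * supp_prod R (kap i)))).
  apply: ler_sum => i _; under eq_bigr do rewrite nsqM.
  rewrite -mulr_sumr; apply: ler_wpM2l; first exact: nsq_ge0.
  exact: sum_nsq_box_coef_le.
under eq_bigr do rewrite mulrCA.
rewrite -mulr_sumr; apply: ler_wpM2l; first exact: exprn_ge0.
exact: sum_nsq_supp_prod_le.
Qed.

Lemma cellDz (j : nat) (y : R) (m : int) : cell j (y + m%:~R) = cell j y + m * (2 ^ j)%N%:Z.
Proof.
apply: cell_eq; have := cell_itv j y.
by rewrite intrD intrM -pmulrn natrX => /andP[h1 h2]; apply/andP; split; lra.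
Qed.

(** With x = tau + y modulo 1, the displacement from the shift is y up to integers, which the
    characters do not see. Only the factor e(<k, tau>) still involves [tau]; these are the
    coefficients in front of it. *)
Definition local_coef y i : R[i] :=
  w i * (e1 (freq_dot (kap i) y) - e1 (grid_dot L (kap i) (fun j => tnth y j : R))).

Lemma remainder_shift tau y : remainder tau (tshift tau y) = ctrig (local_coef y) tau.
Proof.
rewrite ctrigE; apply: eq_bigr => i _; congr complex.Re.
have [m ->] := freq_dot_shift (kap i) tau y.
have -> : grid_dot L (kap i) (disp tau (tshift tau y)) =
  grid_dot L (kap i) (fun j => tnth y j : R) +
  (- \sum_j kap i j * Num.floor ((tnth y j : R) + tnth tau j))%:~R.
  rewrite /grid_dot rmorphN rmorph_sum /= -sumrB; apply: eq_bigr => j _.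
  have -> : disp tau (tshift tau y) j = (tnth y j : R) + (- Num.floor ((tnth y j : R) + tnth tau j))%:~R.
    by rewrite /disp tnth_shift /fract rmorphN /=; ring.
  rewrite cellDz rmorphD !rmorphM rmorphN /= -pmulrn natrX.
  by field; rewrite expf_neq0.
rewrite [freq_dot _ tau + _]addrA !e1Dz !e1D /local_coef; ring.
Qed.

Lemma nsq_local_coef y i :
  nsq (local_coef y i) <= nsq (w i) * (16 * s%:R / 2 ^+ L * supp_prod R (kap i)).
Proof.
rewrite nsqM; apply: ler_wpM2l; first exact: nsq_ge0.
apply: le_trans (nsq_e1B_le _ _) _.
have -> : 16 * s%:R / 2 ^+ L * supp_prod R (kap i) =
  16 * ((2 ^+ L)^-1 * (s%:R * supp_prod R (kap i))) by ring.
rewrite ler_pM2l //.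
have p0 : 0 < 2 ^+ L :> R by rewrite exprn_gt0.
apply: (@le_trans _ _ ((2 ^+ L)^-1 * \sum_j `|(kap i j)%:~R|)); last first.
  apply: ler_wpM2l; first by rewrite invr_ge0 ltW.
  by apply: sum_norm_le => // j; exact: kap_first.
rewrite /freq_dot /grid_dot -sumrB mulr_sumr; apply: le_trans (ler_norm_sum _ _ _) _.
apply: ler_sum => j _; rewrite -mulrBr normrM mulrC; apply: ler_wpM2r => //.
have := cell_itv L (tnth y j : R) => /andP[h1 h2].
have -> : (tnth y j : R) - (cell L (tnth y j : R))%:~R / 2 ^+ L =
  (2 ^+ L * (tnth y j : R) - (cell L (tnth y j : R))%:~R) / 2 ^+ L.
  by field; rewrite gt_eqF.
rewrite normrM [X in _ * X]ger0_norm ?invr_ge0 ?exprn_ge0 // -[leRHS]mul1r.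
apply: ler_wpM2r; first by rewrite invr_ge0 ltW.
by rewrite ger0_norm; lra.
Qed.

Lemma measurable_cell j : measurable_fun setT (fun y : R => (cell j y)%:~R : R).
Proof.
apply: nondecreasing_measurable => // a b ab; rewrite ler_int /cell lerD2r.
by apply: le_ceil; rewrite ler_pM2l // exprn_gt0.
Qed.

Lemma measurable_remainder (dU : measure_display) (U : measurableType dU)
    (f g : U -> vec R d) : measurable_fun setT f -> measurable_fun setT g ->
  measurable_fun setT (fun u => remainder (f u) (g u)).
Proof.
move=> mf mg.
have mt (h : U -> vec R d) (j : 'I_d) : measurable_fun setT h ->
    measurable_fun setT (fun u => tnth (h u) j : R).
  by move=> mh; exact: (measurableT_comp (measurable_tnth j) mh).
have mdot k (h : U -> vec R d) : measurable_fun setT h ->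
    measurable_fun setT (fun u => freq_dot k (h u) : R).
  by move=> mh; exact: (measurableT_comp (measurable_freq_dot k) mh).
have mgrid k : measurable_fun setT (fun u => grid_dot L k (disp (f u) (g u)) : R).
  apply: measurable_sum => j; apply: measurable_funM => //; apply: measurable_funM => //.
  apply: (measurableT_comp (measurable_cell L)).
  by apply: measurable_funB; exact: mt.
have mcos (h : U -> R) : measurable_fun setT h -> measurable_fun setT (fun u => cos (2 * pi * h u)).
  move=> mh; apply: (measurableT_comp (f := cos)).
    by apply: continuous_measurable_fun; exact: continuous_cos.
  exact: measurable_funM.
have msin (h : U -> R) : measurable_fun setT h -> measurable_fun setT (fun u => sin (2 * pi * h u)).
  move=> mh; apply: (measurableT_comp (f := sin)).
    by apply: continuous_measurable_fun; exact: continuous_sin.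
  exact: measurable_funM.
apply: measurable_sum => i.
have m1 := mdot (kap i) _ mg.
have m2 := measurable_funD (mdot (kap i) _ mf) (mgrid (kap i)).
rewrite (_ : (fun u => _) = (fun u =>
  complex.Re (w i) * (cos (2 * pi * freq_dot (kap i) (g u)) -
     cos (2 * pi * (freq_dot (kap i) (f u) + grid_dot L (kap i) (disp (f u) (g u))))) -
  complex.Im (w i) * (sin (2 * pi * freq_dot (kap i) (g u)) -
     sin (2 * pi * (freq_dot (kap i) (f u) + grid_dot L (kap i) (disp (f u) (g u))))))); last first.
  by apply/funext => u; rewrite cplx_ReM.
apply: measurable_funB; apply: measurable_funM => //; apply: measurable_funB;
  by [exact: mcos | exact: msin].
Qed.

(** The inner integral is rotated by tau and Tonelli moves the tau-integration inside. For fixed y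
    the integrand is the square of a trigonometric polynomial in tau, where orthogonality
    applies. *)
Lemma mean_remainder :
  (\int[P]_tau \int[P]_x (remainder tau x ^+ 2)%:E <=
   (16 * s%:R / 2 ^+ L * so_sum)%:E)%E.
Proof.
have mS : measurable_fun setT (fun p : vec R d * vec R d => tshift p.1 p.2).
  apply/measurable_fun_tnthP => j.
  rewrite (_ : _ \o _ = fun p : vec R d * vec R d =>
     fract ((tnth p.2 j : R) + (tnth p.1 j : R)) : measurableTypeR R); last first.
    by apply/funext => p /=; rewrite tnth_shift.
  apply: (measurableT_comp (@measurable_frac R)); apply: measurable_funD.
    exact: (measurableT_comp (measurable_tnth j) measurable_snd).
  exact: (measurableT_comp (measurable_tnth j) measurable_fst).
pose F (p : vec R d * vec R d) : \bar R := (remainder p.1 (tshift p.1 p.2) ^+ 2)%:E.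
have mF : measurable_fun setT F.
  apply/measurable_EFinP/measurable_funX; apply: measurable_remainder => //.
have F0 p : (0 <= F p)%E by rewrite lee_fin sqr_ge0.
have -> : (\int[P]_tau \int[P]_x (remainder tau x ^+ 2)%:E =
   \int[P]_tau \int[P]_y F (tau, y))%E.
  apply: eq_integral => tau _; rewrite -(integral_shift tau) //.
    apply/measurable_EFinP/measurable_funX; exact: measurable_remainder.
  by move=> x; rewrite lee_fin sqr_ge0.
rewrite (fubini_tonelli F mF F0).
have mG := measurable_fun_fubini_tonelli_G F mF F0.
have hy y : (\int[P]_tau F (tau, y) <= (16 * s%:R / 2 ^+ L * so_sum)%:E)%E.
  rewrite /F /=; under eq_integral do rewrite remainder_shift.
  rewrite (mean_sqrE (square_integrable_ctrig _)) lee_fin.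
  apply: le_trans (mean_sqr_ctrig _) _.
  apply: (@le_trans _ _ (\sum_i nsq (w i) * (16 * s%:R / 2 ^+ L * supp_prod R (kap i)))).
    by apply: ler_sum => i _; exact: nsq_local_coef.
  under eq_bigr do rewrite mulrCA.
  rewrite -mulr_sumr; apply: ler_wpM2l; last exact: sum_nsq_supp_prod_le.
  by rewrite divr_ge0 ?exprn_ge0 // mulr_ge0.
apply: (@le_trans _ _ (\int[P]_y (16 * s%:R / 2 ^+ L * so_sum)%:E)%E).
  apply: ge0_le_integral => //; first [exact: mG | by move=> y _; exact: hy
    | by move=> y _; apply: integral_ge0].
rewrite le_eqVlt; apply/orP; left; apply/eqP; exact: integral_probability_cst.
Qed.

End TrigDecomposition.

(** * Mean square error of trigonometric polynomials *)

Section ProductMarginals.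
Context d1 d2 (T1 : measurableType d1) (T2 : measurableType d2) (R : realType).
Context (P : probability T1 R) (Q : probability T2 R).
Local Open Scope ereal_scope.

Lemma integral_prod_fst (F : T1 -> \bar R) :
  measurable_fun setT F -> (forall x, 0 <= F x) ->
  \int[P \x Q]_w F w.1 = \int[P]_x F x.
Proof.
move=> mF F0; rewrite (fubini_tonelli1 (fun w => F w.1)) //.
  by apply: eq_integral => x _; rewrite /fubini_F /= integral_probability_cst.
exact: (measurableT_comp mF measurable_fst).
Qed.

Lemma integral_prod_snd (F : T2 -> \bar R) :
  measurable_fun setT F -> (forall x, 0 <= F x) ->
  \int[P \x Q]_w F w.2 = \int[Q]_x F x.
Proof.
move=> mF F0; rewrite (fubini_tonelli1 (fun w => F w.2)) //.
  by rewrite /fubini_F /= integral_probability_cst.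
exact: (measurableT_comp mF measurable_snd).
Qed.

End ProductMarginals.

Section ErrorBound.
Context (R : realType) (d L s n T i : nat) (Cdelta : R).
Context (delta : nat -> nat -> R) (listing : {set 'I_(n ^ 2)} -> seq 'I_(n ^ 2)).
Hypothesis hsd : (s <= d)%N.
Hypothesis n_gt0 : (0 < n)%N.
Hypothesis hT : n = (2 ^ T)%N.
Hypothesis hi : (i < n)%N.
Hypothesis hdelta : admissible_failure Cdelta delta.
Hypothesis hlisting : forall A, perm_eq (listing A) (enum A).
Local Notation P := (unif R d).
Local Notation E u := (\int[unif R d]_x u x).
Local Notation N := (n ^ 2)%N.
Local Notation gam := (@first_weights R d s).
Local Notation active := (active_box L gam).

Context (I : finType) (kap : I -> freq d) (w : I -> R[i]).
Hypothesis kap_inj : injective kap.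
Hypothesis kap_neq0 : forall i, kap i != 0.
Hypothesis kap_first : forall i (j : 'I_d), (s <= j)%N -> kap i j = 0.
Context (f g : vec R d -> R).
Hypothesis hg : square_integrable P g.
Hypothesis g_mean : E g = 0.
Hypothesis hfg : forall x, cube x -> f x - integ f = g x + ctrig kap w x.

Definition walk_factor : R :=
  30 * ((1 + `|Cdelta|) * ln ((N + #|{: active}|) * N)%:R) * (1 + L.+1%:R ^+ s).

Lemma walk_factor_ge0 : 0 <= walk_factor.
Proof.
have h : (0 < (N + #|{: active}|) * N)%N by rewrite muln_gt0 addn_gt0 expn_gt0 n_gt0.
by rewrite /walk_factor !mulr_ge0 ?ln_ge0 ?ler1n.
Qed.

(** Only the randomness of the walks is averaged here, with shift and samples fixed. At the root the
    set consists of all n^2 samples, so its squared mean carries n^-4. *)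
Lemma expected_err_le (tau : vec R d) (z : N.-tuple (vec R d)) :
  (forall a, cube (tnth z a)) ->
  expect (wsubgtrans L gam delta listing tau z T)
    (fun As => err z (nth finset.set0 As i) f ^+ 2) <=
  (n%:R ^+ 4)^-1 * (0 + \sum_a (g (tnth z a) + ctrig kap w (tnth z a))) ^+ 2 +
  16 / n%:R ^+ 3 * (\sum_a g (tnth z a) ^+ 2) +
  16 / n%:R ^+ 3 * (\sum_a remainder L kap w tau (tnth z a) ^+ 2) +
  16 * walk_factor / n%:R ^+ 2 * (\sum_(B : active) box_value kap w (val B) tau ^+ 2).
Proof.
move=> hz.
pose th a := g (tnth z a) + remainder L kap w tau (tnth z a).
pose phi (B : active) := box_value kap w (val B) tau.
have n0 : 0 < n%:R :> R by rewrite ltr0n.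
have nT : n%:R = 2 ^+ T :> R by rewrite hT natrX.
have hF a : th a + \sum_(B : active) box_weight gam (val B) *
    \1_(shifted_box tau (val B)) (tnth z a) * phi B = g (tnth z a) + ctrig kap w (tnth z a).
  by rewrite /th -addrA; congr (_ + _); exact/esym/ctrig_decomp_active.
have hL : 0 <= Lambda N Cdelta phi (L.+1%:R ^+ s).
  by rewrite mulr_ge0 ?walk_factor_ge0 //; apply: sumr_ge0 => B _; exact: sqr_ge0.
have hN : N = (n * 2 ^ T)%N by rewrite expnS expn1 -hT.
have := @expect_wsub_quad _ _ _ _ _ _ _ _ tau z hdelta hlisting th phi _
  (sum_sqr_active L hsd tau) n T T 0 i (fun P => err z P f ^+ 2) n_gt0 hN (esym (add0n T)) _ hL.
rewrite -hT => /(_ hi) h; apply: le_trans (h _) _ => {h}.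
  move=> A hA; rewrite /quad expr0 invr1 subrr !mulr0 !mul0r !addr0.
  rewrite le_eqVlt; apply/orP; left; apply/eqP; congr (_ ^+ 2).
  under eq_bigr do rewrite hF.
  have A0 : #|A|%:R != 0 :> R by rewrite pnatr_eq0 hA muln1 -lt0n.
  rewrite /err [X in _ = X / _](eq_bigr (fun a => (f (tnth z a) - integ f))); last first.
    by move=> a _; rewrite hfg.
  rewrite sumrB sumr_const -[integ f *+ _]mulr_natr mulrBl mulfK //.
  by rewrite mulrC.
rewrite /quad cardsT card_ord natrX.
have -> : \sum_(a in [set: 'I_N]%SET) (th a + \sum_(B : active) box_weight gam (val B) *
    \1_(shifted_box tau (val B)) (tnth z a) * phi B) =
  0 + \sum_a (g (tnth z a) + ctrig kap w (tnth z a)).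
  by rewrite add0r; apply: eq_big => [a|a _]; [rewrite inE | exact: hF].
rewrite -nT; set S := 0 + _.
have hth : \sum_(a in [set: 'I_N]%SET) th a ^+ 2 <=
   2 * \sum_a g (tnth z a) ^+ 2 + 2 * \sum_a remainder L kap w tau (tnth z a) ^+ 2.
  rewrite !mulr_sumr -big_split /= (eq_bigl predT); last by move=> a; rewrite inE.
  apply: ler_sum => a _; rewrite /th sqrrD.
  have := sqr_ge0 (g (tnth z a) - remainder L kap w tau (tnth z a)); rewrite sqrrB; lra.
set S1 := \sum_a g _ ^+ 2 in hth *; set S2 := \sum_a remainder _ _ _ _ _ ^+ 2 in hth *.
have ni : 0 < n%:R^-1 :> R by rewrite invr_gt0.
have ni1 : n%:R^-1 <= 1 :> R by rewrite invf_le1 // ler1n.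
have hS0 : 0 <= \sum_(a in [set: 'I_N]%SET) th a ^+ 2 by apply: sumr_ge0 => a _; exact: sqr_ge0.
set St := \sum_(a in _) _ in hth hS0 *.
have e1 : (S / n%:R ^+ 2) ^+ 2 = (n%:R ^+ 4)^-1 * S ^+ 2 by field; rewrite gt_eqF.
rewrite e1 -!addrA lerD2l.
have e2 : 8 * (1 - n%:R^-1) / (n%:R ^+ 2 * n%:R) * St <= 16 / n%:R ^+ 3 * S1 + 16 / n%:R ^+ 3 * S2.
  apply: (@le_trans _ _ (8 * n%:R ^- 3 * St)).
    apply: ler_wpM2r => //.
    have -> : 8 * (1 - n%:R^-1) / (n%:R ^+ 2 * n%:R) = 8 * n%:R ^- 3 * (1 - n%:R^-1) :> R.
      by field; rewrite gt_eqF.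
    rewrite -[leRHS]mulr1; apply: ler_wpM2l; last by lra.
    by rewrite mulr_ge0 // invr_ge0 exprn_ge0.
  have -> : 16 / n%:R ^+ 3 * S1 + 16 / n%:R ^+ 3 * S2 = 8 * n%:R ^- 3 * (2 * S1 + 2 * S2) by ring.
  by apply: ler_wpM2l hth; rewrite mulr_ge0 // invr_ge0 exprn_ge0.
have e3 : 16 * Lambda N Cdelta phi (L.+1%:R ^+ s) * (1 - n%:R^-1) / n%:R ^+ 2 <=
   16 * walk_factor / n%:R ^+ 2 * (\sum_(B : active) box_value kap w (val B) tau ^+ 2).
  have -> : 16 * walk_factor / n%:R ^+ 2 * (\sum_(B : active) box_value kap w (val B) tau ^+ 2) =
    16 * Lambda N Cdelta phi (L.+1%:R ^+ s) / n%:R ^+ 2.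
    by rewrite /Lambda -/walk_factor; ring.
  apply: ler_wpM2r; first by rewrite invr_ge0 exprn_ge0.
  rewrite -[leRHS]mulr1; apply: ler_wpM2l; first by rewrite mulr_ge0.
  by lra.
by rewrite addrA; apply: lerD.
Qed.

(** The root term is the plain Monte Carlo error of n^2 independent samples of a mean-zero function:
    variances add, and the prefactor n^-4 leaves order n^-2. *)
Lemma mean_sqr_sample_sum :
  (\int[P \x tuple_prob P N]_p
     ((0 + \sum_a (g (tnth p.2 a) + ctrig kap w (tnth p.2 a))) ^+ 2)%:E <=
   (n%:R ^+ 2 * (2 * E (fun x => g x ^+ 2) + 2 * so_sum kap w))%:E)%E.
Proof.
pose ft x := g x + ctrig kap w x.
have hc := square_integrable_ctrig (d := d) kap w.
have hft : square_integrable P ft by exact: square_integrableD.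
have mft := hft.1.
rewrite (integral_prod_snd _ _ (F := fun z => ((0 + \sum_a ft (tnth z a)) ^+ 2)%:E)); first last.
- by move=> z; rewrite lee_fin sqr_ge0.
- apply/measurable_EFinP/measurable_funX/measurable_funD => //.
  apply: measurable_sum => a.
  exact: (measurableT_comp mft (measurable_tnth a)).
have h0 : E ft = 0.
  rewrite meanD ?g_mean ?add0r; [|exact: square_integrable_integrable..].
  rewrite mean_sum; last first.
    move=> j; apply: square_integrable_integrable; apply: square_integrableD; apply: square_integrableZ.
      exact: square_integrable_Cf.
    exact: square_integrable_Sf.
  rewrite big1 // => j _.
  have h1 := square_integrable_Cf R (kap j).
  have h2 := square_integrable_Sf R (kap j).
  rewrite (meanD (square_integrable_integrable (square_integrableZ _ h1))
    (square_integrable_integrable (square_integrableZ _ h2))).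
  rewrite (meanZ _ (square_integrable_integrable h1)) (meanZ _ (square_integrable_integrable h2)).
  by rewrite mean_Cf mean_Sf (negPf (kap_neq0 j)) !mulr0 addr0.
rewrite (integral_sqr_iid N 0 mft (mean_sqrE hft) h0) expr0n add0r lee_fin natrX.
apply: ler_wpM2l; first exact: exprn_ge0.
apply: le_trans (mean_sqrD_le hg hc) _; rewrite lerD2l ler_pM2l //.
apply: le_trans (mean_sqr_ctrig kap_inj w) _; apply: ler_sum => j _.
rewrite -[leLHS]mulr1; apply: ler_wpM2l; first exact: nsq_ge0.
by apply: le_trans (supp_prod_ge1 R (kap j)) _; exact: supp_prod_le.
Qed.

Lemma mean_sample_g :
  (\int[P \x tuple_prob P N]_p (\sum_a g (tnth p.2 a) ^+ 2)%:E =
   (n%:R ^+ 2 * E (fun x => g x ^+ 2))%:E)%E.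
Proof.
have mg := hg.1.
have mgt (a : 'I_N) : measurable_fun setT (fun z : N.-tuple (vec R d) => (g (tnth z a) ^+ 2)%:E).
  apply/measurable_EFinP/measurable_funX.
  exact: (measurableT_comp mg (measurable_tnth a)).
under eq_integral do rewrite -sumEFin.
rewrite (integral_prod_snd _ _ (F := fun z => (\sum_a (g (tnth z a) ^+ 2)%:E)%E)); first last.
- by move=> z; apply: sume_ge0 => a _; rewrite lee_fin sqr_ge0.
- exact: emeasurable_sum.
rewrite ge0_integral_sum //; last by move=> a z _; rewrite lee_fin sqr_ge0.
have mg2 : measurable_fun setT (fun x => (g x ^+ 2)%:E).
  exact/measurable_EFinP/measurable_funX.
have g20 x : (0 <= (g x ^+ 2)%:E)%E by rewrite lee_fin sqr_ge0.
under eq_bigr do rewrite (integral_tnth P _ mg2 g20).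
by rewrite (mean_sqrE hg) sumEFin sumr_const card_ord -[X in X%:E]mulr_natl natrX.
Qed.

Lemma mean_sample_remainder :
  (\int[P \x tuple_prob P N]_p (\sum_a remainder L kap w p.1 (tnth p.2 a) ^+ 2)%:E <=
   (n%:R ^+ 2 * (16 * s%:R / 2 ^+ L * so_sum kap w))%:E)%E.
Proof.
have mr (a : 'I_N) : measurable_fun setT
    (fun p : vec R d * N.-tuple (vec R d) => (remainder L kap w p.1 (tnth p.2 a) ^+ 2)%:E).
  apply/measurable_EFinP/measurable_funX; apply: measurable_remainder => //.
  exact: (measurableT_comp (measurable_tnth a) measurable_snd).
under eq_integral do rewrite -sumEFin.
rewrite ge0_integral_sum //; last by move=> a z _; rewrite lee_fin sqr_ge0.
apply: (@le_trans _ _ (\sum_(a < N) (16 * s%:R / 2 ^+ L * so_sum kap w)%:E)%E); last first.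
  by rewrite sumEFin sumr_const card_ord -[X in X%:E]mulr_natl natrX.
apply: lee_sum => a _; rewrite (fubini_tonelli1 _ (mr a)) //; last first.
  by move=> x; rewrite lee_fin sqr_ge0.
have := mean_remainder L w hsd kap_inj kap_neq0 kap_first; apply: le_trans.
rewrite le_eqVlt; apply/orP; left; apply/eqP; apply: eq_integral => tau _.
have mr2 : measurable_fun setT (fun x => (remainder L kap w tau x ^+ 2)%:E).
  by apply/measurable_EFinP/measurable_funX; exact: measurable_remainder.
have r20 x : (0 <= (remainder L kap w tau x ^+ 2)%:E)%E by rewrite lee_fin sqr_ge0.
by rewrite /fubini_F /= (integral_tnth P a mr2 r20).
Qed.

Lemma mean_sample_boxes :
  (\int[P \x tuple_prob P N]_p (\sum_(B : active) box_value kap w (val B) p.1 ^+ 2)%:E <=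
   (121 ^+ s * so_sum kap w)%:E)%E.
Proof.
rewrite (integral_prod_fst _ _ (F := fun tau => (\sum_(B : active) box_value kap w (val B) tau ^+ 2)%:E)).
- exact: mean_box_values.
- apply/measurable_EFinP; apply: measurable_sum => B; apply: measurable_funX.
  exact: (square_integrable_ctrig _ _).1.
- by move=> tau; rewrite lee_fin; apply: sumr_ge0 => B _; exact: sqr_ge0.
Qed.

Lemma mean_sq_err_le :
  (mean_sq_err L gam delta listing T i f <=
   (18 / n%:R * E (fun x => g x ^+ 2) +
    (2 + 256 * s%:R * (n%:R / 2 ^+ L) + 16 * walk_factor * 121 ^+ s) / n%:R ^+ 2 *
      so_sum kap w)%:E)%E.
Proof.
have n0 : 0 < n%:R :> R by rewrite ltr0n.
pose F1 (p : vec R d * N.-tuple (vec R d)) : R :=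
  (0 + \sum_a (g (tnth p.2 a) + ctrig kap w (tnth p.2 a))) ^+ 2.
pose F2 (p : vec R d * N.-tuple (vec R d)) : R := \sum_a g (tnth p.2 a) ^+ 2.
pose F3 (p : vec R d * N.-tuple (vec R d)) : R := \sum_a remainder L kap w p.1 (tnth p.2 a) ^+ 2.
pose F4 (p : vec R d * N.-tuple (vec R d)) : R := \sum_(B : active) box_value kap w (val B) p.1 ^+ 2.
have p1 p : 0 <= F1 p by exact: sqr_ge0.
have p2 p : 0 <= F2 p by apply: sumr_ge0 => a _; exact: sqr_ge0.
have p3 p : 0 <= F3 p by apply: sumr_ge0 => a _; exact: sqr_ge0.
have p4 p : 0 <= F4 p by apply: sumr_ge0 => a _; exact: sqr_ge0.
have mt (a : 'I_N) : measurable_fun setT (fun p : vec R d * N.-tuple (vec R d) => tnth p.2 a).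
  exact: (measurableT_comp (measurable_tnth a) measurable_snd).
have mg := hg.1.
have mc (c : I -> R[i]) : measurable_fun setT (ctrig kap c) by case: (square_integrable_ctrig kap c).
have m1 : measurable_fun setT F1.
  apply/measurable_funX/measurable_funD => //; apply: measurable_sum => a.
  have mw := mc w; move: (ctrig kap w) mw => h mh.
  by apply: measurable_funD; [exact: (measurableT_comp mg (mt a)) | exact: (measurableT_comp mh (mt a))].
have m2 : measurable_fun setT F2.
  by apply: measurable_sum => a; apply: measurable_funX; exact: (measurableT_comp mg (mt a)).
have m3 : measurable_fun setT F3.
  by apply: measurable_sum => a; apply: measurable_funX; exact: measurable_remainder.
have m4 : measurable_fun setT F4.
  apply: measurable_sum => B; apply: measurable_funX.
  exact: (measurableT_comp (mc _) measurable_fst).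
pose c1 : R := (n%:R ^+ 4)^-1; pose c2 : R := 16 / n%:R ^+ 3.
pose c4 : R := 16 * walk_factor / n%:R ^+ 2.
have c10 : 0 <= c1 by rewrite invr_ge0 exprn_ge0.
have c20 : 0 <= c2 by rewrite divr_ge0 // exprn_ge0.
have c40 : 0 <= c4 by rewrite divr_ge0 ?exprn_ge0 // mulr_ge0 // walk_factor_ge0.
pose G p := ((c1%:E * (F1 p)%:E + c2%:E * (F2 p)%:E) + (c2%:E * (F3 p)%:E + c4%:E * (F4 p)%:E))%E.
apply: (@le_trans _ _ (\int[P \x tuple_prob P N]_p G p)%E).
  (* The error integrand is dominated directly through its lower integral, so only the four explicit
     functions have to be measurable. *)
  apply: le_lower_integral => p.
    move=> [_ hz]; rewrite lee_fin; apply/andP; split.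
      rewrite -[leLHS](mul0r (expect (wsubgtrans L gam delta listing p.1 p.2 T) (fun=> 1))) -expectZ.
      apply: le_expect => [|As]; last by rewrite mul0r sqr_ge0.
      exact: (@nneg_wsub R d L N gam delta Cdelta listing p.1 p.2 hdelta hlisting T).
    rewrite /G -!EFinM -!EFinD lee_fin addrA.
    exact: expected_err_le.
  by rewrite /G !adde_ge0 // mule_ge0 // lee_fin.
have mZ (c : R) (F : vec R d * N.-tuple (vec R d) -> R) : measurable_fun setT F ->
    measurable_fun setT (fun p => c%:E * (F p)%:E)%E.
  move=> mF; under eq_fun do rewrite -EFinM.
  by apply/measurable_EFinP; exact: measurable_funM.
have pZ (c : R) (F : vec R d * N.-tuple (vec R d) -> R) : 0 <= c -> (forall p, 0 <= F p) ->
    forall p, setT p -> (0 <= c%:E * (F p)%:E)%E.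
  by move=> h1 h2 p _; rewrite -EFinM lee_fin mulr_ge0.
rewrite ge0_integralD //; first last.
- by apply: emeasurable_funD; exact: mZ.
- by move=> p _; rewrite adde_ge0 // pZ.
- by apply: emeasurable_funD; exact: mZ.
- by move=> p _; rewrite adde_ge0 // pZ.
rewrite !ge0_integralD //; try exact: mZ; try exact: pZ.
rewrite !ge0_integralZl_EFin //; try exact/measurable_EFinP; try by move=> p _; rewrite lee_fin.
apply: (@le_trans _ _ (c1%:E * (n%:R ^+ 2 * (2 * E (fun x => g x ^+ 2) + 2 * so_sum kap w))%:E +
  c2%:E * (n%:R ^+ 2 * E (fun x => g x ^+ 2))%:E +
  (c2%:E * (n%:R ^+ 2 * (16 * s%:R / 2 ^+ L * so_sum kap w))%:E +
   c4%:E * (121 ^+ s * so_sum kap w)%:E))%E).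
  apply: leeD; apply: leeD; apply: lee_wpmul2l; rewrite ?lee_fin //.
  - exact: mean_sqr_sample_sum.
  - by rewrite mean_sample_g.
  - exact: mean_sample_remainder.
  - exact: mean_sample_boxes.
rewrite -!EFinM -!EFinD lee_fin.
set G2 := E (fun x => g x ^+ 2); set SO := so_sum kap w.
have G20 : 0 <= G2 by exact: mean_sqr_ge0.
rewrite -subr_ge0.
have p0 : 2 ^+ L != 0 :> R by rewrite expf_neq0.
(* 18 is 16 from the energy of g along the tree plus 2 from the root, whose 2/n^2 is relaxed to 2/n;
   256 is 16 from the tree times 16 from [mean_remainder]. *)
have -> : 18 / n%:R * G2 + (2 + 256 * s%:R * (n%:R / 2 ^+ L) + 16 * walk_factor * 121 ^+ s) / n%:R ^+ 2 * SO -
  (c1 * (n%:R ^+ 2 * (2 * G2 + 2 * SO)) + c2 * (n%:R ^+ 2 * G2) +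
    (c2 * (n%:R ^+ 2 * (16 * s%:R / 2 ^+ L * SO)) + c4 * (121 ^+ s * SO))) =
  2 * G2 / n%:R * (1 - n%:R^-1).
  rewrite /c1 /c2 /c4; set X := 2 ^+ L in p0 *; set Y := 121 ^+ s.
  by field; rewrite p0 gt_eqF.
have ni1 : n%:R^-1 <= 1 :> R by rewrite invf_le1 // ler1n.
by apply: mulr_ge0; [rewrite divr_ge0 ?mulr_ge0 // ltW | lra].
Qed.

End ErrorBound.

(** * Reduction to trigonometric polynomials *)

Definition log_dn (R : realType) (d n : nat) : R := ln (d * n)%:R.

(** * Choice of the level and explicit constants *)

Section Constants.
Context (R : realType) (C Cdelta : R) (d s n : nat).
Hypothesis C2 : 2 <= C.
Hypothesis d1 : (1 <= d)%N.
Hypothesis n2 : (2 <= n)%N.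
Local Notation L := (level C d n).
Local Notation X := (log_dn R d n).

Lemma ln2_ge : 1 / 2 <= ln 2 :> R.
Proof.
have h : ln (1 + (- (1 / 2))) <= - (1 / 2) :> R by apply: le_ln1Dx; lra.
have e : 1 + - (1 / 2) = 2^-1 :> R by field.
by rewrite e lnV ?posrE // in h; lra.
Qed.

Lemma ln2_le1 : ln 2 <= 1 :> R.
Proof.
have h : ln (1 + 1) <= 1 :> R by apply: le_ln1Dx; lra.
by have e : 1 + 1 = 2 :> R by [] ; rewrite e in h.
Qed.

Lemma ln_n_ge : 1 / 2 <= ln n%:R :> R.
Proof.
apply: le_trans ln2_ge _; rewrite ler_ln ?posrE ?ltr0n ?ler_nat //.
exact: ltnW.
Qed.

Lemma ln_n_le : ln n%:R <= X.
Proof.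
have n0 : (0 < n)%N by exact: ltnW.
by rewrite /log_dn ler_ln ?posrE ?ltr0n ?muln_gt0 ?ler_nat ?d1 // leq_pmull.
Qed.

Lemma lnX_ge : 1 / 2 <= X.
Proof. exact: le_trans ln_n_ge ln_n_le. Qed.

Lemma level_itv : C * X <= L%:R <= C * X + 1.
Proof.
have hX := lnX_ge.
have hCX : 0 <= C * X by apply: mulr_ge0; [apply: le_trans C2 | apply: le_trans hX]; rewrite ?divr_ge0.
have h0 : 0 <= Num.ceil (C * X).
  by rewrite -(ler_int R); apply: le_trans hCX _; exact: ceil_ge.
have e : L%:R = (Num.ceil (C * X))%:~R :> R by rewrite /level pmulrn -/(log_dn R d n) gez0_abs.
have := ceil_itv (C * X); rewrite e rmorphB /= => /andP[h1 h2].
by apply/andP; split; lra.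
Qed.

(** L >= C ln(dn) >= 2 ln n, while ln 2 >= 1/2. The threshold 2 for C comes from here; it keeps the
    remainder at order n^-2. *)
Lemma level_large : n%:R <= 2 ^+ L :> R.
Proof.
have n0 : 0 < n%:R :> R by rewrite ltr0n ltnW.
rewrite -ler_ln ?posrE ?exprn_gt0 // lnXn // -(mulr_natr (ln 2)).
have /andP[h1 _] := level_itv; have h2 := ln_n_le; have h3 := ln2_ge; have h4 := lnX_ge.
set x := X in h1 h2 h4; set l := L%:R in h1 *; set a := ln 2 in h3 *.
set y := ln n%:R in h2 *; move: C2 x l a y h1 h2 h3 h4; clear => hC x l a y hl hy ha hx.
have k1 : 0 <= (C - 2) * x by apply: mulr_ge0; lra.
have l0 : 0 <= l by lra.
have k2 : 0 <= (a - 1 / 2) * l by apply: mulr_ge0 l0; rewrite subr_ge0.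
by lra.
Qed.

Lemma level_succ_le : L.+1%:R <= (C + 4) * X.
Proof.
have /andP[_ h1] := level_itv; have h4 := lnX_ge; rewrite -natr1.
have -> : (C + 4) * X = C * X + 4 * X by ring.
by lra.
Qed.

(** The factor 5 + (C+4) s bounds ln(2 * 2^((L+1)s) * n^4) in units of ln(dn), and 2 (C+4)^s does
    the same for 1 + (L+1)^s in units of its s-th power. *)
Definition walk_const : R :=
  30 * (1 + `|Cdelta|) * (5 + (C + 4) * s%:R) * (2 * (C + 4) ^+ s).

Lemma add_le_double_mul (a p q : R) : 1 <= p -> 1 <= q -> a <= p -> q + a <= 2 * p * q.
Proof.
move=> p1 q1 ap; have h1 : 0 <= (p - 1) * q by rewrite mulr_ge0 //; lra.
have h2 : 0 <= (q - 1) * p by rewrite mulr_ge0 //; lra.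
by lra.
Qed.

Lemma sum_bound (a b c x y : R) :
  a <= x -> b <= y -> c <= x -> a + b + (c + (c + (c + c))) <= x + x * 4 + y.
Proof. by lra. Qed.

Lemma walk_factor_le (hsd : (s <= d)%N) :
  walk_factor d L s n Cdelta <= walk_const * X ^+ s.+1.
Proof.
have hX := lnX_ge; have hL := level_succ_le; have h2 := ln2_le1; have hn := ln_n_le.
have hl2 := ln2_ge.
have n0 : (0 < n)%N by exact: ltnW.
have hN : 1 <= n%:R :> R by rewrite ler1n.
set a := #|{: active_box L (@first_weights R d s)}|.
have ha : a%:R <= 2 ^+ (L.+1 * s) :> R by exact: card_active.
have hln : ln ((n ^ 2 + a) * n ^ 2)%:R <= (5 + (C + 4) * s%:R) * X.
  apply: (@le_trans _ _ (ln (2 * 2 ^+ (L.+1 * s) * n%:R ^+ 4))).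
    rewrite ler_ln ?posrE; last 2 first.
    - by rewrite ltr0n muln_gt0 addn_gt0 expn_gt0 n0.
    - by rewrite !mulr_gt0 ?exprn_gt0 // ltr0n.
    rewrite natrM natrD natrX.
    have hp : 1 <= 2 ^+ (L.+1 * s) :> R by rewrite exprn_ege1 // ler1n.
    have hn2 : 1 <= n%:R ^+ 2 :> R by rewrite exprn_ege1.
    have -> : n%:R ^+ 4 = n%:R ^+ 2 * n%:R ^+ 2 :> R by rewrite -exprD.
    rewrite mulrA.
    apply: ler_wpM2r; first exact: exprn_ge0.
    exact: add_le_double_mul.
  rewrite !lnM ?posrE ?mulr_gt0 ?exprn_gt0 ?ltr0n // !lnXn ?ltr0n //.
  rewrite -(mulr_natr (ln 2)) natrM.
  have -> : (5 + (C + 4) * s%:R) * X = X + X * 4 + ((C + 4) * X) * s%:R by ring.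
  have h5 : ln 2 * (L.+1%:R * s%:R) <= (C + 4) * X * s%:R.
    rewrite mulrA; apply: ler_wpM2r; first exact: ler0n.
    apply: le_trans hL; rewrite -[leRHS]mul1r; apply: ler_wpM2r => //; exact: ler0n.
  have : ln 2 <= X.
    by rewrite /log_dn ler_ln ?posrE ?ltr0n ?muln_gt0 ?d1 ?n0 // ler_nat (leq_trans n2) // leq_pmull.
  by move=> h6; exact: sum_bound.
have hQ : 1 + L.+1%:R ^+ s <= 2 * ((C + 4) * X) ^+ s.
  have h1 : 1 <= L.+1%:R ^+ s :> R by rewrite exprn_ege1 // ler1n.
  have h3 : L.+1%:R ^+ s <= ((C + 4) * X) ^+ s.
    by apply: lerXn2r; rewrite ?nnegrE ?ler0n //; apply: le_trans hL; exact: ler0n.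
  by rewrite mulr2n mulrDl mul1r; apply: lerD => //; exact: le_trans h3.
have hCd : 0 <= 1 + `|Cdelta| by rewrite addr_ge0.
rewrite /walk_factor -/a /walk_const.
have -> : 30 * (1 + `|Cdelta|) * (5 + (C + 4) * s%:R) * (2 * (C + 4) ^+ s) * X ^+ s.+1 =
  30 * ((1 + `|Cdelta|) * ((5 + (C + 4) * s%:R) * X)) * (2 * ((C + 4) * X) ^+ s).
  by rewrite exprMn exprS; ring.
apply: ler_pM => //.
- by rewrite !mulr_ge0 // ln_ge0 // ler1n muln_gt0 addn_gt0 expn_gt0 n0.
- by rewrite ler_pM2l //; apply: ler_wpM2l.
Qed.

(** 72 serves the g-term, 36 sigma(g)^2/n combined with ln n >= 1/2. As ln(dn) may be below 1, the
    factor 2^(s+1) lets (2 ln(dn))^(s+1) >= 1 absorb the terms without logarithms. *)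
Definition final_const : R :=
  72 + (2 + 256 * s%:R) * 2 ^+ s.+1 + 16 * walk_const * 121 ^+ s.

Let C4_ge0 : 0 <= C + 4.
Proof. by move: C2; lra. Qed.

Lemma walk_const_ge0 : 0 <= walk_const.
Proof.
apply: mulr_ge0; last by apply: mulr_ge0 => //; exact: exprn_ge0.
apply: mulr_ge0; first by apply: mulr_ge0 => //; exact: addr_ge0.
by apply: addr_ge0 => //; apply: mulr_ge0.
Qed.

Lemma final_const_ge : 72 <= final_const.
Proof.
have t0 : 0 <= 121 ^+ s :> R by exact: exprn_ge0 (ler0n _ 121).
have p0 : 0 <= 2 ^+ s.+1 :> R by exact: exprn_ge0.
have a0 : 0 <= s%:R :> R by exact: ler0n.
have w0 := walk_const_ge0; rewrite /final_const.
move: (121 ^+ s) t0 (2 ^+ s.+1) p0 (s%:R) a0 walk_const w0 => t t0 p p0 a a0 w w0.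
have h1 : 0 <= (2 + 256 * a) * p by apply: mulr_ge0 p0; lra.
have h2 : 0 <= 16 * w * t by apply: mulr_ge0 t0; lra.
by lra.
Qed.

Lemma combine_coefficients (a r W t wc x p : R) :
  0 <= a -> r <= 1 -> 0 <= t -> W <= wc * x -> 1 <= p * x -> 0 <= x ->
  2 + a * r + 16 * W * t <= (72 + (2 + a) * p + 16 * wc * t) * x.
Proof.
move=> a0 r1 t0 hW hp x0.
have h1 : 0 <= a * (1 - r) by rewrite mulr_ge0 // subr_ge0.
have h2 : 0 <= (wc * x - W) * t by rewrite mulr_ge0 // subr_ge0.
have h3 : 0 <= (2 + a) * (p * x - 1) by rewrite mulr_ge0 ?subr_ge0 // addr_ge0.
by lra.
Qed.

Lemma coefficient_le (hsd : (s <= d)%N) :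
  2 + 256 * s%:R * (n%:R / 2 ^+ L) + 16 * walk_factor d L s n Cdelta * 121 ^+ s <=
  final_const * X ^+ s.+1.
Proof.
have X0 : 0 <= X by apply: le_trans lnX_ge; rewrite divr_ge0.
apply: combine_coefficients.
- by apply: mulr_ge0; exact: ler0n.
- by rewrite ler_pdivrMr ?exprn_gt0 // mul1r level_large.
- exact: exprn_ge0 (ler0n _ 121).
- exact: walk_factor_le.
- rewrite -exprMn exprn_ege1 //; have := lnX_ge.
  by move: (log_dn R d n) => y hy; lra.
- exact: exprn_ge0.
Qed.

End Constants.

(** * Periodic extension of functions given on the cube *)

Section Periodic.
Context (R : realType) (d : nat).
Local Notation P := (unif R d).
Local Notation E u := (\int[unif R d]_x u x).
Implicit Types (u v : vec R d -> R) (x : vec R d) (k : freq d).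

Definition zero_vec : vec R d := [tuple 0 | _ < d].

(** Functions are controlled only on the cube. Composing with this map gives a periodic function on
    the whole space with the same integrals, to which rotation invariance applies. *)
Definition mod1 x : vec R d := tshift zero_vec x.

Lemma tnth_mod1 x j : tnth (mod1 x) j = fract (tnth x j : R).
Proof. by rewrite tnth_shift tnth_mktuple addr0. Qed.

Lemma cube_mod1 x : cube (mod1 x).
Proof.
move=> j; rewrite tnth_mod1; have /andP[h0 h1] := frac_itv (tnth x j : R).
by split=> //; exact: ltW.
Qed.

Lemma measurable_cube : measurable (@cube R d).
Proof.
rewrite (_ : @cube R d = \bigcap_(j in [set: 'I_d])
   ((fun x => tnth x j) @^-1` `[0, 1]%classic)); last first.
  apply/seteqP; split=> x hx j; first by move=> _; rewrite /= in_itv /=; apply/andP; exact: hx.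
  by have := hx j I; rewrite /= in_itv /= => /andP.
apply: fin_bigcap_measurable => // j _; rewrite -[X in measurable X]setTI.
exact: (measurable_tnth j).
Qed.

Lemma freq_dot_zero k : freq_dot k zero_vec = 0.
Proof. by rewrite /freq_dot big1 // => j _; rewrite tnth_mktuple mulr0. Qed.

Lemma Cf_mod1 k x : Cf k (mod1 x) = Cf k x.
Proof. by rewrite Cf_shift freq_dot_zero addr0. Qed.

Lemma Sf_mod1 k x : Sf k (mod1 x) = Sf k x.
Proof. by rewrite Sf_shift freq_dot_zero addr0. Qed.

Lemma restrict_mod1 (T : pointedType) (F : vec R d -> T) x :
  (F \_ (@cube R d)) (mod1 x) = F (mod1 x).
Proof. by rewrite patchE mem_set //; exact: cube_mod1. Qed.

Lemma measurable_mod1 u : measurable_fun (@cube R d) u -> measurable_fun setT (u \o mod1).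
Proof.
move=> /(measurable_restrictT _ measurable_cube) mu.
rewrite (_ : u \o mod1 = (u \_ (@cube R d)) \o mod1).
  exact: (measurableT_comp mu (measurable_shift _)).
by apply/funext => x /=; rewrite restrict_mod1.
Qed.

Lemma integ_mod1 u : measurable_fun (@cube R d) u -> integ u = E (u \o mod1).
Proof.
move=> mu; rewrite /integ Rintegral_mkcond -(mean_shift zero_vec).
  by apply: eq_Rintegral => x _; exact: restrict_mod1.
exact/(measurable_restrictT _ measurable_cube).
Qed.

Lemma integral_cube_mod1 u : measurable_fun (@cube R d) u ->
  (\int[P]_(x in @cube R d) (u x ^+ 2)%:E = \int[P]_x (u (mod1 x) ^+ 2)%:E)%E.
Proof.
move=> mu; have mE : measurable_fun (@cube R d) (fun x => (u x ^+ 2)%:E).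
  exact/measurable_EFinP/measurable_funX.
rewrite integral_mkcond.
rewrite -(@integral_shift _ _ zero_vec ((fun x => (u x ^+ 2)%:E) \_ (@cube R d))).
- by apply: eq_integral => x _; rewrite restrict_mod1.
- exact/(measurable_restrictT _ measurable_cube).
- by move=> x; rewrite patchE; case: ifP => // _; rewrite lee_fin sqr_ge0.
Qed.

Lemma L2_mod1 u : L2 u -> square_integrable P (u \o mod1).
Proof.
by move=> [mu hu]; split; [exact: measurable_mod1 | rewrite -integral_cube_mod1].
Qed.

Definition cos_coef u k : R := E (fun x => u (mod1 x) * Cf k x).
Definition sin_coef u k : R := E (fun x => u (mod1 x) * Sf k x).

Lemma fourier_coefE u k : measurable_fun (@cube R d) u ->
  square_integrable P (u \o mod1) ->
  fourier_coef u k = (cos_coef u k +i* - sin_coef u k)%C.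
Proof.
move=> mu hu; rewrite /fourier_coef /cinteg.
have mC : measurable_fun (@cube R d) (fun x => u x * Cf k x).
  by apply: measurable_funM => //; apply: measurable_funTS; exact: measurable_Cf.
have mS : measurable_fun (@cube R d) (fun x => -1 * (u x * Sf k x)).
  apply: measurable_funM => //; apply: measurable_funM => //.
  by apply: measurable_funTS; exact: measurable_Sf.
have -> : (fun x => complex.Re ((u x)%:C%C * character (- k) x)) = (fun x => u x * Cf k x).
  by apply/funext => x; rewrite /Cf /= freq_dotN mulrN cosN; ring.
have -> : (fun x => complex.Im ((u x)%:C%C * character (- k) x)) = (fun x => -1 * (u x * Sf k x)).
  by apply/funext => x; rewrite /Sf /= freq_dotN mulrN sinN; ring.
rewrite (integ_mod1 mC) (integ_mod1 mS); congr (_ +i* _)%C.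
  by apply: eq_Rintegral => x _ /=; rewrite Cf_mod1.
rewrite /sin_coef -[RHS]mulN1r -[RHS]meanZ; last exact: (integrable_mul hu (square_integrable_Sf R k)).
by apply: eq_Rintegral => x _ /=; rewrite Sf_mod1.
Qed.

End Periodic.

Section Coefficients.
Context (R : realType) (d : nat).
Local Notation P := (unif R d).
Local Notation E u := (\int[unif R d]_x u x).
Implicit Types (u v g h : vec R d -> R) (x : vec R d) (k : freq d).

Lemma freq_box_inj K : injective (@freq_box d K).
Proof.
move=> e e' /ffunP h; apply/ffunP => j; apply/val_inj; have := h j.
by rewrite !ffunE => /addIr [].
Qed.

Lemma square_integrable_mod1 u : measurable_fun setT u ->
  square_integrable P (u \o @mod1 R d) -> square_integrable P u.
Proof.
move=> mu [_ h]; split=> //; rewrite -(integral_shift (zero_vec R d)) //.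
  exact/measurable_EFinP/measurable_funX.
by move=> x; rewrite lee_fin sqr_ge0.
Qed.

Lemma mean_mod1 u : measurable_fun setT u -> E (u \o @mod1 R d) = E u.
Proof. exact: mean_shift. Qed.

Lemma cos_coef_cst c k : k != 0 -> E (fun x => c * Cf k x) = 0.
Proof.
move=> /negPf k0; rewrite meanZ ?mean_Cf ?k0 ?mulr0 //.
exact: square_integrable_integrable (square_integrable_Cf R k).
Qed.

Lemma sin_coef_cst c k : E (fun x => c * Sf k x) = 0.
Proof.
rewrite meanZ ?mean_Sf ?mulr0 //.
exact: square_integrable_integrable (square_integrable_Sf R k).
Qed.

Lemma cos_coefD u v k : square_integrable P (u \o @mod1 R d) ->
  square_integrable P (v \o @mod1 R d) ->
  E (fun x => (u (mod1 x) + v (mod1 x)) * Cf k x) = cos_coef u k + cos_coef v k.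
Proof.
move=> hu hv; have hk := square_integrable_Cf R k.
rewrite /cos_coef -(meanD (integrable_mul hu hk) (integrable_mul hv hk)).
by apply: eq_Rintegral => x _; rewrite mulrDl.
Qed.

Lemma sin_coefD u v k : square_integrable P (u \o @mod1 R d) ->
  square_integrable P (v \o @mod1 R d) ->
  E (fun x => (u (mod1 x) + v (mod1 x)) * Sf k x) = sin_coef u k + sin_coef v k.
Proof.
move=> hu hv; have hk := square_integrable_Sf R k.
rewrite /sin_coef -(meanD (integrable_mul hu hk) (integrable_mul hv hk)).
by apply: eq_Rintegral => x _; rewrite mulrDl.
Qed.

Lemma mod1_half_period h s k (j : 'I_d) x : depends_on_first s h -> (s <= j)%N ->
  h (mod1 (tshift (half_period R k j) x)) = h (mod1 x).
Proof.
move=> hh sj; apply: hh; try exact: cube_mod1.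
move=> i si; rewrite !tnth_mod1 tnth_shift tnth_mktuple.
have /negPf -> : i != j by rewrite neq_ltn (leq_trans si sj).
by rewrite addr0 frac_id // frac_itv.
Qed.

(** Half a period in a coordinate j >= s leaves [h] unchanged and negates the character, so the
    integrand is odd under a rotation. *)
Lemma coef_vanish h s k (j : 'I_d) : square_integrable P (h \o @mod1 R d) ->
  depends_on_first s h -> (s <= j)%N -> k j != 0 ->
  cos_coef h k = 0 /\ sin_coef h k = 0.
Proof.
move=> hh hs sj kj; split; apply: (@mean_anti _ _ k j).
- apply: measurable_funM; [exact: hh.1 | exact: measurable_Cf].
- exact: (integrable_mul hh (square_integrable_Cf R k)).
- by move=> x; rewrite (mod1_half_period k x hs sj) Cf_half_period // mulrN.
- apply: measurable_funM; [exact: hh.1 | exact: measurable_Sf].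
- exact: (integrable_mul hh (square_integrable_Sf R k)).
- by move=> x; rewrite (mod1_half_period k x hs sj) Sf_half_period // mulrN.
Qed.

(** Bessel's inequality for [g] minus its mean: subtracting a constant changes only the coefficient
    at frequency zero. *)
Lemma bessel_variance (I : finType) (kap : I -> freq d) g : injective kap ->
  L2 g ->
  \sum_(i | kap i != 0) (cos_coef g (kap i) ^+ 2 + sin_coef g (kap i) ^+ 2) <= sigma2 g.
Proof.
move=> kap_inj hg; have G2 := L2_mod1 hg; have iG := square_integrable_integrable G2.
pose m := E (g \o @mod1 R d).
have hm : m = integ g by rewrite /m -integ_mod1 //; exact: hg.1.
have U2 : square_integrable P (fun x => g (mod1 x) - m).
  by apply: (square_integrableB G2); exact: square_integrable_cst.
have -> : sigma2 g = E (fun x => (g (mod1 x) - m) ^+ 2).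
  by rewrite (variance_le G2) -/m hm /sigma2 (integ_mod1 (measurable_funX 2 hg.1)).
apply: le_trans (bessel kap_inj U2).
rewrite big_mkcond; apply: ler_sum => i _; case: ifPn => [k0|_]; last first.
  by rewrite addr_ge0 ?sqr_ge0.
have hC := square_integrable_Cf R (kap i); have hS := square_integrable_Sf R (kap i).
have -> : E (fun x => (g (mod1 x) - m) * Cf (kap i) x) = cos_coef g (kap i).
  rewrite -[RHS]addr0 -(cos_coef_cst (- m) k0) -meanD; last 2 first.
  - exact: (integrable_mul G2 hC).
  - exact: integrable_scaleR (square_integrable_integrable hC).
  by apply: eq_Rintegral => x _; rewrite mulrDl.
have -> // : E (fun x => (g (mod1 x) - m) * Sf (kap i) x) = sin_coef g (kap i).
rewrite -[RHS]addr0 -(sin_coef_cst (- m) (kap i)) -meanD; last 2 first.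
- exact: (integrable_mul G2 hS).
- exact: integrable_scaleR (square_integrable_integrable hS).
by apply: eq_Rintegral => x _; rewrite mulrDl.
Qed.

Lemma cos_coef0 u : L2 u -> cos_coef u 0 = integ u.
Proof.
move=> hu; rewrite (integ_mod1 hu.1); apply: eq_Rintegral => x _ /=.
by rewrite /Cf freq_dot0 mulr0 cos0 mulr1.
Qed.

End Coefficients.

(** * Fourier truncation of a decomposition f = g + h *)

Section Truncation.
Context (R : realType) (d s Kb : nat) (f g h : vec R d -> R).
Local Notation P := (unif R d).
Local Notation E u := (\int[unif R d]_x u x).
Local Notation W := (@mod1 R d).
Hypothesis f2 : L2 f.
Hypothesis g2 : L2 g.
Hypothesis h_first : depends_on_first s h.
Hypothesis fgh : forall x, cube x -> f x = g x + h x.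
Local Notation K1 := {ffun 'I_d -> 'I_(Kb.*2.+1)}.
Local Notation fb := (@freq_box d Kb).

(** No regularity of [h] is assumed; measurability and, below, square integrability are inherited
    from f - g on the cube. *)
Lemma measurable_component : measurable_fun (@cube R d) h.
Proof.
apply: (@eq_measurable_fun _ _ _ _ _ (fun x => f x - g x)).
  by move=> x /set_mem cx; rewrite /= fgh // addrC addKr.
exact: measurable_funB f2.1 g2.1.
Qed.

Lemma square_integrable_component : square_integrable P (h \o W).
Proof.
rewrite (_ : h \o W = (fun x => f (mod1 x) - g (mod1 x))).
  exact: square_integrableB (L2_mod1 f2) (L2_mod1 g2).
by apply/funext => x /=; rewrite (fgh (cube_mod1 x)) addrAC subrr add0r.
Qed.

Definition partial_sum : vec R d -> R :=
  trig fb (fun e => cos_coef f (fb e)) (fun e => sin_coef f (fb e)).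

Lemma Re_fourier_sum x : complex.Re (fourier_sum f Kb x) = partial_sum x.
Proof.
rewrite /fourier_sum cplx_Re_sum; apply: eq_bigr => e _.
rewrite (fourier_coefE _ f2.1 (L2_mod1 f2)) cplx_ReM /=.
by rewrite /Cf /Sf; ring.
Qed.

Lemma truncation_error_le :
  ((E (fun x => (f (mod1 x) - partial_sum x) ^+ 2))%:E <=
   \int[P]_(x in @cube R d)
     ((ComplexField.Normc.normc ((f x)%:C%C - fourier_sum f Kb x)) ^+ 2)%:E)%E.
Proof.
have mS : measurable_fun setT partial_sum by exact: (square_integrable_trig _ _ _).1.
have wS x : partial_sum (mod1 x) = partial_sum x.
  by apply: eq_bigr => e _; rewrite Cf_mod1 Sf_mod1.
have D2 : square_integrable P (fun x => f (mod1 x) - partial_sum x).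
  by apply: (square_integrableB (L2_mod1 f2)); exact: square_integrable_trig.
rewrite -mean_sqrE //.
under eq_integral do rewrite -wS.
rewrite -(@integral_cube_mod1 _ _ (fun x => f x - partial_sum x)); last first.
  by apply: measurable_funB; [exact: f2.1 | exact: measurable_funTS].
rewrite [leRHS]integral_mkcond; apply: le_lower_integral => x; last first.
  by rewrite patchE; case: ifP => // _; rewrite lee_fin sqr_ge0.
move=> cx; rewrite patchE mem_set // !lee_fin sqr_ge0 /= -Re_fourier_sum.
case: (fourier_sum f Kb x) => a b /=.
by rewrite sqr_sqrtr ?addr_ge0 ?sqr_ge0 // lerDl sqr_ge0.
Qed.

(** By [coef_vanish], restricting to frequencies supported on the first s coordinates discards no
    nonzero coefficient of [h]. *)
Definition low_freq := {e : K1 | (fb e != 0) && [forall j : 'I_d, (s <= j)%N ==> (fb e j == 0)]}.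
Definition low_kap (i : low_freq) : freq d := fb (val i).
Definition low_coef (i : low_freq) : R[i] :=
  (cos_coef h (low_kap i) +i* - sin_coef h (low_kap i))%C.

Lemma low_kap_inj : injective low_kap.
Proof. exact: inj_comp (@freq_box_inj d Kb) val_inj. Qed.

Lemma low_kap_neq0 i : low_kap i != 0.
Proof. by have /andP[] := valP i. Qed.

Lemma low_kap_first i (j : 'I_d) : (s <= j)%N -> low_kap i j = 0.
Proof. by have /andP[_ /forallP/(_ j)/implyP h1] := valP i => /h1/eqP. Qed.

(** The part g' of the overview. Values of [f] off the cube are arbitrary, so [f] is cut to zero
    there to make this measurable on the whole space. *)
Definition rough x : R := (f \_ (@cube R d)) x - integ f - ctrig low_kap low_coef x.

Definition rough_cos e : R := if fb e == 0 then 0 else cos_coef g (fb e).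
Definition rough_sin e : R := if fb e == 0 then 0 else sin_coef g (fb e).

Lemma fourier_split x :
  partial_sum x = integ f + trig fb rough_cos rough_sin x + ctrig low_kap low_coef x.
Proof.
have h2 := square_integrable_component.
have eC k : cos_coef f k = cos_coef g k + cos_coef h k.
  rewrite -(cos_coefD k (L2_mod1 g2) h2); apply: eq_Rintegral => y _.
  by rewrite fgh //; exact: cube_mod1.
have eS k : sin_coef f k = sin_coef g k + sin_coef h k.
  rewrite -(sin_coefD k (L2_mod1 g2) h2); apply: eq_Rintegral => y _.
  by rewrite fgh //; exact: cube_mod1.
pose F e := cos_coef h (fb e) * Cf (fb e) x + sin_coef h (fb e) * Sf (fb e) x.
have -> : ctrig low_kap low_coef x = \sum_(e | (fb e != 0) &&
    [forall j : 'I_d, (s <= j)%N ==> (fb e j == 0)]) F e.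
  rewrite big_sub; apply: eq_bigr => i _; rewrite /= opprK //.
have -> : integ f = \sum_(e : K1) (if fb e == 0 then integ f else 0).
  pose e0 : K1 := [ffun=> inord Kb].
  have e00 : fb e0 = 0.
    by apply/ffunP => j; rewrite !ffunE inordK ?subrr // ltnS -addnn leq_addr.
  rewrite (bigD1 e0) //= e00 eqxx big1 ?addr0 // => e ne.
  by case: eqP => // h0; rewrite -e00 in h0; rewrite (freq_box_inj h0) eqxx in ne.
rewrite [X in _ + X]big_mkcond -!big_split /=; apply: eq_bigr => e _.
rewrite /rough_cos /rough_sin; have [->|ne] := eqVneq (fb e) 0.
  by rewrite (cos_coef0 f2) /Cf /Sf freq_dot0 mulr0 cos0 sin0 /=; ring.
rewrite /= add0r eC eS; case: ifPn => [_|]; first by rewrite /F; ring.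
rewrite negb_forall => /existsP[j]; rewrite negb_imply => /andP[sj kj].
by have [-> ->] := coef_vanish h2 h_first sj kj; rewrite !addr0.
Qed.

Lemma rough_mod1 x :
  rough (mod1 x) = (f (mod1 x) - partial_sum x) + trig fb rough_cos rough_sin x.
Proof.
rewrite fourier_split /rough restrict_mod1.
have -> : ctrig low_kap low_coef (mod1 x) = ctrig low_kap low_coef x.
  by apply: eq_bigr => i _; rewrite Cf_mod1 Sf_mod1.
by ring.
Qed.

Lemma measurable_rough : measurable_fun setT rough.
Proof.
apply: measurable_funB; last exact: (square_integrable_ctrig _ _).1.
apply: measurable_funB => //.
by apply/(measurable_restrictT _ (@measurable_cube R d)); exact: f2.1.
Qed.

Lemma square_integrable_rough : square_integrable P rough.
Proof.
apply: (square_integrable_mod1 measurable_rough).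
have -> : rough \o W = (fun x => (f (mod1 x) - partial_sum x) + trig fb rough_cos rough_sin x).
  by apply/funext => x; exact: rough_mod1.
apply: square_integrableD; last exact: square_integrable_trig.
by apply: (square_integrableB (L2_mod1 f2)); exact: square_integrable_trig.
Qed.

Lemma mean_ctrig0 : E (ctrig low_kap low_coef) = 0.
Proof.
have iC k := square_integrable_integrable (square_integrable_Cf R k).
have iS k := square_integrable_integrable (square_integrable_Sf R k).
rewrite mean_sum => [|i]; last first.
  by apply: (integrable_addR); apply: integrable_scaleR.
rewrite big1 // => i _; rewrite meanD; try exact: integrable_scaleR.
by rewrite (cos_coef_cst _ (low_kap_neq0 i)) sin_coef_cst addr0.
Qed.

Lemma mean_rough : E rough = 0.
Proof.
have F2 := L2_mod1 f2.
have c2 : square_integrable P (ctrig low_kap low_coef) by exact: square_integrable_ctrig.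
rewrite -(mean_mod1 measurable_rough).
transitivity (E (fun x => (f (mod1 x) + - integ f) + -1 * ctrig low_kap low_coef x)).
  apply: eq_Rintegral => x _ /=; rewrite /rough restrict_mod1 mulN1r; congr (_ - _).
  by apply: eq_bigr => i _; rewrite Cf_mod1 Sf_mod1.
rewrite meanD; last 2 first.
- apply: square_integrable_integrable; apply: square_integrableD => //.
  exact: square_integrable_cst.
- exact: integrable_scaleR (square_integrable_integrable c2).
rewrite (meanD (square_integrable_integrable F2)); last first.
  exact: square_integrable_integrable (square_integrable_cst _ _).
rewrite meanZ; last exact: square_integrable_integrable.
by rewrite mean_ctrig0 mulr0 addr0 mean_cst (integ_mod1 f2.1) subrr.
Qed.

Lemma mean_sqr_rough :
  E (fun x => rough x ^+ 2) <=
  2 * E (fun x => (f (mod1 x) - partial_sum x) ^+ 2) + 2 * sigma2 g.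
Proof.
rewrite -(mean_mod1 (measurable_funX 2 measurable_rough)).
have D2 : square_integrable P (fun x => f (mod1 x) - partial_sum x).
  by apply: (square_integrableB (L2_mod1 f2)); exact: square_integrable_trig.
apply: (@le_trans _ _ (E (fun x => ((f (mod1 x) - partial_sum x) + trig fb rough_cos rough_sin x) ^+ 2))).
  by rewrite le_eqVlt; apply/orP; left; apply/eqP; apply: eq_Rintegral => x _ /=; rewrite rough_mod1.
apply: (le_trans (mean_sqrD_le D2 (square_integrable_trig _ _ _))).
rewrite lerD2l ler_pM2l //.
apply: (le_trans (mean_sqr_trig (@freq_box_inj d Kb) _ _)).
apply: le_trans (bessel_variance (@freq_box_inj d Kb) g2).
rewrite [leRHS]big_mkcond; apply: ler_sum => e _; rewrite /rough_cos /rough_sin.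
by case: eqP => //= _; rewrite expr0n addr0.
Qed.

(** The left side is one of the finite partial sums whose supremum is the [esum]. *)
Lemma so_sum_le : ((so_sum low_kap low_coef)%:E <= sigmaSO2 h)%E.
Proof.
apply: esum_ge; exists [set` [seq low_kap i | i <- enum {: low_freq}]].
  split; first exact: finite_seq.
  by move=> k /= /mapP[i _ ->]; exact/eqP/low_kap_neq0.
rewrite -fsbig_seq; last by rewrite (map_inj_uniq low_kap_inj) enum_uniq.
rewrite big_map big_enum sumEFin lee_fin le_eqVlt; apply/orP; left; apply/eqP.
apply: eq_bigr => i _.
have := fourier_coefE (low_kap i) measurable_component square_integrable_component.
by rewrite /nsq => -> /=; rewrite sqr_sqrtr // addr_ge0 // sqr_ge0.
Qed.

Lemma rough_decomp x : cube x -> f x - integ f = rough x + ctrig low_kap low_coef x.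
Proof. by move=> cx; rewrite /rough patchE mem_set //; ring. Qed.

End Truncation.

Lemma sigma2_ge0 (R : realType) (d : nat) (g : vec R d -> R) : L2 g -> 0 <= sigma2 g.
Proof.
move=> hg; have G2 := L2_mod1 hg.
by rewrite /sigma2 (integ_mod1 (measurable_funX 2 hg.1)) (integ_mod1 hg.1)
  -(variance_le G2) mean_sqr_ge0.
Qed.

Lemma sigmaSO2_ge0 (R : realType) (d : nat) (h : vec R d -> R) : (0 <= sigmaSO2 h)%E.
Proof.
apply: esum_ge0 => k _; rewrite lee_fin mulr_ge0 ?sqr_ge0 //.
by apply: sumr_ge0 => u _; apply: prodr_ge0.
Qed.

Lemma truncated_bound_le (R : realFieldType) (n l eps sg co w K x S : R) :
  1 <= n -> 1 / 2 <= l -> 0 <= eps -> 0 <= sg -> 0 <= w -> w <= S ->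
  co <= K * x -> 0 <= x -> 72 <= K ->
  18 / n * (2 * eps + 2 * sg) + co / n ^+ 2 * w <=
  36 * eps + K * (l / n * sg + x / n ^+ 2 * S).
Proof.
move=> n1 l2 e0 s0 w0 wS hco x0 K72.
have n0 : 0 < n by lra.
have i0 : 0 < n^-1 by rewrite invr_gt0.
have i1 : n^-1 <= 1 by rewrite invf_le1.
rewrite -exprVn; move: (n^-1) i0 i1 => v v0 v1.
have h1 : 0 <= (1 - v) * eps by rewrite mulr_ge0 // subr_ge0.
have h2 : 0 <= (K * l - 36) * (v * sg).
  apply: mulr_ge0; last by rewrite mulr_ge0 // ltW.
  have : 0 <= (K - 72) * l by apply: mulr_ge0; lra.
  by lra.
have h3 : 0 <= (K * x - co) * (v ^+ 2 * w).
  by rewrite mulr_ge0 ?subr_ge0 // mulr_ge0 ?sqr_ge0.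
have h4 : 0 <= (S - w) * (K * x * v ^+ 2).
  by rewrite mulr_ge0 ?subr_ge0 // !mulr_ge0 ?sqr_ge0 //; lra.
by lra.
Qed.

Theorem theorem3p5 (R : realType) :
  exists2 C0 : R, 0 < C0 &
  forall (C : R) (hC : C0 <= C) (Cdelta : R) (s : nat) (hs : (1 <= s)%N),
  exists2 K : R, 0 < K &
  forall (d : nat) (hd : (1 <= d)%N) (hsd : (s <= d)%N)
    (n T : nat) (hn : (2 <= n)%N) (hT : n = (2 ^ T)%N)
    (delta : nat -> nat -> R) (hdelta : admissible_failure Cdelta delta)
    (listing : {set 'I_(n ^ 2)} -> seq 'I_(n ^ 2))
    (hlisting : forall A, perm_eq (listing A) (enum A))
    (i : nat) (hi : (i < n)%N)
    (f : vec R d -> R) (hf : has_fourier_decomposition f),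
  (mean_sq_err (level C d n) (@first_weights R d s) delta listing T i f
     <= K%:E * error_bound s n f)%E.
Proof.
exists 2 => // C hC Cdelta s _.
have K72 := final_const_ge Cdelta s hC; set K := final_const _ _ _ in K72.
have K0 : 0 < K by apply: lt_le_trans K72.
exists K => // d hd hsd n T hn hT delta hdelta listing hlisting i hi f [f2 hconv].
set lhs := mean_sq_err _ _ _ _ _ _ _.
have hX := lnX_ge R hd hn; have hl := ln_n_ge R hn.
have n0 : (0 < n)%N by exact: ltnW.
have n1 : 1 <= n%:R :> R by rewrite ler1n.
have X0 : 0 < (ln (d * n)%:R : R) by apply: lt_le_trans hX.
(* With the positive constant moved to the left, the infimum is handled by bounding each
   decomposition separately. *)
rewrite muleC -lee_pdivrMr //; apply: le_ereal_inf_tmp => e [g [h [g2 hfirst fgh ->]]].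
rewrite lee_pdivrMr // muleC.
(* ln(dn)^(s+1)/n^2 is positive, so an infinite sigma_SO makes the right side infinite. *)
have [->|SOfin] := eqVneq (sigmaSO2 h) +oo%E.
  rewrite gt0_muley ?lte_fin; last by rewrite divr_gt0 ?exprn_gt0 // ltr0n.
  by rewrite addey // gt0_muley ?lte_fin // leey.
have : sigmaSO2 h \is a fin_num by rewrite ge0_fin_numE ?sigmaSO2_ge0 // ltey.
move=> /fineK hS; rewrite -hS -EFinM.
apply/lee_addgt0Pr => eps eps0.
pose D (M : nat) := (\int[unif R d]_(x in @cube R d)
  ((ComplexField.Normc.normc ((f x)%:C%C - fourier_sum f M x)) ^+ 2)%:E)%E.
(* Otherwise every truncation error exceeds eps/36 and so cannot tend to 0. The 36 is 18 from
   [mean_sq_err_le] times 2 from [mean_sqr_rough], with 1/n <= 1. *)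
have [M hM] : exists M, (D M <= (eps / 36)%:E)%E.
  apply: contrapT => /forallNP hM.
  have : ((eps / 36)%:E <= 0)%E.
    by apply: (cvge_to_ge hconv); apply: nearW => M; case: (leP (D M) (eps / 36)%:E) => [/hM|/ltW].
  by rewrite lee_fin leNgt divr_gt0.
pose tr := \int[unif R d]_x (f (mod1 x) - partial_sum M f x) ^+ 2.
have trle : tr <= eps / 36.
  by rewrite -lee_fin; exact: le_trans (truncation_error_le M f2) hM.
have hco := coefficient_le Cdelta hC hd hn hsd.
have hso := so_sum_le s M f2 g2 fgh.
have hrough := mean_sqr_rough M f2 g2 hfirst fgh.
have step := @mean_sq_err_le R d (level C d n) s n T i Cdelta delta listing hsd n0 hT hi
  hdelta hlisting _ _ _ (@low_kap_inj d s M) (@low_kap_neq0 d s M) (@low_kap_first d s M)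
  f _ (square_integrable_rough M f2 g2 hfirst fgh) (mean_rough s M h f2) (@rough_decomp R d s M f h).
apply: (le_trans step); rewrite -EFinD lee_fin.
apply: (@le_trans _ _ (18 / n%:R * (2 * tr + 2 * sigma2 g) +
  (2 + 256 * s%:R * (n%:R / 2 ^+ level C d n) + 16 * walk_factor d (level C d n) s n Cdelta * 121 ^+ s) /
    n%:R ^+ 2 * so_sum (@low_kap d s M) (low_coef h))).
  by rewrite lerD2r; apply: ler_wpM2l; first by rewrite divr_ge0.
apply: (@le_trans _ _ (36 * tr + K * (ln n%:R / n%:R * sigma2 g +
  ln (d * n)%:R ^+ s.+1 / n%:R ^+ 2 * fine (sigmaSO2 h)))).
  apply: truncated_bound_le => //.
  - exact: mean_sqr_ge0.
  - exact: sigma2_ge0.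
  - apply: sumr_ge0 => j _; apply: mulr_ge0; first exact: nsq_ge0.
    by apply: sumr_ge0 => u _; apply: prodr_ge0.
  - by rewrite -lee_fin hS.
  - by rewrite exprn_ge0 // ltW.
rewrite [leRHS]addrC lerD2r; move: trle; rewrite ler_pdivlMr // mulrC //.
Qed.
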